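(* Let $\Omega\subset\mathbb{R}^2$ be a bounded open convex set containing the origin in its interior, and let $\epsilon>0$. For $\vartheta\in[-\pi,\pi]$ let $A_\vartheta$ be the rotation by angle $\vartheta$ and $A_\vartheta\Omega=\{A_\vartheta x:x\in\Omega\}$. Then there is a function $\mathcal{C}_{\epsilon,\Omega}:[-\pi,\pi]\to[0,\infty]$ belonging to the weak-type space $L^{2,\infty}([-\pi,\pi])$ (in particular finite for almost every $\vartheta$) such that for all $\vartheta\in[-\pi,\pi]$, all $R\ge2$ and all $h$ with $1\le h\le R$, $$\mathcal{G}_{A_\vartheta\Omega}(R,h)\le \mathcal{C}_{\epsilon,\Omega}(\vartheta)\,R^{1/2}(\log R)^{1+\epsilon}.$$
   Context: For a bounded convex set $D$ and $t>0$ let $\mathcal{N}_D(t)=\mathrm{card}(tD\cap\mathbb{Z}^2)$, $E_D(t)=\mathcal{N}_D(t)-t^2\,\mathrm{area}(D)$, and $\mathcal{G}_D(R,h)=\big(\frac1h\int_R^{R+h}|E_D(t)|^2dt\big)^{1/2}$. A function $f$ lies in $L^{2,\infty}$ if $\sup_{s>0} s\cdot\mathrm{meas}\{|f|^2>s\}<\infty$. *)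

(* Defs.v *)
From HB Require Import structures.
From mathcomp Require Import all_boot all_order all_algebra.
From mathcomp Require Import finmap all_classical all_reals all_analysis measurable_realfun.
Set Implicit Arguments. Unset Strict Implicit. Unset Printing Implicit Defensive.
Import Order.TTheory GRing.Theory Num.Theory.
Import numFieldNormedType.Exports.
Local Open Scope classical_set_scope.
Local Open Scope ring_scope.
Local Open Scope fset_scope.
Local Open Scope ring_scope.

Section defs.
Variable R : realType.

Definition convex_set2 (D : set (R * R)) : Prop :=
  forall x y : R * R, D x -> D y -> forall l : R, 0 <= l <= 1 ->
    D ((1 - l) * x.1 + l * y.1, (1 - l) * x.2 + l * y.2).

Definition bounded_set2 (D : set (R * R)) : Prop :=
  exists M : R, forall x, D x -> `|x.1| <= M /\ `|x.2| <= M.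

Definition rot (th : R) (x : R * R) : R * R :=
  (cos th * x.1 - sin th * x.2, sin th * x.1 + cos th * x.2).

Definition rot_set (th : R) (D : set (R * R)) : set (R * R) := rot th @` D.

Definition lattice_pts (D : set (R * R)) (t : R) : set (int * int) :=
  [set p | exists2 x, D x & ((p.1)%:~R, (p.2)%:~R) = (t * x.1, t * x.2)].

(* N_D(t) = card (t D ∩ Z^2)  (finite for bounded D) *)
Definition Ncount (D : set (R * R)) (t : R) : R :=
  (#|` fset_set (lattice_pts D t)|)%:R.

Definition area (D : set (R * R)) : \bar R :=
  ((@lebesgue_measure R) \x (@lebesgue_measure R))%E D.

Definition Eerr (D : set (R * R)) (t : R) : R :=
  Ncount D t - t ^+ 2 * fine (area D).

Definition Gmean (D : set (R * R)) (r h : R) : \bar R :=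
  sqrte ((h^-1)%:E *
    \int[@lebesgue_measure R]_(t in [set` `[r, r + h]%R]) ((`|Eerr D t| ^+ 2)%:E))%E.

Definition weak_L2 (C : R -> \bar R) : Prop :=
  measurable_fun [set` `[(- pi), pi]%R] C /\
  exists M : R, forall s : R, 0 < s ->
    (s%:E * (@lebesgue_measure R)
        ([set th | [set` `[(- pi), pi]%R] th /\ (s%:E < C th ^+ 2)%E]) <= M%:E)%E.

End defs.

(* Main.v *)
(** Let [E] be the lattice point error of a convex set [D] squeezed between two
    discs. With [K] proportional to [cos (pi x) ^ 2N], [N = n ^ 2], normalised to
    mean value 1, [E (t)] is compared with the error of the smoothed count
    [int_(tD) K(x) K(y)]: as [K] concentrates near the integers, inclusions
    between dilates of [D] sandwich the first error between values of the second
    at [t +- O(n ^ -1/2)], up to [O(n ^ 1/2)]. Expanding the trigonometric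
    polynomial, the smoothed error is [t ^ 2] times a sum over [k <> 0] of cosine
    transforms, at the frequency [t], of the chord length [A_k(s)] of [D] on the
    line [k . z = s]. This function is concave on [0 <= s < a_k], where [a_k] is
    the support function of [D] at [k], and vanishes beyond.

    Taking second differences with the step [h = 1 / 2n] multiplies the cosine
    transform by a factor bounded below near [t = n]. If squared chords are at
    most [f_k] times their depth, [A_k(s) <= V_k (a_k - s) ^ 1/2] with
    [V_k ^ 2 = f_k / |k| ^ 3], and the second difference has mass [O(V_k h ^ 3/2)]
    near [a_k] and [O(V_k h ^ 2)] elsewhere. The parts near [a_k] oscillate at
    frequency about [a_k], hence are almost orthogonal on [[n, n + 1]] (Schur's
    test, with [O(j)] vectors [k] having [a_k] in [[j, j + 1[]); the other parts
    are summed by Cauchy-Schwarz. This bounds the integral of [E ^ 2] over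
    [[n, n + 1]] by [O(n)] times the sum of [f_k / |k| ^ 2] over
    [0 < |k| <= n ^ 2].

    For the rotated set one can take [f_k = F (alpha_k - theta)], with [alpha_k]
    the angle of [k] and [F] the supremum of the second difference quotients of
    the support function on the circle. Since the derivative of that function has
    bounded variation, [F] is controlled by the maximal function of a finite
    measure and the Vitali covering lemma puts it in weak [L^1]. Grouping [k] into
    dyadic shells with the weights [(m + 1) ^ -(2 + 2 eps)], the Stein-Weiss lemma
    gives a weak [L^1] function of [theta] that dominates the sums over [k] up to
    [(log R) ^ (2 + 2 eps)]. *)
Require Import Defs.
From HB Require Import structures.
From mathcomp Require Import all_boot all_order all_algebra.
From mathcomp Require Import finmap all_classical all_reals all_analysis measurable_realfun.
From mathcomp Require Import ring lra zify.
Import Order.TTheory GRing.Theory Num.Theory.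
Import numFieldNormedType.Exports.
Set Implicit Arguments. Unset Strict Implicit. Unset Printing Implicit Defensive.
Local Open Scope classical_set_scope.
Local Open Scope ring_scope.

(** * Integrals of bounded functions with bounded support *)

(** The scales are dictated by the target. Sandwiching at distance [eta] changes the area of [tD] by
    a multiple of [n * eta], which may not exceed [n^(1/2)]; hence [eta = n^(-1/2) / 4]. Beyond
    [eta] the kernel must be negligible even against its own peak: for [N = n^2] the peak is at most
    [2n] and the relative decay at [eta] is [exp(- n / 16)]. The price, frequencies up to [n^2], is
    not felt by a logarithm. The obstacle is that [Omega] is merely convex: no curvature bound is
    uniform in the direction, and at the normal to a flat side the flatness is infinite. Only its
    weak-type behaviour in the angle survives, and adding weak [L^1] functions costs a logarithm.
    The exponent [2 + 2 eps] is [1] from Stein-Weiss plus [1 + 2 eps] from making the dyadic shells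
    summable. [C] is the square root of a weak [L^1] function, which gives weak [L^2] and the
    exponent [1 + eps]. All estimates live on unit intervals, so [h] enters only through their
    number, at most [3h]. *)

Section AffineLebesgue.
Context {R : realType}.
Notation mu := (@lebesgue_measure R).

(** The right-hand side is a measure in [A], so uniqueness reduces the claim to intervals []u, v]].
    For [a < 0] the preimage is closed at the other end, which does not change its length. *)
Lemma lebesgue_measure_affine (a b : R) (A : set R) : a != 0 -> measurable A ->
  mu A = (`|a|%:E * mu ((fun x : R => a * x + b)%R @^-1` A))%E.
Proof.
move=> a0 mA.
pose phi : measurableTypeR R -> measurableTypeR R := fun x => a * x + b.
have mphi : measurable_fun setT phi.
  by apply: measurable_funD => //; apply: measurable_funM.
pose nu m := mscale (NngNum (normr_ge0 a)) (pushforward mu phi) m.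
have -> : (`|a|%:E * mu ((fun x : R => a * x + b)%R @^-1` A))%E = nu mphi A by [].
apply: lebesgue_measure_unique => //= _ [[u v]] _ <-.
change (mu `]u, v] = (`|a|%:E * mu (phi @^-1` `]u, v]%classic))%E).
have [a1|a1] := ltP 0 a.
  have -> : phi @^-1` `]u, v]%classic = `](u - b) / a, (v - b) / a]%classic.
    apply/seteqP; split => x /=; rewrite !in_itv/= /phi ltr_pdivrMr// ler_pdivlMr// ltrBlDr lerBrDr mulrC//.
  rewrite !lebesgue_measure_itv/= !lte_fin ltr_pM2r ?invr_gt0// ltrD2r.
  case: ifP => _; last by rewrite mule0.
  by rewrite -!EFinB -EFinM gtr0_norm//; congr EFin; field.
have {}a1 : a < 0 by rewrite lt_neqAle a0.
have -> : phi @^-1` `]u, v]%classic = `[(v - b) / a, (u - b) / a[%classic.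
  apply/seteqP; split => x /=; rewrite !in_itv/= /phi ltr_ndivlMr// ler_ndivrMr// ltrBlDr lerBrDr ![x * a]mulrC andbC//.
rewrite !lebesgue_measure_itv/= !lte_fin ltr_nM2r ?invr_lt0// ltrD2r.
case: ifP => _; last by rewrite mule0.
by rewrite -!EFinB -EFinM ltr0_norm//; congr EFin; field.
Qed.

Lemma ge0_integral_affine (a b : R) (f : R -> R) : a != 0 ->
  measurable_fun setT f -> (forall x, 0 <= f x) ->
  (\int[mu]_x (f (a * x + b))%:E = `|a|^-1%:E * \int[mu]_x (f x)%:E)%E.
Proof.
move=> a0 mf f0.
pose phi : measurableTypeR R -> measurableTypeR R := fun x => a * x + b.
have mphi : measurable_fun setT phi.
  by apply: measurable_funD => //; apply: measurable_funM.
have /= := @ge0_integral_pushforward _ _ _ _ _ phi mphi mu setT (EFin \o f) measurableT.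
rewrite preimage_setT => <- //; last first.
- by move=> y _; rewrite lee_fin.
- exact/measurable_EFinP.
pose nu m := mscale (NngNum (normr_ge0 a)) (pushforward mu phi) m.
have <- : (\int[nu mphi]_x (f x)%:E = \int[mu]_x (f x)%:E)%E.
  apply: eq_measure_integral => A mA _.
  by rewrite [RHS](lebesgue_measure_affine b a0).
rewrite /nu ge0_integral_mscale//; last 2 first.
- exact/measurable_EFinP.
- by move=> x _; rewrite lee_fin.
by rewrite muleA -EFinM mulVf ?normr_eq0// mul1e.
Qed.

End AffineLebesgue.

Section BoundedSupport.
Context {R : realType}.
Notation mu := (@lebesgue_measure R).
Notation mu2 := (mu \x mu)%E.

Lemma bounded_support_integrable d (T : measurableType d)
    (m : {measure set T -> \bar R}) (S : set T) (f : T -> R) (M : R) :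
  measurable S -> (m S < +oo)%E -> measurable_fun setT f ->
  (forall x, `|f x| <= M) -> (forall x, ~ S x -> f x = 0) ->
  m.-integrable setT (EFin \o f).
Proof.
move=> mS Sfin mf fM fS.
have -> : EFin \o f = (EFin \o f) \_ S.
  apply/funext => x /=; rewrite patchE; case: ifPn => // /negP xS.
  by rewrite /= fS// => Sx; apply: xS; rewrite inE.
rewrite -integrable_mkcond//; apply: measurable_bounded_integrable => //.
  exact: measurable_funTS.
exists M; split; first exact: num_real.
by move=> x Mx y _ /=; exact: le_trans (fM y) (ltW Mx).
Qed.

(* Every integrand below is in one of these two classes, so that integrability
   and Fubini's theorem are always available. *)
Definition bs1 (f : R -> R) := measurable_fun setT f /\
  exists M, forall x, `|f x| <= M /\ (M < `|x| -> f x = 0).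

Definition bs2 (f : R * R -> R) := measurable_fun setT f /\
  exists M, forall z, `|f z| <= M /\ (M < `|z.1| \/ M < `|z.2| -> f z = 0).

Lemma bs1_integrable f : bs1 f -> mu.-integrable setT (EFin \o f).
Proof.
move=> [mf [M fM]].
apply: (@bounded_support_integrable _ _ mu `[- M, M]%classic f M) => //.
- by rewrite /= lebesgue_measure_itv/=; case: ifP => _; rewrite ?ltry// -EFinB ltry.
- by move=> x; exact: (fM x).1.
- move=> x /= /negP; rewrite in_itv/= -ler_norml -ltNge => h.
  exact: (fM x).2.
Qed.

Lemma bs2_integrable f : bs2 f -> mu2.-integrable setT (EFin \o f).
Proof.
move=> [mf [M fM]].
apply: (@bounded_support_integrable _ _ mu2 (`[- M, M]%classic `*` `[- M, M]%classic) f M) => //.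
- exact: measurableX.
- rewrite /= product_measure1E//= lebesgue_measure_itv/=; case: ifP => _.
    by rewrite -EFinB -EFinM ltry.
  by rewrite mule0 ltry.
- by move=> x; exact: (fM x).1.
- move=> x /= /not_andP h; apply: (fM x).2.
  by case: h => /negP; rewrite in_itv/= -ler_norml -ltNge => h; [left|right].
Qed.

Lemma bs1D f g : bs1 f -> bs1 g -> bs1 (fun x => f x + g x).
Proof.
move=> [mf [M fM]] [mg [N gN]]; split; first exact: measurable_funD.
exists (M + N) => x.
have M0 : 0 <= M by exact: le_trans (normr_ge0 _) (fM 0).1.
have N0 : 0 <= N by exact: le_trans (normr_ge0 _) (gN 0).1.
split; first by rewrite (le_trans (ler_normD _ _))// lerD ?(fM x).1 ?(gN x).1.
move=> h; rewrite (fM x).2 ?(gN x).2 ?addr0//; lra.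
Qed.

Lemma bs1M (f g : R -> R) M : bs1 f -> measurable_fun setT g -> (forall x, `|g x| <= M) ->
  bs1 (fun x => g x * f x).
Proof.
move=> [mf [N fN]] mg gM; split; first exact: measurable_funM.
have M0 : 0 <= M by exact: le_trans (normr_ge0 _) (gM 0).
have N0 : 0 <= N by exact: le_trans (normr_ge0 _) (fN 0).1.
exists (M * N + N) => x; split.
  rewrite normrM (@le_trans _ _ (M * N))//; last by rewrite lerDl.
  by rewrite ler_pM// (fN x).1.
move=> h; rewrite (fN x).2 ?mulr0//; apply: le_lt_trans h.
by rewrite lerDr mulr_ge0.
Qed.

Lemma bs1Z c f : bs1 f -> bs1 (fun x => c * f x).
Proof. by move=> bf; apply: (@bs1M _ (fun _ => c) `|c|). Qed.

Lemma bs10 : bs1 (fun _ => 0).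
Proof. by split=> //; exists 0 => x; rewrite normr0. Qed.

Lemma bs1B f g : bs1 f -> bs1 g -> bs1 (fun x => f x - g x).
Proof.
move=> bf bg; have := bs1D bf (bs1Z (-1) bg).
by under [X in bs1 X -> _]eq_fun do rewrite mulN1r.
Qed.

Lemma bs1_sum (I : Type) (s : seq I) (P : pred I) (f : I -> R -> R) :
  (forall i, bs1 (f i)) -> bs1 (fun x => \sum_(i <- s | P i) f i x).
Proof.
move=> bf; elim: s => [|i s IH].
  by under eq_fun do rewrite big_nil; exact: bs10.
under eq_fun do rewrite big_cons; case: (P i) => //; exact: bs1D.
Qed.

Lemma bs1_norm f : bs1 f -> bs1 (fun x => `|f x|).
Proof.
move=> [mf [M fM]]; split; first exact: measurableT_comp.
by exists M => x; rewrite normr_id; split; [exact: (fM x).1|move=> /((fM x).2) ->; rewrite normr0].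
Qed.

Lemma bs1_affine a b f : a != 0 -> bs1 f -> bs1 (fun x => f (a * x + b)).
Proof.
move=> a0 [mf [M fM]]; split.
  by apply: measurableT_comp => //; apply: measurable_funD => //; apply: measurable_funM.
have M0 : 0 <= M by exact: le_trans (normr_ge0 _) (fM 0).1.
exists (M + (M + `|b|) / `|a|) => x; split.
  by rewrite (le_trans (fM _).1)// lerDl divr_ge0// addr_ge0.
move=> h; apply: (fM _).2.
have {}h : (M + `|b|) / `|a| < `|x| by lra.
rewrite ltr_pdivrMr ?normr_gt0// -normrM in h.
have := ler_normD (a * x + b) (- b); rewrite addrK normrN mulrC; lra.
Qed.

Lemma bs1_indic (a b : R) (b0 b1 : bool) : bs1 (\1_[set` Interval (BSide b0 a) (BSide b1 b)]).
Proof.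
split; first exact: measurable_indic.
exists (1 + (`|a| + `|b|)) => x; rewrite indicE; split.
  by case: (_ \in _); rewrite ?normr1 ?normr0; have := normr_ge0 a; have := normr_ge0 b; lra.
move=> h; rewrite memNset//= in_itv => xab.
have h1 : a <= x <= b by case: b0 b1 xab => -[] /= /andP[]; lra.
have := ler_norm a; have := ler_norm b; have := ler_norm (- a); have := ler_norm (- b).
rewrite !normrN; move: h; rewrite ltr_normr; lra.
Qed.

Lemma int1D f g : bs1 f -> bs1 g ->
  \int[mu]_x (f x + g x) = \int[mu]_x f x + \int[mu]_x g x.
Proof. by move=> bf bg; rewrite RintegralD//; exact: bs1_integrable. Qed.

Lemma int1B f g : bs1 f -> bs1 g ->
  \int[mu]_x (f x - g x) = \int[mu]_x f x - \int[mu]_x g x.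
Proof. by move=> bf bg; rewrite RintegralB//; exact: bs1_integrable. Qed.

Lemma int1Z c f : bs1 f -> \int[mu]_x (c * f x) = c * \int[mu]_x f x.
Proof. by move=> bf; rewrite RintegralZl//; exact: bs1_integrable. Qed.

Lemma int10 : \int[mu]_x (0 : R) = 0.
Proof. by rewrite /Rintegral integral0. Qed.

Lemma int1_sum (I : Type) (s : seq I) (P : pred I) (f : I -> R -> R) :
  (forall i, bs1 (f i)) ->
  \int[mu]_x (\sum_(i <- s | P i) f i x) = \sum_(i <- s | P i) \int[mu]_x f i x.
Proof.
move=> bf; elim: s => [|i s IH].
  by under eq_Rintegral do rewrite big_nil; rewrite big_nil int10.
rewrite big_cons -IH; under eq_Rintegral do rewrite big_cons.
by case: ifP => // _; rewrite int1D//; exact: bs1_sum.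
Qed.

Lemma le_int1 f g : bs1 f -> bs1 g -> (forall x, f x <= g x) ->
  \int[mu]_x f x <= \int[mu]_x g x.
Proof. by move=> bf bg fg; apply: le_Rintegral => //; exact: bs1_integrable. Qed.

Lemma int1_ge0 (f : R -> R) : (forall x, 0 <= f x) -> 0 <= \int[mu]_x f x.
Proof. by move=> f0; apply: Rintegral_ge0. Qed.

Lemma int1_norm f : bs1 f -> `|\int[mu]_x f x| <= \int[mu]_x `|f x|.
Proof. by move=> bf; apply: le_normr_Rintegral => //; exact: bs1_integrable. Qed.

Lemma int1_affine a b f : a != 0 -> bs1 f ->
  \int[mu]_x f (a * x + b) = `|a|^-1 * \int[mu]_x f x.
Proof.
move=> a0 bf.
(* The change of variables was obtained for nonnegative integrands; [f] is the difference of the two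
   nonnegative functions [f1] and [f2]. *)
pose f1 x := (`|f x| + f x).
pose f2 x := `|f x|.
have b2 : bs1 f2 by exact: bs1_norm.
have b1 : bs1 f1 by exact: bs1D.
have fE x : f x = f1 x - f2 x by rewrite /f1 /f2; ring.
have key g : bs1 g -> (forall x, 0 <= g x) ->
    \int[mu]_x g (a * x + b) = `|a|^-1 * \int[mu]_x g x.
  move=> bg g0; rewrite /Rintegral (ge0_integral_affine b a0 bg.1 g0).
  by rewrite fineM//; apply: integrable_fin_num => //; exact: bs1_integrable.
under eq_Rintegral do rewrite fE.
under [in RHS]eq_Rintegral do rewrite fE.
rewrite int1B; [|exact: bs1_affine|exact: bs1_affine].
rewrite int1B// mulrBr !key//; first by move=> x; exact: normr_ge0.
by move=> x; rewrite /f1; have := ler_norm (- f x); rewrite normrN; lra.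
Qed.

Lemma int1_shift b f : bs1 f -> \int[mu]_x f (x + b) = \int[mu]_x f x.
Proof.
move=> bf; have := int1_affine b (oner_neq0 _) bf.
by rewrite normr1 invr1 mul1r => <-; under [in RHS]eq_Rintegral do rewrite mul1r.
Qed.

Lemma int1_indic (a b : R) (b0 b1 : bool) : a <= b ->
  \int[mu]_x \1_[set` Interval (BSide b0 a) (BSide b1 b)] x = b - a.
Proof.
move=> ab; rewrite /Rintegral integral_indic// setIT /= lebesgue_measure_itv/= lte_fin.
by case: ltgtP ab => [//|//|->]; rewrite ?subrr// ?ltxx.
Qed.

End BoundedSupport.

(** * Fubini's theorem and linear changes of variables in the plane *)

Section TwoDim.
Context {R : realType}.
Notation mu := (@lebesgue_measure R).
Notation mu2 := (mu \x mu)%E.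

Lemma bs2_section1 (F : R * R -> R) x : bs2 F -> bs1 (fun y => F (x, y)).
Proof.
move=> [mF [M FM]]; split; first exact: measurableT_comp (pair1_measurable x).
by exists M => y; split; [exact: (FM _).1|move=> h; apply: (FM _).2; right].
Qed.

Lemma bs2_section2 (F : R * R -> R) y : bs2 F -> bs1 (fun x => F (x, y)).
Proof.
move=> [mF [M FM]]; split; first exact: measurableT_comp (pair2_measurable y).
by exists M => x; split; [exact: (FM _).1|move=> h; apply: (FM _).2; left].
Qed.

Lemma EFin_int1 (f : R -> R) : bs1 f ->
  (\int[mu]_x f x)%:E = (\int[mu]_x (f x)%:E)%E.
Proof. by move=> bf; rewrite fineK//; apply: integrable_fin_num => //; exact: bs1_integrable. Qed.

Lemma int2_fubini1 (F : R * R -> R) : bs2 F ->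
  \int[mu2]_z F z = \int[mu]_x \int[mu]_y F (x, y).
Proof.
move=> bF; have h := bs2_integrable bF; rewrite {1 2}/Rintegral; congr fine.
rewrite -(integral12_prod_meas1 h).
by apply: eq_integral => x _; rewrite (EFin_int1 (bs2_section1 x bF)).
Qed.

Lemma int2_fubini2 (F : R * R -> R) : bs2 F ->
  \int[mu2]_z F z = \int[mu]_y \int[mu]_x F (x, y).
Proof.
move=> bF; have h := bs2_integrable bF; rewrite {1 2}/Rintegral; congr fine.
rewrite -(integral21_prod_meas1 h).
by apply: eq_integral => x _; rewrite (EFin_int1 (bs2_section2 x bF)).
Qed.

(** One constant bounds both the values and the support; this is what keeps partial integrals of
    [bs2] functions in the class [bs1]. *)
Lemma int1_bound (f : R -> R) M : measurable_fun setT f ->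
  (forall x, `|f x| <= M /\ (M < `|x| -> f x = 0)) ->
  `|\int[mu]_x f x| <= 2 * M ^+ 2.
Proof.
move=> mf fM.
have M0 : 0 <= M by exact: le_trans (normr_ge0 _) (fM 0).1.
have bf : bs1 f by split => //; exists M.
apply: le_trans (int1_norm bf) _.
have bi := @bs1_indic R (- M) M true false.
apply: (@le_trans _ _ (\int[mu]_x (M * \1_[set` `[- M, M]] x))).
  apply: le_int1; [exact: bs1_norm|exact: bs1Z|move=> x].
  rewrite indicE; case: (boolP (x \in _)) => /= h; first by rewrite mulr1 (fM x).1.
  rewrite mulr0 (fM x).2 ?normr0// ltNge ler_norml; apply: contra h => h.
  by rewrite inE/= in_itv.
rewrite int1Z// int1_indic; last lra.
by rewrite le_eqVlt; apply/orP; left; apply/eqP; ring.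
Qed.

Lemma bs2_int1 (F : R * R -> R) : bs2 F -> bs1 (fun x => \int[mu]_y F (x, y)).
Proof.
move=> bF; have [mF [M FM]] := bF; split.
  apply/measurable_EFinP.
  have -> : EFin \o (fun x => \int[mu]_y F (x, y)) = fubini_F mu (EFin \o F).
    by apply/funext => x /=; rewrite EFin_int1//; exact: bs2_section1.
  exact: measurable_fubini_F (bs2_integrable bF).
have M0 : 0 <= M by exact: le_trans (normr_ge0 _) (FM (0, 0)).1.
exists (M + 2 * M ^+ 2) => x; split.
  apply: le_trans (int1_bound (f := fun y => F (x, y)) (M := M) _ _) _.
  - exact: (bs2_section1 x bF).1.
  - by move=> y; split; [exact: (FM _).1|move=> h; apply: (FM _).2; right].
  - by rewrite lerDr.
move=> h; have Fx y : F (x, y) = 0.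
  by apply: (FM _).2; left => /=; apply: le_lt_trans h; rewrite lerDl; nra.
under eq_Rintegral do rewrite Fx; exact: int10.
Qed.

Lemma bs2_swap (F : R * R -> R) : bs2 F -> bs2 (fun z => F (z.2, z.1)).
Proof.
move=> [mF [M FM]]; split; first exact: measurableT_comp mF (measurable_fun_pair measurable_snd measurable_fst).
by exists M => z; split; [exact: (FM _).1|move=> h; apply: (FM _).2 => /=; tauto].
Qed.

Lemma bs2_int2 (F : R * R -> R) : bs2 F -> bs1 (fun y => \int[mu]_x F (x, y)).
Proof. by move=> /bs2_swap/bs2_int1. Qed.

Lemma int2_swap (F : R * R -> R) : bs2 F -> \int[mu2]_z F (z.2, z.1) = \int[mu2]_z F z.
Proof. by move=> bF; rewrite int2_fubini1 ?int2_fubini2//; exact: bs2_swap. Qed.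

Lemma measurable_lin2 (a b : R) : measurable_fun setT (fun z : R * R => a * z.1 + b * z.2).
Proof.
by apply: measurable_funD; apply: measurable_funM => //.
Qed.

Lemma bs2_lin (u1 v1 u2 v2 : R) (F : R * R -> R) : u1 * v2 - u2 * v1 != 0 -> bs2 F ->
  bs2 (fun z => F (u1 * z.1 + v1 * z.2, u2 * z.1 + v2 * z.2)).
Proof.
set d := _ - _ => d0 [mF [M FM]]; split.
  by apply: measurableT_comp mF _; apply: measurable_fun_pair; exact: measurable_lin2.
have M0 : 0 <= M by exact: le_trans (normr_ge0 _) (FM (0, 0)).1.
pose S := `|u1| + `|u2| + `|v1| + `|v2|.
have S0 : 0 <= S by rewrite !addr_ge0.
exists (M + M * S / `|d|) => z; split.
  by rewrite (le_trans (FM _).1)// lerDl divr_ge0 ?mulr_ge0.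
move=> h; apply: (FM _).2 => /=.
set p := u1 * z.1 + _; set q := u2 * z.1 + _.
have [hp|hp] := ltP M `|p|; first by left.
have [hq|hq] := ltP M `|q|; first by right.
have e1 : z.1 = (v2 * p - v1 * q) / d by rewrite /p /q /d; field.
have e2 : z.2 = (u1 * q - u2 * p) / d by rewrite /p /q /d; field.
have bnd (a b x y : R) : `|a| + `|b| <= S -> `|x| <= M -> `|y| <= M ->
    `|(a * x - b * y) / d| <= M + M * S / `|d|.
  move=> ab xM yM; rewrite normrM normfV.
  rewrite (@le_trans _ _ (M * S / `|d|)) ?lerDr// ler_pM2r ?invr_gt0 ?normr_gt0//.
  rewrite (le_trans (ler_normB _ _))// !normrM.
  have := ler_wpM2l (normr_ge0 a) xM; have := ler_wpM2l (normr_ge0 b) yM; nra.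
case: h; rewrite ltNge => /negP []; [rewrite e1|rewrite e2]; apply: bnd => //; rewrite /S;
  have := normr_ge0 u1; have := normr_ge0 u2; have := normr_ge0 v1; have := normr_ge0 v2; lra.
Qed.

(** Gaussian elimination: when [u1] is nonzero, substituting in the first variable leaves the pivot
    [d / u1] for the second, so two one-dimensional substitutions suffice. When [u1 = 0] the two
    rows are exchanged. *)
Lemma int2_lin (u1 v1 u2 v2 : R) (F : R * R -> R) : u1 * v2 - u2 * v1 != 0 -> bs2 F ->
  \int[mu2]_z F (u1 * z.1 + v1 * z.2, u2 * z.1 + v2 * z.2) =
  `|u1 * v2 - u2 * v1|^-1 * \int[mu2]_z F z.
Proof.
wlog u1n0 : u1 v1 u2 v2 F / u1 != 0.
  move=> H d0 bF; have [u10|] := eqVneq u1 0; last by move=> h; exact: H.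
  have u20 : u2 != 0 by apply: contra_neq d0 => ->; rewrite u10 !mul0r subrr.
  have d1 : u2 * v1 - u1 * v2 != 0 by rewrite -oppr_eq0 opprB.
  have := H u2 v2 u1 v1 _ u20 d1 (bs2_swap bF).
  by rewrite int2_swap// -normrN opprB => <-.
set d := _ - _ => d0 bF.
have bT := bs2_lin d0 bF.
have bG : bs2 (fun z : R * R => F (z.1, u2 / u1 * z.1 + d / u1 * z.2)).
  have h : 1 * (d / u1) - u2 / u1 * 0 != 0 by rewrite mul1r mulr0 subr0 mulf_neq0// invr_eq0.
  have := bs2_lin h bF.
  by under [X in bs2 X -> _]eq_fun do rewrite mul1r mul0r addr0.
rewrite (int2_fubini2 bT)/=.
transitivity (\int[mu]_y (`|u1|^-1 * \int[mu]_x F (x, u2 / u1 * x + d / u1 * y))).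
  apply: eq_Rintegral => y _.
  rewrite -(int1_affine (v1 * y) u1n0 (bs2_section2 y bG))/=.
  by apply: eq_Rintegral => x _; congr (F (_, _)); rewrite /d; field.
rewrite int1Z; last exact: (bs2_int2 bG).
rewrite -(int2_fubini2 bG) (int2_fubini1 bG) (int2_fubini1 bF)/=.
transitivity (`|u1|^-1 * \int[mu]_x (`|d / u1|^-1 * \int[mu]_y F (x, y))).
  congr (_ * _); apply: eq_Rintegral => x _.
  have du : d / u1 != 0 by rewrite mulf_neq0// invr_eq0.
  rewrite -(int1_affine (u2 / u1 * x) du (bs2_section1 x bF)).
  by apply: eq_Rintegral => y _; rewrite addrC.
rewrite int1Z; last exact: (bs2_int1 bF).
rewrite mulrA; congr (_ * _); rewrite normrM normfV; field.
by rewrite !normr_eq0 u1n0 d0.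
Qed.

Lemma bs2D (f g : R * R -> R) : bs2 f -> bs2 g -> bs2 (fun x => f x + g x).
Proof.
move=> [mf [M fM]] [mg [N gN]]; split; first exact: measurable_funD.
exists (M + N) => x.
have M0 : 0 <= M by exact: le_trans (normr_ge0 _) (fM (0,0)).1.
have N0 : 0 <= N by exact: le_trans (normr_ge0 _) (gN (0,0)).1.
split; first by rewrite (le_trans (ler_normD _ _))// lerD ?(fM x).1 ?(gN x).1.
move=> h; rewrite (fM x).2 ?(gN x).2 ?addr0//; case: h; lra.
Qed.

Lemma bs2M (f g : R * R -> R) M : bs2 f -> measurable_fun setT g -> (forall x, `|g x| <= M) ->
  bs2 (fun x => g x * f x).
Proof.
move=> [mf [N fN]] mg gM; split; first exact: measurable_funM.
have M0 : 0 <= M by exact: le_trans (normr_ge0 _) (gM (0,0)).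
have N0 : 0 <= N by exact: le_trans (normr_ge0 _) (fN (0,0)).1.
exists (M * N + N) => x; split.
  rewrite normrM (@le_trans _ _ (M * N))//; last by rewrite lerDl.
  by rewrite ler_pM// (fN x).1.
have MN : 0 <= M * N by rewrite mulr_ge0.
move=> h; rewrite (fN x).2 ?mulr0//; case: h; lra.
Qed.

Lemma bs2Z c f : bs2 f -> bs2 (fun x : R * R => c * f x).
Proof. by move=> bf; apply: (@bs2M _ (fun _ => c) `|c|). Qed.

Lemma bs20 : bs2 (fun _ => 0 : R).
Proof. by split=> //; exists 0 => x; rewrite normr0. Qed.

Lemma bs2_sum (I : Type) (s : seq I) (P : pred I) (f : I -> R * R -> R) :
  (forall i, bs2 (f i)) -> bs2 (fun x => \sum_(i <- s | P i) f i x).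
Proof.
move=> bf; elim: s => [|i s IH].
  by under eq_fun do rewrite big_nil; exact: bs20.
under eq_fun do rewrite big_cons; case: (P i) => //; exact: bs2D.
Qed.

Lemma bs2_prod (f g : R -> R) : bs1 f -> bs1 g -> bs2 (fun z => f z.1 * g z.2).
Proof.
move=> [mf [M fM]] [mg [N gN]]; split.
  by apply: measurable_funM; apply: measurableT_comp => //.
have M0 : 0 <= M by exact: le_trans (normr_ge0 _) (fM 0).1.
have N0 : 0 <= N by exact: le_trans (normr_ge0 _) (gN 0).1.
have MN : 0 <= M * N by rewrite mulr_ge0.
exists (M * N + (M + N)) => z; split.
  rewrite normrM (@le_trans _ _ (M * N)) ?lerDl ?addr_ge0//.
  by rewrite ler_pM ?(fM _).1 ?(gN _).1.
by case => h; [rewrite (fM _).2 ?mul0r|rewrite (gN _).2 ?mulr0] => //; lra.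
Qed.

Lemma int2_prod (f g : R -> R) : bs1 f -> bs1 g ->
  \int[mu2]_z (f z.1 * g z.2) = (\int[mu]_x f x) * (\int[mu]_x g x).
Proof.
move=> bf bg; rewrite int2_fubini1/=; last exact: bs2_prod.
rewrite mulrC -int1Z//; apply: eq_Rintegral => x _.
by rewrite int1Z// mulrC.
Qed.

Lemma int2D (f g : R * R -> R) : bs2 f -> bs2 g ->
  \int[mu2]_x (f x + g x) = \int[mu2]_x f x + \int[mu2]_x g x.
Proof. by move=> bf bg; rewrite RintegralD//; exact: bs2_integrable. Qed.

Lemma int2Z c (f : R * R -> R) : bs2 f -> \int[mu2]_x (c * f x) = c * \int[mu2]_x f x.
Proof. by move=> bf; rewrite RintegralZl//; exact: bs2_integrable. Qed.

Lemma int20 : \int[mu2]_x (0 : R) = 0.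
Proof. by rewrite /Rintegral integral0. Qed.

Lemma int2_sum (I : Type) (s : seq I) (P : pred I) (f : I -> R * R -> R) :
  (forall i, bs2 (f i)) ->
  \int[mu2]_x (\sum_(i <- s | P i) f i x) = \sum_(i <- s | P i) \int[mu2]_x f i x.
Proof.
move=> bf; elim: s => [|i s IH].
  by under eq_Rintegral do rewrite big_nil; rewrite big_nil int20.
rewrite big_cons -IH; under eq_Rintegral do rewrite big_cons.
by case: ifP => // _; rewrite int2D//; exact: bs2_sum.
Qed.

Lemma le_int2 (f g : R * R -> R) : bs2 f -> bs2 g -> (forall x, f x <= g x) ->
  \int[mu2]_x f x <= \int[mu2]_x g x.
Proof. by move=> bf bg fg; apply: le_Rintegral => //; exact: bs2_integrable. Qed.

Lemma int2_ge0 (f : R * R -> R) : (forall x, 0 <= f x) -> 0 <= \int[mu2]_x f x.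
Proof. by move=> f0; apply: Rintegral_ge0. Qed.

Lemma bs2_indic (D : set (R * R)) : measurable D -> bounded_set2 D -> bs2 (\1_D).
Proof.
move=> mD [M DM]; split; first exact: measurable_indic.
exists (`|M| + 1) => z; rewrite indicE; split.
  by case: (_ \in _); rewrite ?normr1 ?normr0; have := normr_ge0 M; lra.
move=> h; rewrite memNset// => /DM [h1 h2]; have := ler_norm M.
case: h; lra.
Qed.

Lemma int2_indic (D : set (R * R)) : measurable D ->
  \int[mu2]_z \1_D z = fine (area D).
Proof. by move=> mD; rewrite /Rintegral integral_indic// setIT. Qed.

(** The sigma-algebra of the plane is the product one, so an open set is written as a countable
    union of boxes with rational corners. *)
Lemma open_measurable2 (U : set (R * R)) : open U -> measurable U.
Proof.
move=> oU.
pose B (p : (rat * rat) * (rat * rat)) : set (R * R) :=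
  `](ratr p.1.1 : R), (ratr p.1.2 : R)[%classic `*` `](ratr p.2.1 : R), (ratr p.2.2 : R)[%classic.
pose I := [set p | B p `<=` U].
have -> : U = \bigcup_(p in I) B p.
  apply/seteqP; split; last by move=> z [p Ip Bp]; exact: Ip.
  move=> [x y] Uz.
  have /nbhs_ballP [e /= e0 eU] := open_nbhs_nbhs (conj oU Uz).
  have rr (w : R) : exists a b : rat, [/\ w - e < ratr a, ratr a < w, w < ratr b & ratr b < w + e].
    have h1 : w - e < w by rewrite ltrBlDr ltrDl.
    have h2 : w < w + e by rewrite ltrDl.
    have [a /[!in_itv]/= /andP[a1 a2]] := rat_in_itvoo h1.
    have [b /[!in_itv]/= /andP[b1 b2]] := rat_in_itvoo h2.
    by exists a, b.
  have [a [b [xa1 xa2 xb1 xb2]]] := rr x.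
  have [c [d [yc1 yc2 yd1 yd2]]] := rr y.
  exists ((a, b), (c, d)); last by split => /=; rewrite in_itv/= ?xa2 ?yc2.
  move=> [x' y'] [/=]; rewrite !in_itv/= => /andP[h1 h2] /andP[h3 h4].
  apply: eU; split; rewrite /ball/= ltr_norml; lra.
rewrite bigcup_mkcond; apply: countable_bigcupT_measurable => [|p]; first exact: countableP.
by case: ifP => // _; exact: measurableX.
Qed.

End TwoDim.

(** * The kernel *)

Section Calculus.
Context {R : realType}.
Notation mu := (@lebesgue_measure R).

Lemma bs1_itv_mul (a b : R) (f : R -> R) : continuous f ->
  bs1 (fun x => \1_`[a, b]%classic x * f x).
Proof.
move=> cf; split.
  by apply: measurable_funM; [exact: measurable_indic|exact: continuous_measurable_fun].
have [M [Mr MP]] : [bounded f x | x in `[a, b]%classic].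
  have [|M [Mr MP]] := @compact_bounded R R^o (f @` `[a, b]%classic).
    by apply: continuous_compact; [exact: continuous_subspaceT|exact: segment_compact].
  by exists M; split => // y My x abx; apply: (MP y My); exists x.
exists (`|M| + 1 + (`|a| + `|b|)) => x; rewrite indicE; split.
  case: (boolP (x \in _)) => /= h; rewrite ?mul1r ?mul0r ?normr0 ?addr_ge0//.
  apply: (@le_trans _ _ (`|M| + 1)); last by rewrite lerDl addr_ge0.
  by apply: MP; rewrite ?ltr_pwDr ?ler_norm//; move: h; rewrite inE.
move=> h; rewrite memNset ?mul0r//= in_itv/= => /andP[ax xb].
have := ler_norm a; have := ler_norm b; have := ler_norm (- a); have := ler_norm (- b).
have := normr_ge0 M; rewrite !normrN; move: h; rewrite ltr_normr; lra.
Qed.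

Lemma int1_FTC (F f : R -> R) (a b : R) : a < b ->
  (forall x : R, is_derive x (1 : R) F (f x)) -> continuous f ->
  \int[mu]_x (\1_`[a, b]%classic x * f x) = F b - F a.
Proof.
move=> ab dF cf.
have cF : continuous F by move=> x; apply: differentiable_continuous; apply/derivable1_diffP; exact: (@ex_derive _ _ _ _ _ _ _ (dF x)).
have -> : \int[mu]_x (\1_`[a, b]%classic x * f x) = \int[mu]_(x in `[a, b]%classic) f x.
  rewrite [RHS]Rintegral_mkcond; apply: eq_Rintegral => x _.
  by rewrite patchE indicE; case: (x \in _); rewrite ?mul1r ?mul0r.
rewrite /Rintegral (@continuous_FTC2 _ f F a b ab).
- by [].
- exact: continuous_subspaceT.
- split; first by move=> x _; exact: (@ex_derive _ _ _ _ _ _ _ (dF x)).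
    exact/cvg_at_right_filter/cF.
  exact/cvg_at_left_filter/cF.
- by move=> x _; rewrite derive1E; exact: (@derive_val _ _ _ _ _ _ _ (dF x)).
Qed.

Lemma is_derive_lin (a b x : R) : is_derive x 1 (fun t : R => a * t + b) a.
Proof.
have -> : (fun t : R => a * t + b) = (a *: (@id R) + cst b).
  by apply/funext => t.
by apply: is_derive_eq; rewrite addr0 /GRing.scale/= mulr1.
Qed.

Lemma is_derive_sinlin (a b x : R) :
  is_derive x 1 (fun t : R => sin (a * t + b)) (a * cos (a * x + b)).
Proof.
have := @is_derive1_comp R (@sin R) (fun t => a * t + b) x _ _ (is_derive_sin _) (is_derive_lin a b x).
by rewrite mulrC.
Qed.

Lemma is_derive_coslin (a b x : R) :
  is_derive x 1 (fun t : R => cos (a * t + b)) (- (a * sin (a * x + b))).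
Proof.
have := @is_derive1_comp R (@cos R) (fun t => a * t + b) x _ _ (is_derive_cos _) (is_derive_lin a b x).
by rewrite mulrC mulrN.
Qed.

Lemma continuous_lin (a b : R) : continuous (fun t : R => a * t + b).
Proof. by move=> x; apply: cvgD; [apply: cvgM; [exact: cvg_cst|exact: cvg_id]|exact: cvg_cst]. Qed.

Lemma continuous_coslin (a b : R) : continuous (fun t : R => cos (a * t + b)).
Proof.
move=> x; apply: (@continuous_comp _ _ _ (fun t => a * t + b) cos); first exact: continuous_lin.
exact: continuous_cos.
Qed.

End Calculus.

Section Kernel.
Context {R : realType}.
Notation mu := (@lebesgue_measure R).

(** The free phase [b] carries the induction: a further factor [cos a] splits it into [b + a] and
    [b - a], which is Pascal's rule. Later the same phase absorbs the second coordinate when a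
    product of two kernels is expanded. *)
Lemma cos_pow_expand m (a b : R) :
  2 ^+ m * cos a ^+ m * cos b =
  \sum_(j < m.+1) 'C(m, j)%:R * cos ((j%:R *+ 2 - m%:R) * a + b).
Proof.
elim: m b => [|m IH] b.
  by rewrite big_ord1 bin0 !expr0 !mul1r mul0rn subr0 mul0r add0r.
have -> : 2 ^+ m.+1 * cos a ^+ m.+1 * cos b =
    2 ^+ m * cos a ^+ m * cos (b + a) + 2 ^+ m * cos a ^+ m * cos (b - a) :> R.
  by rewrite cosD cosB !exprS; ring.
rewrite !IH [RHS]big_ord_recl bin0.
under [in RHS]eq_bigr => i _ do rewrite lift0 binS natrD mulrDl.
rewrite big_split/= addrA addrC; congr (_ + _).
  by apply: eq_bigr => i _; congr (_ * cos _); rewrite -!natr1 mulrnDl; ring.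
rewrite [in LHS]big_ord_recl [in RHS]big_ord_recr/= (bin_small (ltnSn m)) mul0r addr0 bin0.
congr (_ + _); first by congr (_ * cos _); rewrite -natr1; ring.
apply: eq_bigr => i _; rewrite /bump/= add1n; congr (_ * cos _); rewrite -!natr1 mulrnDl; ring.
Qed.

Definition rng (N : nat) : seq int := [seq (Posz i - Posz N)%R | i <- iota 0 N.*2.+1].

(** For [i < - N] the absolute value produces a spurious coefficient; sums are taken over [rng N]
    only. *)
Definition coef (N : nat) (i : int) : R :=
  'C(N.*2, (absz (i + Posz N)))%:R / 'C(N.*2, N)%:R.

Definition ker (N : nat) (x : R) : R :=
  4 ^+ N / 'C(N.*2, N)%:R * cos (pi * x) ^+ (N.*2).

Lemma mem_rng N (i : int) : (i \in rng N) = (`|i| <= N)%N.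
Proof.
apply/mapP/idP => [[j] | h].
  by rewrite mem_iota => /andP[_ h] ->; lia.
by exists (absz (i + Posz N)); [rewrite mem_iota; lia|lia].
Qed.

Lemma uniq_rng N : uniq (rng N).
Proof. by rewrite map_inj_uniq ?iota_uniq// => i j; lia. Qed.

Lemma sum_rng N (f : int -> R) :
  \sum_(i <- rng N) f i = \sum_(j < N.*2.+1) f (Posz j - Posz N)%R.
Proof. by rewrite big_map -(subn0 N.*2.+1) -/(index_iota 0 _) big_mkord. Qed.

Lemma bin_central_gt0 N : 0 < ('C(N.*2, N))%:R :> R.
Proof. by rewrite ltr0n bin_gt0; lia. Qed.

Lemma ker_expand N (x b : R) : ker N x * cos b =
  \sum_(i <- rng N) coef N i * cos (2 * pi * i%:~R * x + b).
Proof.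
rewrite sum_rng /ker /coef.
have := cos_pow_expand N.*2 (pi * x) b.
have -> : 2 ^+ N.*2 = 4 ^+ N :> R by rewrite -mul2n exprM; congr (_ ^+ _); ring.
move=> E.
rewrite [LHS](_ : _ = 4 ^+ N * cos (pi * x) ^+ N.*2 * cos b / 'C(N.*2, N)%:R); last by ring.
rewrite E mulr_suml; apply: eq_bigr => j _.
rewrite mulrAC; congr (_ / _ * cos _).
  by congr (('C(_, _))%:R); lia.
have h : N.*2%:R = 2 * N%:R :> R by rewrite -mul2n natrM.
rewrite rmorphB/= h -!pmulrn; ring.
Qed.

Lemma coef0 N : coef N 0 = 1.
Proof. by rewrite /coef add0r/= divff// gt_eqF// bin_central_gt0. Qed.

Lemma coef_ge0 N i : 0 <= coef N i.
Proof. by rewrite divr_ge0. Qed.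

Lemma leq_bin_central N j : ('C(N.*2, j) <= 'C(N.*2, N))%N.
Proof.
have up i : (i < N)%N -> ('C(N.*2, i) <= 'C(N.*2, i.+1))%N.
  move=> iN; have := mul_bin_left N.*2 i => E.
  rewrite -(leq_pmul2l (ltn0Sn i)) E leq_mul2r; apply/orP; right; lia.
have le1 i : (i <= N)%N -> ('C(N.*2, N - i) <= 'C(N.*2, N))%N.
  elim: i => [|i IH] iN; first by rewrite subn0.
  apply: leq_trans (IH (ltnW iN)).
  have -> : (N - i = (N - i.+1).+1)%N by lia.
  by apply: up; lia.
have [jN|Nj] := leqP j N; first by rewrite -(subKn jN); apply: le1; lia.
have [j2|j2] := leqP j N.*2; last by rewrite bin_small.
rewrite -bin_sub//; have -> : (N.*2 - j = N - (j - N))%N by lia.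
by apply: le1; lia.
Qed.

Lemma coef_le1 N i : coef N i <= 1.
Proof. by rewrite ler_pdivrMr ?bin_central_gt0// mul1r ler_nat leq_bin_central. Qed.

Lemma coefN N i : (`|i| <= N)%N -> coef N (- i) = coef N i.
Proof.
move=> iN; rewrite /coef; congr (_%:R / _).
rewrite -bin_sub; last by lia.
by congr binomial; lia.
Qed.

Lemma ker_coef0 N : ker N 0 = \sum_(i <- rng N) coef N i.
Proof.
have := ker_expand N 0 0; rewrite cos0 mulr1 => ->.
by apply: eq_bigr => i _; rewrite mulr0 addr0 cos0 mulr1.
Qed.

Lemma ker0E N : ker N 0 = 4 ^+ N / 'C(N.*2, N)%:R.
Proof. by rewrite /ker mulr0 cos0 expr1n mulr1. Qed.

(** The central binomial estimate [4^N / C(2N, N) <= 2 sqrt N]; the induction step comes down to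
    [4 M (M + 1) <= (2 M + 1)^2]. For [N = n^2] it bounds the peak of the kernel by [2n]. *)
Lemma ker0_le N : (0 < N)%N -> ker N 0 ^+ 2 <= 4 * N%:R.
Proof.
rewrite ker0E => N0; rewrite expr_div_n ler_pdivrMr ?exprn_gt0 ?bin_central_gt0//.
elim: N N0 => // -[_ _|N IH _].
  by rewrite -[(1%N).*2]/2%N bin1//; lra.
have {}IH := IH isT.
set M := N.+1 in IH *.
have M0 : 0 < M%:R :> R by rewrite ltr0n.
have E : M.+1%:R * 'C(M.+1.*2, M.+1)%:R = 2 * (M.*2.+1)%:R * 'C(M.*2, M)%:R :> R.
  have e1 := mul_bin_diag M.+1.*2 M.
  have e2 := mul_bin_left M.*2.+1 M.
  rewrite doubleS/= in e1 e2.
  have e3 : 'C(M.*2.+1, M) = 'C(M.*2.+1, M.+1).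
    by rewrite -bin_sub; [congr binomial; lia|lia].
  have e4 := mul_bin_diag M.*2.+1 M.
  rewrite /= in e4.
  rewrite -!natrM; congr (_%:R); rewrite doubleS -e1; nia.
have C0 := bin_central_gt0 M.
set c := 'C(M.*2, M)%:R in IH E C0.
set c' := 'C(M.+1.*2, M.+1)%:R in E *.
have M1 : M.+1%:R = M%:R + 1 :> R by rewrite -natr1.
have M2 : M.*2.+1%:R = 2 * M%:R + 1 :> R by rewrite -natr1 -mul2n natrM.
have c'E : c' = 2 * (2 * M%:R + 1) * c / (M%:R + 1).
  by rewrite -M2 -E M1; field; lra.
rewrite c'E M1 (_ : 4 * (M%:R + 1) * _ =
   16 * c ^+ 2 * ((2 * M%:R + 1) ^+ 2 / (M%:R + 1))); last by field; lra.
apply: (@le_trans _ _ (16 * c ^+ 2 * (4 * M%:R))).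
  clearbody M; have -> : 4 ^+ M.+1 ^+ 2 = 16 * (4 ^+ M ^+ 2) :> R by rewrite [4 ^+ M.+1]exprS; ring.
  by move: IH; nra.
rewrite ler_pM2l ?mulr_gt0 ?exprn_gt0//.
by rewrite ler_pdivlMr; nra.
Qed.

Lemma ker_ge0 N x : 0 <= ker N x.
Proof. by rewrite /ker -mul2n exprM; apply: mulr_ge0; [rewrite divr_ge0 ?exprn_ge0|rewrite exprn_ge0 ?sqr_ge0]. Qed.

Lemma continuous_ker N : continuous (ker N).
Proof.
move=> x; apply: cvgM; first exact: cvg_cst.
apply: (@continuous_comp _ _ _ (fun x => cos (pi * x)) (fun y => y ^+ N.*2)); last exact: exprn_continuous.
have := @continuous_coslin R pi 0 x.
by under [X in {for _, continuous X} -> _]eq_fun do rewrite addr0.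
Qed.

Lemma ker_le N x : ker N x <= ker N 0.
Proof.
rewrite ker0E /ker ler_piMr ?divr_ge0 ?exprn_ge0//.
Qed.


Lemma sin_lipschitz (a b : R) : `|sin a - sin b| <= `|a - b|.
Proof.
wlog ab : a b / b < a.
  move=> H; have [h|h|->] := ltgtP a b; last by rewrite !subrr.
    by rewrite distrC [X in _ <= X]distrC; exact: H.
  exact: H.
have [|c _ ->] := @MVT R sin cos b a ab (fun x _ => is_derive_sin x).
  by apply: continuous_subspaceT; exact: continuous_sin.
by rewrite normrM ler_piMl// cos_max.
Qed.

Lemma cos_lipschitz (a b : R) : `|cos a - cos b| <= `|a - b|.
Proof.
have := sin_lipschitz (a + pi / 2) (b + pi / 2).
by rewrite !sinDpihalf (_ : a + _ - _ = a - b)//; ring.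
Qed.

Lemma norm_sin_le (x : R) : `|sin x| <= `|x|.
Proof. by have := sin_lipschitz x 0; rewrite sin0 !subr0. Qed.

Lemma cos_ge_sqr (x : R) : 1 - x ^+ 2 / 2 <= cos x.
Proof.
have -> : cos x = 1 - 2 * sin (x / 2) ^+ 2.
  by rewrite {1}(splitr x) cosD -!expr2 cos2sin2; ring.
have : sin (x / 2) ^+ 2 <= (x / 2) ^+ 2.
  by rewrite -[X in X <= _]real_normK ?num_real// -[X in _ <= X]real_normK ?num_real// lerXn2r ?nnegrE// norm_sin_le.
by have -> : (x / 2) ^+ 2 = x ^+ 2 / 4 by [field]; lra.
Qed.

Lemma sin_ge_half (x : R) : 0 <= x <= 1 -> x / 2 <= sin x.
Proof.
move=> /andP[x0 x1]; have [->|xn0] := eqVneq x 0; first by rewrite sin0 mul0r.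
have xp : 0 < x by rewrite lt_neqAle eq_sym xn0.
have [|c] := @MVT R sin cos 0 x xp (fun x _ => is_derive_sin x).
  by apply: continuous_subspaceT; exact: continuous_sin.
rewrite sin0 !subr0 in_itv/= => /andP[c0 cx] ->.
have := cos_ge_sqr c; nra.
Qed.

Lemma pi_le4 : pi <= 4 :> R.
Proof. by have := @pihalf_lt2 R; lra. Qed.

Lemma cosDpin (y : R) (n : nat) : cos (y + pi * n%:R) ^+ 2 = cos y ^+ 2.
Proof.
elim: n => [|n IH]; first by rewrite mulr0 addr0.
by rewrite -natr1 mulrDr mulr1 addrA cosDpi sqrrN.
Qed.

Lemma sin_pin (n : nat) : sin (pi * n%:R) = 0 :> R.
Proof.
elim: n => [|n IH]; first by rewrite mulr0 sin0.
by rewrite -natr1 mulrDr mulr1 sinDpi IH oppr0.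
Qed.

Lemma sin_piz (i : int) : sin (pi * i%:~R) = 0 :> R.
Proof.
case: i => n; first by rewrite -pmulrn sin_pin.
by rewrite NegzE mulrNz mulrN sinN -pmulrn sin_pin oppr0.
Qed.

Lemma cosDpiz (y : R) (i : int) : cos (y + pi * i%:~R) ^+ 2 = cos y ^+ 2.
Proof.
case: i => n; first by rewrite -pmulrn cosDpin.
rewrite NegzE mulrNz -pmulrn mulrN.
by rewrite -(cosDpin _ n.+1) subrK.
Qed.

Lemma ker_periodic N (x : R) (i : int) : ker N (x + i%:~R) = ker N x.
Proof. by rewrite /ker -mul2n !exprM mulrDr cosDpiz. Qed.

Lemma int_ker_window N (e : R) (m : int) :
  \int[mu]_x (\1_`[m%:~R - e, m%:~R + e]%classic x * ker N x) =
  \int[mu]_x (\1_`[- e, e]%classic x * ker N x).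
Proof.
have bf : bs1 (fun x : R => \1_`[m%:~R - e, m%:~R + e]%classic x * ker N x).
  by apply: bs1_itv_mul; exact: continuous_ker.
rewrite -(int1_shift m%:~R bf); apply: eq_Rintegral => x _.
rewrite ker_periodic !indicE; congr (_%:R * _); congr nat_of_bool.
apply/idP/idP; rewrite !inE/= !in_itv/= => /andP[h1 h2]; apply/andP; split; lra.
Qed.

Lemma int_ker_period N :
  \int[mu]_x (\1_`[- 2^-1, 2^-1]%classic x * ker N x) = 1 :> R.
Proof.
have E x : \1_`[- 2^-1, 2^-1]%classic x * ker N x =
    \sum_(i <- rng N) coef N i * (\1_`[- 2^-1, 2^-1]%classic x * cos (2 * pi * i%:~R * x + 0)).
  have := ker_expand N x 0; rewrite cos0 mulr1 => ->.
  by rewrite mulr_sumr; apply: eq_bigr => i _; rewrite mulrCA.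
under eq_Rintegral do rewrite E.
have b i : bs1 (fun x : R => \1_`[- 2^-1, 2^-1]%classic x * cos (2 * pi * i%:~R * x + 0)).
  by apply: bs1_itv_mul; exact: continuous_coslin.
rewrite int1_sum => [|i]; last exact: bs1Z.
rewrite (bigD1_seq 0) ?mem_rng ?uniq_rng//= big1 ?addr0.
  rewrite int1Z// coef0 mul1r.
  under eq_Rintegral do rewrite mulr0 mul0r addr0 cos0 mulr1.
  by rewrite int1_indic; lra.
move=> i i0; rewrite int1Z//.
have i0' : i%:~R != 0 :> R by rewrite intr_eq0.
have pn0 : pi != 0 :> R by rewrite gt_eqF// pi_gt0.
pose F (x : R) := (2 * pi * i%:~R)^-1 * sin (2 * pi * i%:~R * x + 0).
have dF (x : R) : is_derive x (1 : R) F (cos (2 * pi * i%:~R * x + 0)).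
  have := is_deriveZ ((2 * pi * i%:~R)^-1) (is_derive_sinlin (2 * pi * i%:~R) 0 x).
  by rewrite /GRing.scale/= mulrA mulVf ?mul1r// !mulf_neq0.
rewrite (@int1_FTC _ F _ _ _ _ dF); [|lra|exact: continuous_coslin].
rewrite /F !addr0.
have -> : 2 * pi * i%:~R * 2^-1 = pi * i%:~R :> R by field.
have -> : 2 * pi * i%:~R * - 2^-1 = - (pi * i%:~R) :> R by field.
by rewrite sinN sin_piz oppr0 !mulr0 subrr mulr0.
Qed.

Lemma ker_window_le1 N (e : R) : e <= 2^-1 ->
  \int[mu]_x (\1_`[- e, e]%classic x * ker N x) <= 1.
Proof.
move=> e2; rewrite -(int_ker_period N); apply: le_int1.
- by apply: bs1_itv_mul; exact: continuous_ker.
- by apply: bs1_itv_mul; exact: continuous_ker.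
move=> x; apply: ler_wpM2r; first exact: ker_ge0.
rewrite !indicE; case: (boolP (x \in `[- e, e]%classic)) => // h.
by rewrite mem_set//; move: h; rewrite inE/= !in_itv/=; lra.
Qed.

Lemma ker_window_ge N (e k : R) : 0 <= k -> e <= 2^-1 ->
  (forall x, e <= `|x| <= 2^-1 -> ker N x <= k) ->
  1 - k <= \int[mu]_x (\1_`[- e, e]%classic x * ker N x).
Proof.
move=> k0 e2 H; rewrite lerBlDr -{1}(int_ker_period N).
have b1 : bs1 (fun x => \1_`[- e, e]%classic x * ker N x).
  by apply: bs1_itv_mul; exact: continuous_ker.
have b2 : bs1 (fun x : R => k * \1_`[- 2^-1, 2^-1]%classic x).
  by apply: bs1Z; exact: bs1_indic.
have <- : \int[mu]_x (k * \1_`[- 2^-1, 2^-1]%classic x) = k.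
  by rewrite int1Z ?int1_indic; [lra|lra|exact: bs1_indic].
rewrite -int1D//; apply: le_int1; [|exact: bs1D|].
  by apply: bs1_itv_mul; exact: continuous_ker.
move=> x; rewrite !indicE.
case: (boolP (x \in `[- 2^-1, 2^-1]%classic)) => /= h; last first.
  by rewrite mul0r mulr0 addr0 mulr_ge0// ker_ge0.
case: (boolP (x \in `[- e, e]%classic)) => /= h1; rewrite ?mulr1 ?mul1r ?mul0r ?add0r.
  by rewrite lerDl.
apply: H; move: h; rewrite inE/= in_itv/= -ler_norml => ->; rewrite andbT.
by move/negP: h1; rewrite inE/= in_itv/= -ler_norml => /negP; rewrite -ltNge => /ltW.
Qed.

(** On this range [cos (pi x)^2 <= cos (pi e)^2 = 1 - sin (pi e)^2], and
    [sin (pi e) >= pi e / 2 >= e]. The bound [e <= 1/4] keeps [pi e] below 1, where the sine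
    estimate is valid. *)
Lemma ker_far N (e x : R) : 0 < e <= 4^-1 -> e <= `|x| <= 2^-1 ->
  ker N x <= ker N 0 * (1 - e ^+ 2) ^+ N.
Proof.
move=> /andP[e0 e4] /andP[ex x2].
rewrite ker0E /ker -mul2n exprM ler_wpM2l ?divr_ge0 ?exprn_ge0//.
rewrite lerXn2r ?nnegrE ?sqr_ge0//; first by nra.
have p2 := @pi_ge2 R; have p4 := pi_le4.
have -> : cos (pi * x) = cos (pi * `|x|).
  by rewrite -[LHS]cos_norm normrM (ger0_norm (ltW (@pi_gt0 R))).
have c0 : 0 <= cos (pi * `|x|).
  by apply: cos_ge0_pihalf; apply/andP; split; nra.
have c1 : cos (pi * `|x|) <= cos (pi * e).
  have [->//|xe] := eqVneq `|x| e.
  by apply/ltW; rewrite ltr_cos ?in_itv/=; [rewrite ltr_pM2l ?pi_gt0// lt_neqAle eq_sym xe|apply/andP; split; nra|apply/andP; split; nra].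
have s : e <= sin (pi * e).
  have := @sin_ge_half (pi * e); have : 0 <= pi * e <= 1 by apply/andP; split; nra.
  by move=> h /(_ h); nra.
have : cos (pi * `|x|) ^+ 2 <= cos (pi * e) ^+ 2 by rewrite lerXn2r ?nnegrE//; exact: le_trans c1.
have := cos2Dsin2 (pi * e); nra.
Qed.

End Kernel.

(** * Oscillatory integrals *)

Section Oscillation.
Context {R : realType}.
Notation mu := (@lebesgue_measure R).

(** A Hann window. It dominates the indicator of [[p + 1/2, p + 3/2]], but its Fourier transform
    decays like [1 / xi^2]; the decay [1 / xi] of the indicator itself would not be summable in
    Schur's test. *)
Definition bump (p t : R) : R := \1_`[p, p + 2]%classic t * (1 - cos (pi * t - pi * p)).

Lemma bs1_bump p : bs1 (bump p).
Proof.
apply: bs1_itv_mul => x; apply: cvgB; first exact: cvg_cst.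
exact: (@continuous_coslin R pi (- (pi * p)) x).
Qed.

Lemma bump_ge0 p t : 0 <= bump p t.
Proof. by rewrite mulr_ge0// ?subr_ge0 ?cos_le1. Qed.

Lemma bump_ge p t : p + 2^-1 <= t <= p + 3 / 2 -> 1 <= bump p t.
Proof.
move=> /andP[t1 t2]; rewrite /bump indicE mem_set/= ?in_itv/=; last by apply/andP; split; lra.
rewrite mul1r lerBrDr -lerBrDl subrr.
have -> : pi * t - pi * p = (pi * t - pi * p - pi) + pi by ring.
rewrite cosDpi oppr_le0; apply: cos_ge0_pihalf; have := @pi_gt0 R => p0.
apply/andP; split; nra.
Qed.

(* Two integrations by parts; the weight vanishes to second order at both ends. *)
Lemma osc_bump (p xi b : R) :
  `|\int[mu]_t (bump p t * cos (xi * t + b))| <= 64 / (1 + xi ^+ 2).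
Proof.
have bv := bs1_bump p.
have mc : measurable_fun setT (fun t : R => cos (xi * t + b)).
  by apply: continuous_measurable_fun; exact: continuous_coslin.
have bvc : bs1 (fun t => bump p t * cos (xi * t + b)).
  have := @bs1M R _ (fun t => cos (xi * t + b)) 1 bv mc (fun x => cos_max _).
  by under eq_fun do rewrite mulrC.
have p4 := @pi_le4 R; have p0 := @pi_gt0 R.
have xi2 : 0 < 1 + xi ^+ 2 by rewrite ltr_pwDl ?sqr_ge0.
have [x1|x1] := ltP (xi ^+ 2) 1.
  apply: (@le_trans _ _ 4); last by rewrite ler_pdivlMr//; lra.
  apply: le_trans (int1_norm bvc) _.
  apply: (@le_trans _ _ (\int[mu]_t (2 * \1_`[p, p + 2]%classic t))).
    apply: le_int1; [exact: bs1_norm|by apply: bs1Z; exact: bs1_indic|].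
    move=> t; rewrite normrM ger0_norm ?bump_ge0//.
    apply: (@le_trans _ _ (bump p t)); first by rewrite ler_piMr ?bump_ge0 ?cos_max.
    rewrite /bump mulrC ler_wpM2r//; have := cos_geN1 (pi * t - pi * p); lra.
  by rewrite int1Z ?int1_indic; [lra|lra|exact: bs1_indic].
have xn0 : xi != 0 by apply: contraTneq x1 => ->; rewrite expr0n/= ler10.
pose w (t : R) := 1 - cos (pi * t + (- (pi * p))).
pose w' (t : R) := pi * sin (pi * t + (- (pi * p))).
pose w'' (t : R) := pi * (pi * cos (pi * t + (- (pi * p)))).
have dw t : is_derive t (1 : R) w (w' t).
  have := is_deriveB (is_derive_cst (1 : R) t 1) (is_derive_coslin pi (- (pi * p)) t).
  by rewrite sub0r opprK.
have dw' t : is_derive t (1 : R) w' (w'' t).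
  exact: (is_deriveZ pi (is_derive_sinlin pi (- (pi * p)) t)).
(* [W] collects the boundary terms of both integrations by parts; it vanishes at [p] and at [p + 2],
   where [w] and [w'] are zero. *)
pose W t := xi^-1 * (w t * sin (xi * t + b)) + xi^-2 * (w' t * cos (xi * t + b)).
pose g t := w t * cos (xi * t + b) + xi^-2 * (w'' t * cos (xi * t + b)).
have dW t : is_derive t (1 : R) W (g t).
  have d1 := is_deriveZ xi^-1 (is_deriveM (dw t) (is_derive_sinlin xi b t)).
  have d2 := is_deriveZ (xi^-2) (is_deriveM (dw' t) (is_derive_coslin xi b t)).
  have := is_deriveD d1 d2.
  by move/is_derive_eq; apply; rewrite /g /GRing.scale/=; field.
have cw : continuous w.
  by move=> t; apply: cvgB; [exact: cvg_cst|exact: continuous_coslin].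
have cw'' : continuous w''.
  move=> t; apply: cvgM; first exact: cvg_cst.
  by apply: cvgM; [exact: cvg_cst|exact: continuous_coslin].
have cg : continuous g.
  move=> t; apply: cvgD; first by apply: cvgM; [exact: cw|exact: continuous_coslin].
  apply: cvgM; first exact: cvg_cst.
  by apply: cvgM; [exact: cw''|exact: continuous_coslin].
have pp : p < p + 2 by lra.
have := int1_FTC pp dW cg.
have -> : W (p + 2) - W p = 0.
  rewrite /W /w /w' subrr cos0 sin0.
  have -> : pi * (p + 2) - pi * p = pi *+ 2 by ring.
  by rewrite cos2pi sin2pi; ring.
have E t : \1_`[p, p + 2]%classic t * g t = bump p t * cos (xi * t + b) +
    \1_`[p, p + 2]%classic t * (xi^-2 * (w'' t * cos (xi * t + b))).
  by rewrite /g /bump mulrDr mulrA.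
under eq_Rintegral do rewrite E.
have b2 : bs1 (fun t => \1_`[p, p + 2]%classic t * (xi^-2 * (w'' t * cos (xi * t + b)))).
  apply: bs1_itv_mul => t; apply: cvgM; first exact: cvg_cst.
  by apply: cvgM; [exact: cw''|exact: continuous_coslin].
rewrite int1D// => /eqP; rewrite addr_eq0 => /eqP ->; rewrite normrN.
apply: (@le_trans _ _ (\int[mu]_t ((16 / xi ^+ 2) * \1_`[p, p + 2]%classic t))).
  apply: le_trans (int1_norm b2) _.
  apply: le_int1; [exact: bs1_norm|by apply: bs1Z; exact: bs1_indic|].
  move=> t; rewrite normrM [X in _ <= X]mulrC ger0_norm// ler_wpM2l//.
  have x2 : 0 <= xi ^- 2 by rewrite invr_ge0 sqr_ge0.
  rewrite normrM (ger0_norm x2) [leLHS]mulrC; apply: ler_wpM2r => //.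
  rewrite normrM /w'' !normrM (ger0_norm (ltW p0)).
  have c1 := cos_max (pi * t - pi * p); have c2 := cos_max (xi * t + b).
  have n1 := normr_ge0 (cos (pi * t - pi * p)); have n2 := normr_ge0 (cos (xi * t + b)).
  apply: (@le_trans _ _ (4 * (4 * 1) * 1)); last by lra.
  by rewrite !ler_pM ?mulr_ge0 ?(ltW p0).
rewrite int1Z ?int1_indic; [|lra|exact: bs1_indic].
rewrite -[p + 2 - p]addrAC subrr add0r ler_pdivlMr//.
have -> : 16 / xi ^+ 2 * 2 * (1 + xi ^+ 2) = 32 * ((1 + xi ^+ 2) / xi ^+ 2) by field.
rewrite (_ : 64 = 32 * 2) ?ler_pM2l//; last by lra.
by rewrite ler_pdivrMr; lra.
Qed.

Definition cosint (B : R -> R) (t : R) : R := \int[mu]_s (cos (2 * pi * t * s) * B s).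

Lemma bs2_cosint_kernel (v B : R -> R) sg : bs1 v -> bs1 B ->
  bs2 (fun z : R * R => cos (2 * pi * (z.1 + sg) * z.2) * (v z.1 * B z.2)).
Proof.
move=> bv bB; apply: (@bs2M _ _ _ 1); first exact: bs2_prod.
  apply: (measurableT_comp (continuous_measurable_fun (@continuous_cos R))).
  apply: measurable_funM => //; apply: measurable_funM => //.
  by apply: measurable_funD.
by move=> z; exact: cos_max.
Qed.

Lemma bs1_mul_cosint (v B : R -> R) sg : bs1 v -> bs1 B ->
  bs1 (fun t => v t * cosint B (t + sg)).
Proof.
move=> bv bB; have := bs2_int1 (bs2_cosint_kernel sg bv bB).
congr bs1; apply/funext => t /=; rewrite /cosint -int1Z.
  by apply: eq_Rintegral => s _; ring.
apply: (@bs1M _ _ _ 1) => //; last by move=> x; exact: cos_max.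
by apply: (measurableT_comp (continuous_measurable_fun (@continuous_cos R))); apply: measurable_funM.
Qed.

Lemma int_mul_cosint (v B : R -> R) sg : bs1 v -> bs1 B ->
  \int[mu]_t (v t * cosint B (t + sg)) =
  \int[mu]_s (B s * \int[mu]_t (v t * cos (2 * pi * (t + sg) * s))).
Proof.
move=> bv bB; have b2 := bs2_cosint_kernel sg bv bB.
transitivity (\int[mu]_t \int[mu]_s (cos (2 * pi * (t + sg) * s) * (v t * B s))).
  apply: eq_Rintegral => t _; rewrite /cosint -int1Z.
    by apply: eq_Rintegral => s _; ring.
  apply: (@bs1M _ _ _ 1) => //; last by move=> x; exact: cos_max.
  by apply: (measurableT_comp (continuous_measurable_fun (@continuous_cos R))); apply: measurable_funM.
rewrite -(int2_fubini1 b2) (int2_fubini2 b2)/=; apply: eq_Rintegral => s _.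
rewrite -int1Z; first by apply: eq_Rintegral => t _; ring.
under eq_fun do rewrite mulrC.
apply: (@bs1M _ _ _ 1) => //; last by move=> x; exact: cos_max.
apply: (measurableT_comp (continuous_measurable_fun (@continuous_cos R))); apply: measurable_funM => //.
by apply: measurable_funM => //; exact: measurable_funD.
Qed.

Lemma bs1_int_cos (v B : R -> R) sg : bs1 v -> bs1 B ->
  bs1 (fun s => B s * \int[mu]_t (v t * cos (2 * pi * (t + sg) * s))).
Proof.
move=> bv bB; have := bs2_int2 (bs2_cosint_kernel sg bv bB).
congr bs1; apply/funext => s /=; rewrite -int1Z.
  by apply: eq_Rintegral => t _; ring.
under eq_fun do rewrite mulrC.
apply: (@bs1M _ _ _ 1) => //; last by move=> x; exact: cos_max.
apply: (measurableT_comp (continuous_measurable_fun (@continuous_cos R))); apply: measurable_funM => //.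
by apply: measurable_funM => //; exact: measurable_funD.
Qed.

(** Fubini moves the oscillation onto [v], leaving only the mass of [B]. It is applied twice in
    [sqr_cosint_sum], once for each factor of the square. *)
Lemma norm_int_mul_cosint (v B : R -> R) sg M : bs1 v -> bs1 B ->
  (forall s, B s != 0 -> `|\int[mu]_t (v t * cos (2 * pi * (t + sg) * s))| <= M) ->
  `|\int[mu]_t (v t * cosint B (t + sg))| <= (\int[mu]_s `|B s|) * M.
Proof.
move=> bv bB H; rewrite int_mul_cosint//.
have b1 := bs1_int_cos sg bv bB.
apply: le_trans (int1_norm b1) _; rewrite [leRHS]mulrC -int1Z; last exact: bs1_norm.
apply: le_int1; [exact: bs1_norm|by apply: bs1Z; exact: bs1_norm|move=> s].
rewrite normrM mulrC; have [->|Bs] := eqVneq (B s) 0; first by rewrite normr0 !mulr0.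
by rewrite ler_wpM2r// H.
Qed.

(* Expanding the square, the interaction of [i] and [j] is an oscillatory
   integral with frequencies [a i +- a j + O(1)]. *)
Lemma sqr_cosint_sum (I : Type) (r : seq I) (B : I -> R -> R) (a be : I -> R) (p sg : R) :
  (forall i, bs1 (B i)) -> (forall i, 0 <= a i) ->
  (forall i s, B i s != 0 -> `|s - a i| <= 1) ->
  (forall i, \int[mu]_s `|B i s| <= be i) ->
  \int[mu]_t (bump p t * (\sum_(i <- r) cosint (B i) (t + sg)) ^+ 2) <=
  \sum_(i <- r) \sum_(j <- r) be i * be j * (576 / (1 + (a i - a j) ^+ 2)).
Proof.
move=> bB a0 Ba Bbe.
have ka0 i j : 0 <= 576 / (1 + (a i - a j) ^+ 2).
  by apply: divr_ge0; [rewrite ler0n|apply: addr_ge0 => //; exact: sqr_ge0].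
pose T t := \sum_(i <- r) cosint (B i) (t + sg).
have bv := bs1_bump p.
have bvT : bs1 (fun t => bump p t * T t).
  rewrite /T; under eq_fun do rewrite mulr_sumr.
  by apply: bs1_sum => i; exact: bs1_mul_cosint.
have mcos s : measurable_fun setT (fun t : R => cos (2 * pi * (t + sg) * s)).
  apply: (measurableT_comp (continuous_measurable_fun (@continuous_cos R))).
  by apply: measurable_funM => //; apply: measurable_funM => //; exact: measurable_funD.
have bvc s : bs1 (fun t => bump p t * cos (2 * pi * (t + sg) * s)).
  under eq_fun do rewrite mulrC.
  by apply: (@bs1M _ _ _ 1) => // x; exact: cos_max.
have be0 i : 0 <= be i by apply: le_trans (Bbe i); apply: int1_ge0 => s; exact: normr_ge0.
(* The product of cosines has the frequencies [s + s'] and [s - s']. As the centres [a i] are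
   nonnegative, both are at least [|a i - a j| - 2] in absolute value. *)
have K i j s s' : B i s != 0 -> B j s' != 0 ->
    `|\int[mu]_t (bump p t * cos (2 * pi * (t + sg) * s) * cos (2 * pi * (t + sg) * s'))|
    <= 576 / (1 + (a i - a j) ^+ 2).
  move=> /Ba si /Ba sj.
  pose g (x t : R) := bump p t * cos (2 * pi * x * t + 2 * pi * x * sg).
  have bg x : bs1 (g x).
    rewrite /g; under eq_fun do rewrite mulrC.
    apply: (@bs1M _ _ _ 1) => //; last by move=> y; exact: cos_max.
    by apply: continuous_measurable_fun; exact: continuous_coslin.
  have -> : \int[mu]_t (bump p t * cos (2 * pi * (t + sg) * s) * cos (2 * pi * (t + sg) * s')) =
      2^-1 * \int[mu]_t g (s + s') t + 2^-1 * \int[mu]_t g (s - s') t.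
    rewrite -!int1Z// -int1D; [|exact: bs1Z|exact: bs1Z].
    apply: eq_Rintegral => t _; rewrite /g.
    have -> : 2 * pi * (s + s') * t + 2 * pi * (s + s') * sg =
      2 * pi * (t + sg) * s + 2 * pi * (t + sg) * s' by ring.
    have -> : 2 * pi * (s - s') * t + 2 * pi * (s - s') * sg =
      2 * pi * (t + sg) * s - 2 * pi * (t + sg) * s' by ring.
    by rewrite cosD cosB; field.
  (* [576 = 64 * 9]: from [d <= y + 2] follows [d^2 <= 2 y^2 + 8], so [1 + d^2] is at most 9 times
     [1 + (2 pi y)^2]. *)
  have D x : `|a i - a j| <= `|x| + 2 -> `|\int[mu]_t g x t| <= 576 / (1 + (a i - a j) ^+ 2).
    move=> ax; apply: le_trans (osc_bump _ _ _) _.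
    have p1 : 1 <= 2 * pi :> R by have := @pi_ge2 R; lra.
    have -> : (a i - a j) ^+ 2 = `|a i - a j| ^+ 2 by rewrite real_normK ?num_real.
    have -> : (2 * pi * x) ^+ 2 = (2 * pi) ^+ 2 * `|x| ^+ 2 by rewrite exprMn real_normK ?num_real.
    have := normr_ge0 (a i - a j); have := normr_ge0 x.
    move: ax; set d := `|a i - a j|; set y := `|x| => dy y0 d0.
    have h1 : d ^+ 2 <= 2 * y ^+ 2 + 8 by have := sqr_ge0 (y - 2); nra.
    have h2 : y ^+ 2 <= (2 * pi) ^+ 2 * y ^+ 2 by rewrite ler_peMl ?sqr_ge0// expr_ge1//; lra.
    rewrite ler_pdivrMr; last by nra.
    rewrite mulrAC ler_pdivlMr; last by nra.
    nra.
  rewrite (le_trans (ler_normD _ _))// !normrM gtr0_norm; last by lra.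
  have := a0 i; have := a0 j; move: si sj; rewrite !ler_norml => /andP[? ?] /andP[? ?] ? ?.
  have D1 : `|\int[mu]_t g (s + s') t| <= 576 / (1 + (a i - a j) ^+ 2).
    apply: D; rewrite ler_norml; have := ler_norm (s + s'); lra.
  have D2 : `|\int[mu]_t g (s - s') t| <= 576 / (1 + (a i - a j) ^+ 2).
    apply: D; rewrite ler_norml; have := ler_norm (s - s'); have := ler_norm (- (s - s')).
    by rewrite normrN; lra.
  lra.
have G i s : B i s != 0 ->
    `|\int[mu]_t (bump p t * T t * cos (2 * pi * (t + sg) * s))| <=
    \sum_(j <- r) be j * (576 / (1 + (a i - a j) ^+ 2)).
  move=> Bis.
  have E t : bump p t * T t * cos (2 * pi * (t + sg) * s) =
      \sum_(j <- r) (bump p t * cos (2 * pi * (t + sg) * s)) * cosint (B j) (t + sg).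
    by rewrite /T -mulr_sumr; ring.
  under eq_Rintegral do rewrite E.
  rewrite int1_sum => [|j]; last exact: bs1_mul_cosint.
  apply: le_trans (ler_norm_sum _ _ _) _; apply: ler_sum => j _.
  apply: le_trans (norm_int_mul_cosint (M := 576 / (1 + (a i - a j) ^+ 2)) (bvc s) (bB j) _) _.
    by move=> s' Bjs'; exact: K.
  exact: ler_wpM2r.
have E t : bump p t * T t ^+ 2 = \sum_(i <- r) (bump p t * T t) * cosint (B i) (t + sg).
  by rewrite -mulr_sumr -/(T t); ring.
under eq_Rintegral do rewrite E.
rewrite int1_sum => [|i]; last exact: bs1_mul_cosint.
apply: ler_sum => i _.
apply: le_trans (ler_norm _) _.
apply: le_trans (norm_int_mul_cosint bvT (bB i) (G i)) _.
apply: (@le_trans _ _ (be i * \sum_(j <- r) be j * (576 / (1 + (a i - a j) ^+ 2)))).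
  apply: ler_wpM2r => //; apply: sumr_ge0 => j _.
  exact: mulr_ge0.
by rewrite mulr_sumr; apply: ler_sum => j _; rewrite mulrA.
Qed.

End Oscillation.

(** * Second differences of concave functions *)

Section SecondDifference.
Context {R : realType}.
Notation mu := (@lebesgue_measure R).

Lemma bs1_itv (x y : R) (A : R -> R) : bs1 A -> bs1 (fun s => \1_`[x, y[%classic s * A s).
Proof.
move=> bA; apply: (@bs1M _ _ _ 1) => //.
by move=> s; rewrite indicE; case: (_ \in _); rewrite ?normr1 ?normr0.
Qed.

Lemma indic_coE (x y s : R) : \1_`[x, y[%classic s = (x <= s < y)%R%:R :> R.
Proof. rewrite indicE; have -> // : (s \in `[x, y[%classic) = (x <= s < y).
by apply/idP/idP; rewrite inE/= in_itv. Qed.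

Lemma indic_co_diff (x y s : R) : x <= y ->
  \1_`[x, y[%classic s = (x <= s)%R%:R - (y <= s)%R%:R :> R.
Proof.
move=> xy; rewrite indic_coE ltNge; case: (leP y s) => h; last by rewrite andbT subr0.
by rewrite (le_trans xy h) subrr.
Qed.

Lemma int1_itv_shift (x y h : R) (A : R -> R) : bs1 A ->
  \int[mu]_s (\1_`[x, y[%classic s * A (s + h)) =
  \int[mu]_s (\1_`[x + h, y + h[%classic s * A s).
Proof.
move=> bA; rewrite -(int1_shift h (bs1_itv (x + h) (y + h) bA)).
by apply: eq_Rintegral => s _; rewrite !indic_coE lerD2r ltrD2r.
Qed.

(** Meant for [A] the chord function in the direction [k], [a] the support function at [k], [ka] the
    norm of [k], and [r0], [rho] the radii of the two discs. Concavity is assumed down to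
    [- (r0 * ka)], not only to 0: the room on the left controls the growth of [A] at 0. *)
Variables (A : R -> R) (a ka r0 rho h V : R).
Hypotheses (bA : bs1 A) (A0 : forall s, 0 <= A s) (Aa : forall s, a <= s -> A s = 0).
Hypotheses (r00 : 0 < r0) (r01 : r0 <= 1) (rho1 : 1 <= rho) (ka1 : 1 <= ka)
  (h0 : 0 < h) (h8 : h <= r0 / 8).
Hypotheses (ra : r0 * ka <= a) (ar : a <= rho * ka) (V0 : 0 <= V).
Hypothesis Aconc : forall s1 s2 l, - (r0 * ka) <= s1 -> s1 < a -> - (r0 * ka) <= s2 ->
  s2 < a -> 0 <= l <= 1 -> (1 - l) * A s1 + l * A s2 <= A ((1 - l) * s1 + l * s2).
Hypothesis AV : forall s, - (r0 * ka) <= s -> s < a -> A s <= V * Num.sqrt (a - s).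

Local Ltac hyps := have ? := r00; have ? := r01; have ? := rho1; have ? := ka1;
  have ? := h0; have ? := h8; have ? := ra; have ? := ar; have ? := V0.

Definition sdiff (s : R) : R := A (s + - h) - 2 * A s + A (s + h).
Let c := a - r0 / 2.
Let Q x := \int[mu]_s (\1_`[x, x + h[%classic s * A s).

Lemma bs1_sdiff : bs1 sdiff.
Proof.
have bs d : bs1 (fun s => A (s + d)).
  have := bs1_affine d (oner_neq0 R) bA.
  by under eq_fun do rewrite mul1r.
by apply: bs1D => //; apply: bs1B => //; exact: bs1Z.
Qed.

Let bsA d : bs1 (fun s => A (s + d)).
Proof.
have := bs1_affine d (oner_neq0 R) bA.
by under eq_fun do rewrite mul1r.
Qed.

(** A discrete fundamental theorem of calculus: the interior of [[x, y[] cancels and only windows of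
    length [h] at its two ends remain. *)
Lemma int_sdiff (x y : R) : x <= y ->
  - (\int[mu]_s (\1_`[x, y[%classic s * sdiff s)) = Q (y - h) - Q y + (Q x - Q (x - h)).
Proof.
hyps.
move=> xy.
have -> : \int[mu]_s (\1_`[x, y[%classic s * sdiff s) =
    \int[mu]_s (\1_`[x, y[%classic s * A (s + - h)) -
    2 * \int[mu]_s (\1_`[x, y[%classic s * A s) +
    \int[mu]_s (\1_`[x, y[%classic s * A (s + h)).
  rewrite -int1Z -?int1B -?int1D.
  - by apply: eq_Rintegral => s _; rewrite /sdiff; ring.
  - by apply: bs1B; [exact: (bs1_itv _ _ (bsA (- h)))|apply: bs1Z; exact: bs1_itv].
  - exact: (bs1_itv _ _ (bsA h)).
  - exact: (bs1_itv _ _ (bsA (- h))).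
  - by apply: bs1Z; exact: bs1_itv.
  - exact: bs1_itv.
rewrite !int1_itv_shift// /Q !subrK.
have E : \int[mu]_s (\1_`[x - h, y - h[%classic s * A s) +
    \int[mu]_s (\1_`[x + h, y + h[%classic s * A s) +
    (\int[mu]_s (\1_`[y - h, y[%classic s * A s) +
     \int[mu]_s (\1_`[x, x + h[%classic s * A s)) =
    2 * \int[mu]_s (\1_`[x, y[%classic s * A s) +
    (\int[mu]_s (\1_`[y, y + h[%classic s * A s) +
    \int[mu]_s (\1_`[x - h, x[%classic s * A s)).
  have b u v := bs1_itv u v bA.
  rewrite -int1Z// -!int1D//; do ?[apply: bs1D => //]; do ?[exact: bs1Z].
  apply: eq_Rintegral => s _; rewrite !indic_co_diff; [ring|lra..].
move: E; move: (\int[mu]_s (\1_`[x - h, y - h[%classic s * A s))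
  (\int[mu]_s (\1_`[x + h, y + h[%classic s * A s)) (\int[mu]_s (\1_`[y - h, y[%classic s * A s))
  (\int[mu]_s (\1_`[x, x + h[%classic s * A s)) (\int[mu]_s (\1_`[x, y[%classic s * A s))
  (\int[mu]_s (\1_`[y, y + h[%classic s * A s)) (\int[mu]_s (\1_`[x - h, x[%classic s * A s)).
move=> ? ? ? ? ? ? ?; lra.
Qed.

Let int_itv_le (x y M : R) (f : R -> R) : x <= y -> bs1 f ->
  (forall s, x <= s < y -> f s <= M) ->
  \int[mu]_s (\1_`[x, y[%classic s * f s) <= (y - x) * M.
Proof.
hyps.
move=> xy bf fM; rewrite -(int1_indic true true xy) mulrC -int1Z; last exact: bs1_indic.
apply: le_int1; [exact: bs1_itv|by apply: bs1Z; exact: bs1_indic|move=> s].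
rewrite mulrC !indic_coE; case: (boolP (x <= s < y)) => [/fM fs|_]; last by rewrite !mulr0.
by rewrite !mulr1.
Qed.

Let cpos : 0 < c.
Proof. by hyps; rewrite /c; nra. Qed.

Let sdiff_le0 s : 0 <= s -> s < a - h -> sdiff s <= 0.
Proof.
hyps.
move=> s0 sa; rewrite /sdiff.
have l2 : 0 <= (2^-1 : R) <= 1 by lra.
have := @Aconc (s - h) (s + h) 2^-1; have -> : (1 - 2^-1) * (s - h) + 2^-1 * (s + h) = s by field.
have h1 : - (r0 * ka) <= s - h by nra.
have h2 : s - h < a by lra.
have h3 : - (r0 * ka) <= s + h by nra.
have h4 : s + h < a by lra.
by move=> /(_ h1 h2 h3 h4 l2); lra.
Qed.

(** [s - h] lies between [- (r0 * ka)] and [s]; concavity is used there, discarding the nonnegative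
    value at the left end. So [A] grows at a relative rate of at most [1 / (r0 * ka)]. *)
Let up_step s : 0 <= s -> s < a -> A s - A (s - h) <= h / (r0 * ka) * A s.
Proof.
hyps.
move=> s0 sa.
have b0 : 0 < r0 * ka by nra.
pose l := (s - h + r0 * ka) / (s + r0 * ka).
have d0 : 0 < s + r0 * ka by lra.
have l01 : 0 <= l <= 1.
  apply/andP; split; first by rewrite divr_ge0//; nra.
  by rewrite ler_pdivrMr//; lra.
have h1 : - (r0 * ka) < a by lra.
have h2 : - (r0 * ka) <= s by lra.
have := Aconc (lexx _) h1 h2 sa l01.
have -> : (1 - l) * - (r0 * ka) + l * s = s - h by rewrite /l; field; lra.
have := A0 (- (r0 * ka)); move: l01 => /andP[l0 l1].
have h3 : 1 - l <= h / (r0 * ka).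
  have -> : 1 - l = h / (s + r0 * ka) by rewrite /l; field; lra.
  by rewrite ler_pM2l; [rewrite lef_pV2 ?posrE//; lra|lra].
have := A0 s; nra.
Qed.

Let sq1 (x : R) : x <= 1 -> Num.sqrt x <= 1.
Proof. by move=> x1; rewrite -sqrtr1 ler_wsqrtr. Qed.

Let sub_Q_bound1 : Q c - Q (c - h) <= V * h ^+ 2 / r0.
Proof.
hyps.
have -> : Q c - Q (c - h) = \int[mu]_s (\1_`[c, c + h[%classic s * (A s - A (s + - h))).
  rewrite /Q !subrK.
  have -> : \int[mu]_s (\1_`[c - h, c[%classic s * A s) = \int[mu]_s (\1_`[c, c + h[%classic s * A (s + - h)).
    by rewrite int1_itv_shift// addrK.
  rewrite -int1B; [|exact: bs1_itv|exact: (bs1_itv _ _ (bsA (- h)))].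
  by apply: eq_Rintegral => s _; rewrite mulrBr.
apply: le_trans (int_itv_le (M := h / r0 * V) _ _ _) _; first lra.
- exact: bs1B.
- move=> s /andP[s1 s2].
  have sa : s < a by rewrite /c in s2; lra.
  have s0 : 0 <= s by have := cpos; lra.
  apply: le_trans (up_step s0 sa) _.
  apply: ler_pM => //; first by rewrite divr_ge0; nra.
    by rewrite ler_pM2l; [rewrite lef_pV2 ?posrE; nra|lra].
  have hs : - (r0 * ka) <= s by nra.
  apply: le_trans (AV hs sa) _; rewrite ler_piMr// sq1//; move: s1; rewrite /c; lra.
- by rewrite le_eqVlt; apply/orP; left; apply/eqP; ring.
Qed.

(* On [[c, a + 1[] the second difference is non-positive except within [h] of
   [a], so its mass is a boundary term controlled by [AV]. *)
Lemma top_bound :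
  \int[mu]_s `|\1_`[c, a + 1[%classic s * sdiff s| <= (1 / r0 + 8) * (V * (h * Num.sqrt h)).
Proof.
hyps.
have ca1 : c <= a + 1 by rewrite /c; lra.
have b1 := bs1_itv c (a + 1) bs1_sdiff.
have b2 : bs1 (fun s => 2 * (\1_`[a - h, a + h[%classic s * A (s + - h))).
  by apply: bs1Z; exact: (bs1_itv _ _ (bsA (- h))).
(* The majorant is [- sdiff] plus a correction within [h] of [a]: there [A (s + h) = 0], so [sdiff]
   is [A (s - h) - 2 A s], which may be positive, and adding [2 A (s - h)] to its opposite dominates
   its absolute value. *)
apply: (@le_trans _ _ (\int[mu]_s ((- 1) * (\1_`[c, a + 1[%classic s * sdiff s) +
    2 * (\1_`[a - h, a + h[%classic s * A (s + - h))))).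
  apply: le_int1; [exact: bs1_norm|by apply: bs1D => //; exact: bs1Z|move=> s].
  rewrite !indic_coE; have Ash := A0 (s + - h); have As := A0 s.
  case: (boolP (c <= s < a + 1)) => [/andP[s1 s2]|_]; last first.
    by rewrite !mul0r mulr0 normr0 add0r mulr_ge0// mulr_ge0.
  rewrite mul1r; have [sa|sa] := ltP s (a - h).
    rewrite ler0_norm ?sdiff_le0//; last by have := cpos; lra.
    by rewrite mulN1r lerDl mulr_ge0// mulr_ge0.
  rewrite andbC /=.
  have E : sdiff s = A (s + - h) - 2 * A s by rewrite /sdiff (Aa (s := s + h)) ?addr0//; lra.
  case: ltP => sh /=.
    by rewrite mul1r E ler_norml; lra.
  rewrite E (Aa (s := s + - h)); last lra.
  rewrite (Aa (s := s)); last lra.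
  by rewrite !(mulr0, subrr, normr0, addr0).
rewrite int1D; [|exact: bs1Z|exact: b2].
rewrite int1Z// mulN1r int_sdiff//.
have Qz x : a <= x -> Q x = 0.
  move=> ax; rewrite /Q; under eq_Rintegral => s _.
    have -> : \1_`[x, x + h[%classic s * A s = 0.
      rewrite indic_coE; case: (boolP (x <= s < x + h)) => [/andP[? _]|]; last by rewrite mul0r.
      by rewrite Aa ?mulr0//; lra.
    over.
  exact: int10.
have -> : Q (a + 1 - h) = 0 by apply: Qz; lra.
have -> : Q (a + 1) = 0 by apply: Qz; lra.
rewrite subrr add0r.
rewrite int1Z; last exact: (bs1_itv _ _ (bsA (- h))).
rewrite int1_itv_shift// addrK.
have tl : \int[mu]_s (\1_`[a - h - h, a[%classic s * A s) <= (a - (a - h - h)) * (V * Num.sqrt (2 * h)).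
  apply: int_itv_le => //; first lra.
  move=> s /andP[s1 s2]; apply: le_trans (AV _ s2) _; first by nra.
  by rewrite ler_wpM2l// ler_wsqrtr//; lra.
have sh0 := sqrtr_ge0 h.
have hh : Num.sqrt h ^+ 2 = h by rewrite sqr_sqrtr//; lra.
have h1 : h <= Num.sqrt h by have := @sq1 h; nra.
have h2 : Num.sqrt (2 * h) <= 2 * Num.sqrt h.
  rewrite sqrtrM//; apply: ler_wpM2r => //.
  have {2}-> : 2 = Num.sqrt (2 ^+ 2) :> R by rewrite sqrtr_sqr ger0_norm.
  by rewrite ler_wsqrtr//; lra.
have g1 : V * h ^+ 2 / r0 <= 1 / r0 * (V * (h * Num.sqrt h)).
  have -> : V * h ^+ 2 / r0 = 1 / r0 * (V * (h * h)) by field; lra.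
  rewrite ler_wpM2l ?divr_ge0//; first by lra.
  by rewrite ler_wpM2l// ler_wpM2l//; lra.
have g2 : (a - (a - h - h)) * (V * Num.sqrt (2 * h)) <= 4 * (V * (h * Num.sqrt h)).
  have -> : 4 * (V * (h * Num.sqrt h)) = (a - (a - h - h)) * (V * (2 * Num.sqrt h)) by ring.
  by rewrite ler_wpM2l ?ler_wpM2l//; lra.
have := sub_Q_bound1; lra.
Qed.

(* Here concavity makes [sdiff] non-positive, so that the integral of its
   absolute value telescopes to increments of [Q]. *)
Lemma mid_bound :
  \int[mu]_s `|\1_`[0, c[%classic s * sdiff s| <= ((4 + rho) / r0) * (V * h ^+ 2).
Proof.
hyps.
have b1 := bs1_itv 0 c bs1_sdiff.
have -> : \int[mu]_s `|\1_`[0, c[%classic s * sdiff s| = - (\int[mu]_s (\1_`[0, c[%classic s * sdiff s)).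
  rewrite -mulN1r -int1Z//; apply: eq_Rintegral => s _.
  rewrite indic_coE; case: (boolP (0 <= s < c)) => [/andP[s0 sc]|_]; last by rewrite !mul0r mulr0 normr0.
  by rewrite mul1r mulN1r ler0_norm//; apply: sdiff_le0 => //; move: sc; rewrite /c; lra.
rewrite int_sdiff ?(ltW cpos)//.
have E x : Q x - Q (x - h) = \int[mu]_s (\1_`[x, x + h[%classic s * (A s - A (s + - h))).
  rewrite /Q !subrK.
  have -> : \int[mu]_s (\1_`[x - h, x[%classic s * A s) = \int[mu]_s (\1_`[x, x + h[%classic s * A (s + - h)).
    by rewrite int1_itv_shift// addrK.
  rewrite -int1B; [|exact: bs1_itv|exact: (bs1_itv _ _ (bsA (- h)))].
  by apply: eq_Rintegral => s _; rewrite mulrBr.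
have q1 : Q (c - h) - Q c <= h * (4 * h / r0 * V).
  have -> : Q (c - h) - Q c = \int[mu]_s (\1_`[c, c + h[%classic s * (A (s + - h) - A s)).
    have -> : Q (c - h) - Q c = - (Q c - Q (c - h)) by ring.
    rewrite E -mulN1r -int1Z; first by apply: eq_Rintegral => s _; ring.
    by apply: bs1_itv; exact: bs1B.
  have -> : h * (4 * h / r0 * V) = (c + h - c) * (4 * h / r0 * V) by ring.
  apply: int_itv_le; [lra|exact: bs1B|move=> s /andP[s1 s2]].
  rewrite /c in s1 s2.
  (* The descent of [A] near [c] is bounded by concavity towards [a'], which lies at least [r0 / 4]
     to the right of [s - h] and where [A] is nonnegative. *)
  pose a' := a - r0 / 8; pose l := h / (a' - (s - h)).
  have d0 : r0 / 4 <= a' - (s - h) by rewrite /a'; lra.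
  have l4 : l <= 4 * h / r0.
    have -> : 4 * h / r0 = h / (r0 / 4) by field; lra.
    by rewrite /l ler_pM2l; [rewrite lef_pV2 ?posrE//; lra|lra].
  have l01 : 0 <= l <= 1.
    apply/andP; split; first by rewrite divr_ge0//; lra.
    by rewrite /l ler_pdivrMr; lra.
  have g1 : - (r0 * ka) <= s - h by nra.
  have g2 : s - h < a by lra.
  have g3 : - (r0 * ka) <= a' by rewrite /a'; nra.
  have g4 : a' < a by rewrite /a'; lra.
  have := Aconc g1 g2 g3 g4 l01.
  have -> : (1 - l) * (s - h) + l * a' = s by rewrite /l; field; lra.
  have := A0 a'; have := A0 (s - h); have := AV g1 g2.
  have := @sq1 (a - (s - h)); have := sqrtr_ge0 (a - (s - h)).
  move: l01 => /andP[l0 l1] q0 q1 q2 q3 q4 q5.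
  have {}q1 : Num.sqrt (a - (s - h)) <= 1 by apply: q1; lra.
  have q6 : A (s - h) <= V by nra.
  have q7 : l * A (s - h) <= 4 * h / r0 * V by rewrite ler_pM.
  nra.
(* At 0 the chord can only be bounded by [V * (rho * ka)], but the factor [ka] cancels against the
   one in [up_step]. *)
have q2 : Q 0 - Q (0 - h) <= h * (h * (rho / r0) * V).
  rewrite E; have {3}-> : h = 0 + h - 0 by ring.
  apply: int_itv_le; [lra|exact: bs1B|move=> s /andP[s1 s2]].
  have sa : s < a by nra.
  apply: le_trans (up_step s1 sa) _.
  have b0 : 0 < r0 * ka by nra.
  rewrite mulrAC ler_pdivrMr//.
  have sb : - (r0 * ka) <= s by lra.
  have h1 := AV sb sa.
  have rk : 1 <= rho * ka by nra.
  have h2 : Num.sqrt (a - s) <= rho * ka.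
    apply: (@le_trans _ _ (Num.sqrt ((rho * ka) ^+ 2))).
      rewrite ler_wsqrtr//; apply: (@le_trans _ _ (rho * ka)); first lra.
      by rewrite expr2 ler_peMl//; lra.
    by rewrite sqrtr_sqr ger0_norm//; lra.
  have -> : h * (rho / r0) * V * (r0 * ka) = h * (V * (rho * ka)) by field; lra.
  rewrite ler_wpM2l//; first lra.
  by apply: le_trans h1 _; rewrite ler_wpM2l.
have -> : (4 + rho) / r0 * (V * h ^+ 2) = h * (4 * h / r0 * V) + h * (h * (rho / r0) * V) by field; lra.
lra.
Qed.

End SecondDifference.

(** * Support functions and chords *)

Section Length.
Context {R : realType}.
Notation mu := (@lebesgue_measure R).

Lemma length_ge (E : set R) (x y : R) : bs1 (\1_E) -> x <= y ->
  (forall z, x <= z <= y -> E z) -> y - x <= \int[mu]_z \1_E z.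
Proof.
move=> bE xy H; rewrite -(int1_indic true false xy).
apply: le_int1 => // [|z]; first exact: bs1_indic.
rewrite !indicE; case: (boolP (z \in `[x, y]%classic)) => // h.
by rewrite mem_set//; apply: H; move: h; rewrite inE/= in_itv.
Qed.

Lemma length_le (E : set R) (L : R) : bs1 (\1_E) -> E !=set0 ->
  (forall x y, E x -> E y -> y - x <= L) -> \int[mu]_z \1_E z <= L.
Proof.
move=> bE [e Ee] H.
have L0 : 0 <= L by have := H _ _ Ee Ee; rewrite subrr.
have ub : has_ubound E by exists (e + L) => x Ex; have := H _ _ Ee Ex; lra.
have lb : has_lbound E by exists (e - L) => x Ex; have := H _ _ Ex Ee; lra.
have Es x : E x -> inf E <= x <= sup E.
  by move=> Ex; rewrite ub_le_sup// ge_inf.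
have iE : inf E <= sup E by have /andP[h1 h2] := Es _ Ee; exact: le_trans h2.
apply: (@le_trans _ _ (sup E - inf E)).
  rewrite -(int1_indic true false iE); apply: le_int1 => // [|z]; first exact: bs1_indic.
  rewrite !indicE; case: (boolP (z \in E)) => // h.
  by rewrite mem_set//= in_itv/=; apply: Es; move: h; rewrite inE.
rewrite lerBlDr; apply: ge_sup; first by exists e.
move=> x Ex; rewrite -lerBlDl; apply: lb_le_inf; first by exists e.
by move=> y Ey; have := H _ _ Ey Ex; lra.
Qed.

(** The end points of a section need not belong to it; almost extremal points replace them in the
    proof of concavity. *)
Lemma length_approx (E : set R) (eps : R) : bs1 (\1_E) -> E !=set0 -> 0 < eps ->
  exists x y, [/\ E x, E y & \int[mu]_z \1_E z <= y - x + eps].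
Proof.
move=> bE E0 e0; apply: contrapT => H.
have := @length_le E (\int[mu]_z \1_E z - eps) bE E0.
move: (\int[mu]_z \1_E z) H => I H.
have h : forall x y, E x -> E y -> y - x <= I - eps.
  move=> x y Ex Ey; rewrite leNgt; apply/negP => h; apply: H; exists x, y; split => //; lra.
by move=> /(_ h); lra.
Qed.

End Length.

Section Support.
Context {R : realType}.
Notation mu := (@lebesgue_measure R).
Notation mu2 := (mu \x mu)%E.

Definition dot (k z : R * R) : R := k.1 * z.1 + k.2 * z.2.
Definition nrm (k : R * R) : R := Num.sqrt (dot k k).
Definition supp (D : set (R * R)) (k : R * R) : R := sup [set dot k z | z in D].

Lemma dot_ge0 k : 0 <= dot k k.
Proof. by rewrite addr_ge0// -expr2 sqr_ge0. Qed.

Lemma nrm_ge0 k : 0 <= nrm k. Proof. exact: sqrtr_ge0. Qed.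

Lemma sqr_nrm k : nrm k ^+ 2 = dot k k.
Proof. by rewrite sqr_sqrtr// dot_ge0. Qed.

Lemma cauchy_schwarz k z : dot k z <= nrm k * nrm z.
Proof.
have [h|h] := leP (dot k z) 0; first by rewrite (le_trans h)// mulr_ge0// nrm_ge0.
rewrite -(@ler_pXn2r _ 2)// ?nnegrE; [|exact: ltW|by rewrite mulr_ge0// nrm_ge0].
rewrite exprMn !sqr_nrm /dot; have := sqr_ge0 (k.1 * z.2 - k.2 * z.1); nra.
Qed.

Lemma nrm_gt0 k : k != (0, 0) -> 0 < nrm k.
Proof.
move=> k0; rewrite sqrtr_gt0 lt_neqAle dot_ge0 andbT eq_sym; apply: contra k0.
case: k => a b; rewrite /dot/= -!expr2 paddr_eq0 ?sqr_ge0// !sqrf_eq0.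
by move=> /andP[/eqP -> /eqP ->].
Qed.

Variables (D : set (R * R)) (r0 rho : R).
Hypothesis oD : open D.
Hypothesis cD : convex_set2 D.
Hypothesis r00 : 0 < r0.
Hypothesis rD : forall z, nrm z <= r0 -> D z.
Hypothesis Drho : forall z, D z -> nrm z <= rho.

Lemma bounded_of_nrm : bounded_set2 D.
Proof.
exists rho => z /Drho h; have := sqr_nrm z; rewrite /dot => E.
have n0 := nrm_ge0 z; have r0' : 0 <= rho by lra.
by split; rewrite -(@ler_pXn2r _ 2) ?nnegrE// real_normK ?num_real//; nra.
Qed.

Lemma measurable_D : measurable D. Proof. exact: open_measurable2. Qed.

Lemma bs2_D : bs2 (\1_D). Proof. exact: bs2_indic measurable_D bounded_of_nrm. Qed.

Lemma D00 : D (0, 0).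
Proof. by apply: rD; rewrite /nrm /dot/= !mul0r addr0 sqrtr0; exact: ltW. Qed.

Lemma dot_le_supp k z : D z -> dot k z <= supp D k.
Proof.
move=> Dz; apply: ub_le_sup; last by exists z.
exists (nrm k * rho) => _ [y Dy <-]; apply: le_trans (cauchy_schwarz _ _) _.
by rewrite ler_wpM2l ?nrm_ge0// Drho.
Qed.

Lemma supp_le k M : (forall z, D z -> dot k z <= M) -> supp D k <= M.
Proof.
move=> H; apply: ge_sup; first by exists (dot k (0, 0)); exists (0, 0) => //; exact: D00.
by move=> _ [z Dz <-]; exact: H.
Qed.

Lemma supp_ler k : supp D k <= rho * nrm k.
Proof.
apply: supp_le => z Dz; apply: le_trans (cauchy_schwarz _ _) _.
by rewrite mulrC ler_wpM2r ?nrm_ge0// Drho.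
Qed.

Lemma supp_ger k : r0 * nrm k <= supp D k.
Proof.
have [->|k0] := eqVneq k (0, 0).
  rewrite {1}/nrm /dot/= !mul0r addr0 sqrtr0 mulr0.
  by have := dot_le_supp (0, 0) D00; rewrite /dot/= !mul0r addr0.
have n0 := nrm_gt0 k0.
pose z : R * R := (r0 / nrm k * k.1, r0 / nrm k * k.2).
have -> : r0 * nrm k = dot k z.
  have -> : dot k z = r0 / nrm k * dot k k by rewrite /dot /z/=; ring.
  by rewrite -sqr_nrm; field; rewrite gt_eqF.
apply: dot_le_supp; apply: rD.
have -> : nrm z = r0; last by [].
rewrite /nrm; have -> : dot z z = r0 ^+ 2.
  have -> : dot z z = (r0 / nrm k) ^+ 2 * dot k k by rewrite /dot /z/=; ring.
  by rewrite -sqr_nrm; field; rewrite gt_eqF.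
by rewrite sqrtr_sqr ger0_norm// ltW.
Qed.

Lemma supp_add k v : supp D (k.1 + v.1, k.2 + v.2) <= supp D k + rho * nrm v.
Proof.
apply: supp_le => z Dz.
have -> : dot (k.1 + v.1, k.2 + v.2) z = dot k z + dot v z by rewrite /dot/=; ring.
by apply: lerD; [exact: dot_le_supp|apply: le_trans (dot_le_supp _ Dz) (supp_ler _)].
Qed.

(** As [D] is open, [z] can still be pushed a little in the direction [k]. The strict inequality is
    what makes the chord vanish already at [s = supp D k]. *)
Lemma dot_lt_supp k z : k != (0, 0) -> D z -> dot k z < supp D k.
Proof.
move=> k0 Dz; have n0 := nrm_gt0 k0.
have /nbhs_ballP [e /= e0 eD] := open_nbhs_nbhs (conj oD Dz).
pose d := e / (2 * (`|k.1| + `|k.2| + 1)).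
have K0 : 0 < `|k.1| + `|k.2| + 1 by have := normr_ge0 k.1; have := normr_ge0 k.2; lra.
have d0 : 0 < d by rewrite divr_gt0// mulr_gt0.
have small x : `|x| <= `|k.1| + `|k.2| -> `|d * x| < e.
  move=> hx; rewrite normrM gtr0_norm//; apply: (@le_lt_trans _ _ (e / 2)); last lra.
  have -> : e / 2 = d * (`|k.1| + `|k.2| + 1) by rewrite /d; field; lra.
  by rewrite ler_pM2l//; lra.
have Dy : D (z.1 + d * k.1, z.2 + d * k.2).
  apply: eD; split; rewrite /ball/= opprD addrA subrr add0r normrN; apply: small;
    have := normr_ge0 k.1; have := normr_ge0 k.2; lra.
apply: lt_le_trans (dot_le_supp k Dy).
have -> : dot k (z.1 + d * k.1, z.2 + d * k.2) = dot k z + d * dot k k by rewrite /dot/=; ring.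
by rewrite ltrDl mulr_gt0// -sqr_nrm exprn_gt0.
Qed.

Variable k : R * R.
Hypothesis k0 : k != (0, 0).
Let q := dot k k.

Let q0 : 0 < q. Proof. by rewrite /q -sqr_nrm exprn_gt0// nrm_gt0. Qed.
Let qn0 : q != 0. Proof. by rewrite gt_eqF. Qed.

(* The point with [dot k] equal to [s] and abscissa [tau] along the orthogonal
   direction; the change of variables [(tau, s) -> chpt k s tau] has Jacobian 1. *)
Definition chpt (k : R * R) (s tau : R) : R * R :=
  (- k.2 * tau + k.1 / dot k k * s, k.1 * tau + k.2 / dot k k * s).

(** The parameter [tau] runs through the line at speed [nrm k], so this is the Euclidean length of
    the chord divided by [nrm k]; hence the quotient in [chord_le]. *)
Definition chord (k : R * R) (s : R) : R := \int[mu]_tau \1_D (chpt k s tau).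

Lemma dot_chpt s tau : dot k (chpt k s tau) = s.
Proof. by rewrite /chpt /dot/=; field; exact: qn0. Qed.

Lemma chpt_dot z : chpt k (dot k z) ((k.1 * z.2 - k.2 * z.1) / q) = z.
Proof.
rewrite /chpt [z in RHS]surjective_pairing /q /dot.
by congr pair; field; exact: qn0.
Qed.

Let det : - k.2 * (k.2 / q) - k.1 * (k.1 / q) = -1.
Proof. by rewrite /q /dot; field; exact: qn0. Qed.

Let detn0 : - k.2 * (k.2 / q) - k.1 * (k.1 / q) != 0.
Proof. by rewrite det oppr_eq0 oner_eq0. Qed.

Let bs2_chpt : bs2 (fun z => \1_D (chpt k z.2 z.1)).
Proof. exact: (bs2_lin detn0 bs2_D). Qed.

Lemma bs1_chord_section s : bs1 (fun tau => \1_D (chpt k s tau)).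
Proof. exact: (bs2_section2 s bs2_chpt). Qed.

Lemma bs1_chord : bs1 (chord k).
Proof. exact: (bs2_int2 bs2_chpt). Qed.

Lemma int2_chord (g : R -> R) M : measurable_fun setT g -> (forall x, `|g x| <= M) ->
  \int[mu2]_z (g (dot k z) * \1_D z) = \int[mu]_s (g s * chord k s).
Proof.
move=> mg gM.
have bF : bs2 (fun z => g (dot k z) * \1_D z).
  apply: (@bs2M _ _ _ M) => //; first exact: bs2_D.
  by apply: measurableT_comp mg _; exact: measurable_lin2.
have := int2_lin detn0 bF; rewrite det normrN1 invr1 mul1r => <-.
rewrite (int2_fubini2 (bs2_lin detn0 bF))/=; apply: eq_Rintegral => s _.
rewrite /chord -int1Z; last exact: bs1_chord_section.
by apply: eq_Rintegral => tau _; rewrite -/(chpt k s tau) dot_chpt.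
Qed.

Lemma chord_ge0 s : 0 <= chord k s.
Proof. by apply: int1_ge0 => tau; rewrite indicE. Qed.

Lemma chord_eq0 s : supp D k <= s -> chord k s = 0.
Proof.
move=> h; rewrite /chord -[RHS](@int10 R); apply: eq_Rintegral => tau _.
rewrite indicE memNset// => /(dot_lt_supp k0); rewrite dot_chpt; lra.
Qed.

Let Sec s := [set tau | D (chpt k s tau)].

Let secE s : (fun tau => \1_D (chpt k s tau)) = \1_(Sec s) :> (R -> R).
Proof. by apply/funext => tau; rewrite !indicE; congr (_ : bool)%:R; apply/idP/idP; rewrite !inE. Qed.

Let bSec s : bs1 (\1_(Sec s)).
Proof. by rewrite -secE; exact: bs1_chord_section. Qed.

Let chordE s : chord k s = \int[mu]_tau \1_(Sec s) tau.
Proof. by rewrite -secE. Qed.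

Let Sec_ne s : - (r0 * nrm k) <= s -> s < supp D k -> Sec s !=set0.
Proof.
move=> s1 s2; have n0 := nrm_gt0 k0.
have [sp|sn] := ltP 0 s.
  have [_ [z Dz <-] sz] : exists2 x, [set dot k z | z in D] x & s < x.
    apply: sup_gt => //; by exists (dot k (0, 0)); exists (0, 0) => //; exact: D00.
  pose l := s / dot k z.
  have dz : 0 < dot k z by lra.
  have l01 : 0 <= l <= 1 by rewrite divr_ge0 ?ler_pdivrMr//=; lra.
  have := cD D00 Dz l01; rewrite !mulr0 !add0r => Dl.
  exists ((k.1 * (l * z.2) - k.2 * (l * z.1)) / q); rewrite /Sec/=.
  have := chpt_dot (l * z.1, l * z.2) => /=.
  have -> : dot k (l * z.1, l * z.2) = s.
    have -> : dot k (l * z.1, l * z.2) = l * dot k z by rewrite /dot/=; ring.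
    by rewrite /l; field; lra.
  by move=> ->.
exists 0; rewrite /Sec/=; apply: rD.
rewrite -(@ler_pXn2r _ 2) ?nnegrE ?nrm_ge0//; last exact: ltW.
rewrite sqr_nrm; have -> : dot (chpt k s 0) (chpt k s 0) = s ^+ 2 / q.
  by rewrite /chpt /q /dot/=; field; exact: qn0.
rewrite ler_pdivrMr// /q -sqr_nrm; nra.
Qed.

Lemma chord_concave s1 s2 l : - (r0 * nrm k) <= s1 -> s1 < supp D k ->
  - (r0 * nrm k) <= s2 -> s2 < supp D k -> 0 <= l <= 1 ->
  (1 - l) * chord k s1 + l * chord k s2 <= chord k ((1 - l) * s1 + l * s2).
Proof.
(* The Brunn-Minkowski argument in the plane: convex combinations of almost extremal points of the
   two sections lie in the intermediate one. The lower bounds on [s1] and [s2] guarantee that these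
   sections are nonempty. *)
move=> a1 b1 a2 b2 /andP[l0 l1].
apply/ler_addgt0Pr => e e0.
have [x1 [y1 [Ex1 Ey1 h1]]] := length_approx (bSec s1) (Sec_ne a1 b1) e0.
have [x2 [y2 [Ex2 Ey2 h2]]] := length_approx (bSec s2) (Sec_ne a2 b2) e0.
rewrite -!chordE in h1 h2.
set s := (1 - l) * s1 + l * s2.
have cmb t1 t2 : Sec s1 t1 -> Sec s2 t2 -> Sec s ((1 - l) * t1 + l * t2).
  rewrite /Sec/= => D1 D2; have := cD D1 D2 (l := l); rewrite l0 l1 => /(_ isT).
  by congr D; rewrite /chpt/= /s; congr pair; ring.
have Ex := cmb _ _ Ex1 Ex2; have Ey := cmb _ _ Ey1 Ey2.
have conv t u v : Sec s u -> Sec s v -> u <= t <= v -> Sec s t.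
  move=> Eu Ev /andP[ut tv]; have [uv|uv] := eqVneq u v.
    by have -> : t = u by lra.
  have uv' : u < v by lra.
  pose m := (t - u) / (v - u).
  have m01 : 0 <= m <= 1 by rewrite divr_ge0 ?ler_pdivrMr//=; lra.
  have := cD Eu Ev m01; rewrite /Sec/=; congr D.
  have em : t = (1 - m) * u + m * v by rewrite /m; field; lra.
  by rewrite [in RHS]em /chpt/=; congr pair; ring.
set x := (1 - l) * x1 + l * x2 in Ex; set y := (1 - l) * y1 + l * y2 in Ey.
have lo : y - x <= chord k s.
  have [xy|yx] := leP x y; last by apply: le_trans (chord_ge0 _); lra.
  by rewrite chordE; apply: length_ge => // t; exact: conv Ex Ey.
have : (1 - l) * chord k s1 + l * chord k s2 <= (1 - l) * (y1 - x1 + e) + l * (y2 - x2 + e).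
  by apply: lerD; apply: ler_wpM2l => //; lra.
move: lo; rewrite /x /y; lra.
Qed.

Lemma chord_le s W : 0 <= W -> - (r0 * nrm k) <= s -> s < supp D k ->
  (forall y y', D y -> D y' -> dot k y = s -> dot k y' = s ->
     dot (y.1 - y'.1, y.2 - y'.2) (y.1 - y'.1, y.2 - y'.2) <= W) ->
  chord k s <= Num.sqrt W / nrm k.
Proof.
move=> W0 s1 s2 H; have n0 := nrm_gt0 k0; rewrite chordE.
apply: length_le => //; first exact: Sec_ne.
move=> x y Ex Ey; have := H _ _ Ex Ey (dot_chpt s x) (dot_chpt s y).
have -> : dot ((chpt k s x).1 - (chpt k s y).1, (chpt k s x).2 - (chpt k s y).2)
   ((chpt k s x).1 - (chpt k s y).1, (chpt k s x).2 - (chpt k s y).2) = ((y - x) * nrm k) ^+ 2.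
  by rewrite exprMn sqr_nrm /chpt /dot/=; ring.
move=> h; rewrite ler_pdivlMr//; apply: le_trans (ler_norm _) _.
by rewrite -sqrtr_sqr ler_wsqrtr.
Qed.

End Support.

Lemma chordN {R : realType} (D : set (R * R)) (k : R * R) (s : R) :
  bs1 (fun tau => \1_D (chpt k (- s) tau) : R) ->
  chord D (- k.1, - k.2) s = chord D k (- s).
Proof.
move=> b; rewrite /chord.
have n1 : (-1 : R) != 0 by rewrite oppr_eq0 oner_eq0.
have := int1_affine 0 n1 b; rewrite normrN1 invr1 mul1r => <-.
apply: eq_Rintegral => tau _; congr (\1_D _); rewrite /chpt /dot/=.
by rewrite !mulrNN; congr pair; ring.
Qed.

(** * Almost orthogonality *)

Section Counting.
Context {R : realType}.
Notation mu := (@lebesgue_measure R).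
Notation mu2 := (mu \x mu)%E.

Definition kr (k : int * int) : R * R := (k.1%:~R, k.2%:~R).

Lemma bs2B (f g : R * R -> R) : bs2 f -> bs2 g -> bs2 (fun z => f z - g z).
Proof.
move=> bf bg; have := bs2D bf (bs2Z (-1) bg).
by under [X in bs2 X -> _]eq_fun do rewrite mulN1r.
Qed.

Lemma sum_le_single (T : eqType) (s : seq T) (f : T -> R) (k0 : T) : uniq s ->
  (forall k, 0 <= f k) -> (forall k, f k != 0 -> k = k0) -> \sum_(k <- s) f k <= f k0.
Proof.
move=> us f0 H; have [ks|ks] := boolP (k0 \in s).
  rewrite (bigD1_seq k0)//= big1 ?addr0// => i; apply: contra_neq_eq => /H ->//.
rewrite big_seq big1// => i is'; apply: contraNeq ks => /H <-//.
Qed.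

Definition usq (k : int * int) (z : R * R) : R :=
  \1_`[(k.1%:~R : R), k.1%:~R + 1[%classic z.1 * \1_`[(k.2%:~R : R), k.2%:~R + 1[%classic z.2.

Lemma usq_ge0 k z : 0 <= usq k z.
Proof. by rewrite mulr_ge0// indicE. Qed.

Lemma usq_neq0 k z : usq k z != 0 ->
  k.1%:~R <= z.1 < k.1%:~R + 1 /\ k.2%:~R <= z.2 < k.2%:~R + 1.
Proof.
rewrite /usq !indic_coE; case: (boolP (_ <= _ < _)) => h1; last by rewrite mul0r eqxx.
by case: (boolP (_ <= _ < _)) => h2; last by rewrite mulr0 eqxx.
Qed.

Lemma usq_le1 k z : usq k z <= 1.
Proof. by rewrite /usq !indic_coE; case: (_ <= _ < _); case: (_ <= _ < _); rewrite ?mul1r ?mul0r. Qed.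

Lemma int_usq k : \int[mu2]_z usq k z = 1.
Proof.
rewrite /usq int2_prod; [|exact: bs1_indic|exact: bs1_indic].
by rewrite !int1_indic ?lerDl// !(addrAC _ 1) !subrr !add0r mulr1.
Qed.

Lemma bs2_usq k : bs2 (usq k).
Proof. by apply: bs2_prod; exact: bs1_indic. Qed.

Lemma itv_floor (x : R) (i : int) : i%:~R <= x < i%:~R + 1 -> i = Num.floor x.
Proof.
move=> h; apply/esym/Num.Theory.floor_def; rewrite rmorphD/=; exact: h.
Qed.

(** The half-open unit squares at distinct lattice points are disjoint and have area 1, so a
    function that is at least 1 on each of them has integral at least their number. *)
Lemma count_le (s : seq (int * int)) (G : R * R -> R) : uniq s -> bs2 G ->
  (forall z, 0 <= G z) -> (forall k z, k \in s -> usq k z != 0 -> 1 <= G z) ->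
  (size s)%:R <= \int[mu2]_z G z.
Proof.
move=> us bG G0 GH.
have -> : (size s)%:R = \int[mu2]_z \sum_(k <- s) usq k z.
  rewrite int2_sum; last exact: bs2_usq.
  under eq_bigr do rewrite int_usq.
  by rewrite big_const_seq count_predT iter_addr addr0.
apply: le_int2 => [||z] //; first by apply: bs2_sum; exact: bs2_usq.
rewrite big_seq_cond; under eq_bigl do rewrite andbT.
have [/hasP[k ks kz]|/hasPn h] := boolP (has (fun k => usq k z != 0) s).
  rewrite -big_seq; apply: le_trans (GH _ _ ks kz).
  apply: le_trans (usq_le1 k z); apply: sum_le_single => // [k'|k' k'z].
    exact: usq_ge0.
  have [a1 a2] := usq_neq0 kz; have [b1 b2] := usq_neq0 k'z.
  rewrite (surjective_pairing k) (surjective_pairing k').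
  by rewrite (itv_floor a1) (itv_floor a2) (itv_floor b1) (itv_floor b2).
rewrite big1 ?G0// => k ks; apply/eqP; exact: (negbNE (h _ ks)).
Qed.

Section Bins.
Variables (D : set (R * R)) (r0 rho : R).
Hypothesis r00 : 0 < r0.
Hypothesis rD : forall z, nrm z <= r0 -> D z.
Hypothesis Drho : forall z, D z -> nrm z <= rho.

Lemma nrm_le_sum (z : R * R) : nrm z <= `|z.1| + `|z.2|.
Proof.
rewrite -(@ler_pXn2r _ 2) ?nnegrE ?nrm_ge0 ?addr_ge0//.
rewrite sqr_nrm /dot -!expr2 -(real_normK (num_real z.1)) -(real_normK (num_real z.2)).
have := normr_ge0 z.1; have := normr_ge0 z.2; nra.
Qed.

Lemma norm_le_nrm (z : R * R) : `|z.1| <= nrm z /\ `|z.2| <= nrm z.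
Proof.
split; rewrite -(@ler_pXn2r _ 2) ?nnegrE ?nrm_ge0// sqr_nrm /dot real_normK ?num_real// -!expr2.
  by rewrite lerDl sqr_ge0.
by rewrite lerDr sqr_ge0.
Qed.

Lemma rho_ge0 : 0 <= rho.
Proof. by apply: le_trans (nrm_ge0 _) (Drho (D00 r00 rD)). Qed.

Lemma supp_sub_le (x y : R * R) : supp D x <= supp D y + rho * (`|x.1 - y.1| + `|x.2 - y.2|).
Proof.
have := supp_add r00 rD Drho y (x.1 - y.1, x.2 - y.2).
rewrite /= !(addrC _ (_ - _)) !subrK -surjective_pairing => h.
apply: le_trans h _; rewrite lerD2l ler_wpM2l ?rho_ge0//; exact: nrm_le_sum.
Qed.

Lemma supp_scale u (z : R * R) : 0 < u -> supp D (u * z.1, u * z.2) = u * supp D z.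
Proof.
move=> u0.
have le w (y : R * R) : 0 < w -> supp D (w * y.1, w * y.2) <= w * supp D y.
  move=> w0; apply: (supp_le r00 rD) => v Dv.
  have -> : dot (w * y.1, w * y.2) v = w * dot y v by rewrite /dot/=; ring.
  by rewrite ler_pM2l// (dot_le_supp Drho).
apply/eqP; rewrite eq_le le//=.
have := le u^-1 (u * z.1, u * z.2); rewrite invr_gt0 => /(_ u0) /=.
by rewrite !mulKf ?gt_eqF// -surjective_pairing -ler_pdivlMl ?invr_gt0// invrK.
Qed.

(** For [u > 0] this is the interior of the polar body of [D], dilated by [u]. *)
Let lev u : set (R * R) := [set z | supp D z < u].

Let open_lev u : open (lev u).
Proof.
rewrite openE => z; rewrite /lev/= => zu; apply/nbhs_ballP.
have rp := rho_ge0.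
exists ((u - supp D z) / (2 * rho + 1)) => /=; first by rewrite divr_gt0//; lra.
move=> y [/=]; rewrite /ball/= => h1 h2; rewrite /lev/=.
apply: le_lt_trans (supp_sub_le y z) _.
rewrite distrC in h1; rewrite distrC in h2.
rewrite ltr_pdivlMr in h1; last lra.
rewrite ltr_pdivlMr in h2; last lra.
have := normr_ge0 (y.1 - z.1); have := normr_ge0 (y.2 - z.2); nra.
Qed.

Let lev_bnd u z : lev u z -> `|z.1| <= u / r0 /\ `|z.2| <= u / r0.
Proof.
have r := r00; rewrite /lev/= => h; have := supp_ger r00 rD Drho z => h2.
by have [h3 h4] := norm_le_nrm z; split; rewrite ler_pdivlMr//; nra.
Qed.

Let bs2_lev u : bs2 (\1_(lev u)).
Proof. by apply: bs2_indic; [apply: open_measurable2; exact: open_lev|exists (u / r0) => z /lev_bnd]. Qed.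

Let area_lev u : 0 < u -> \int[mu2]_z \1_(lev u) z = u ^+ 2 * \int[mu2]_z \1_(lev 1) z.
Proof.
move=> u0.
have d0 : u * u - 0 * 0 != 0 by rewrite mulr0 subr0 mulf_neq0// gt_eqF.
have := int2_lin d0 (bs2_lev u); rewrite mulr0 subr0 -expr2 ger0_norm ?sqr_ge0// => h.
have -> : \int[mu2]_z \1_(lev 1) z = \int[mu2]_z \1_(lev u) (u * z.1 + 0 * z.2, 0 * z.1 + u * z.2).
  apply: eq_Rintegral => z _; rewrite !mul0r addr0 add0r !indicE; congr (_ : bool)%:R.
  have E v y : (y \in lev v) = (supp D y < v) by apply/idP/idP; rewrite inE.
  by rewrite !E supp_scale// -[in RHS](mulr1 u) -mulrA mul1r ltr_pM2l.
by rewrite h mulrA divff ?mul1r// sqrf_eq0 gt_eqF.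
Qed.

Let area1 : \int[mu2]_z \1_(lev 1) z <= (2 / r0) ^+ 2.
Proof.
have r := r00; pose I := `[- (1 / r0), 1 / r0]%classic.
have i0 : 0 < 1 / r0 by rewrite divr_gt0.
have -> : (2 / r0) ^+ 2 = \int[mu2]_z (\1_I z.1 * \1_I z.2).
  rewrite (int2_prod (f := \1_I) (g := \1_I)); [|exact: bs1_indic|exact: bs1_indic].
  by rewrite !int1_indic; [rewrite expr2; congr (_ * _); field; lra|lra].
apply: le_int2 => // [|z].
  by apply: (bs2_prod (f := \1_I) (g := \1_I)); exact: bs1_indic.
rewrite !indicE; case: (boolP (z \in lev 1)); last by rewrite mulr_ge0.
have E v : `|v| <= 1 / r0 -> v \in I by move=> h; rewrite mem_set// /I/= in_itv/= -ler_norml.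
by rewrite inE => /lev_bnd [h1 h2]; rewrite !E// mul1r.
Qed.

(** The unit squares at the points counted lie in a ring between two dilates of the polar body; its
    area is a difference of squares, hence linear in [j]. The margin [L = 2 * rho] is the variation
    of the support function over a unit square. If [j <= L] the inner dilate is dropped and [j] is
    bounded. *)
Lemma bin_count (s : seq (int * int)) (j : nat) : uniq s ->
  (forall k, k \in s -> j%:R <= supp D (kr k) < j%:R + 1) ->
  (size s)%:R <= 2 * (2 / r0) ^+ 2 * (1 + 4 * rho) ^+ 2 * j.+1%:R.
Proof.
move=> us H; have rp := rho_ge0.
pose L := 2 * rho.
pose G z : R := \1_(lev (j%:R + 1 + L)) z - \1_(lev (j%:R - L)) z.
have bG : bs2 G.
  exact: bs2B.
have sub z : lev (j%:R - L) z -> lev (j%:R + 1 + L) z by rewrite /lev/= /L; lra.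
have G0 z : 0 <= G z.
  rewrite /G !indicE; case: (boolP (z \in lev (j%:R - L))); last by rewrite subr0.
  by rewrite inE => /sub ?; rewrite mem_set// subrr.
have GH k z : k \in s -> usq k z != 0 -> 1 <= G z.
  move=> /H /andP[s1 s2] /usq_neq0 [/andP[z1 z1'] /andP[z2 z2']].
  have d1 : `|z.1 - (kr k).1| <= 1 by rewrite ler_norml /kr/=; apply/andP; split; lra.
  have d2 : `|z.2 - (kr k).2| <= 1 by rewrite ler_norml /kr/=; apply/andP; split; lra.
  have u1 := supp_sub_le z (kr k); have u2 := supp_sub_le (kr k) z.
  rewrite (distrC (kr k).1) (distrC (kr k).2) in u2.
  rewrite /G !indicE mem_set; last by rewrite /lev/= /L; nra.
  by rewrite memNset ?subr0// /lev/= /L; nra.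
apply: le_trans (count_le us bG G0 GH) _.
have -> : \int[mu2]_z G z = \int[mu2]_z \1_(lev (j%:R + 1 + L)) z - \int[mu2]_z \1_(lev (j%:R - L)) z.
  rewrite -mulN1r -int2Z// -int2D//; last exact: bs2Z.
  by apply: eq_Rintegral => z _; rewrite mulN1r.
have j0 : 0 <= j%:R :> R by [].
have L0 : 0 <= L by rewrite /L; lra.
have a0 : 0 <= \int[mu2]_z \1_(lev 1) z by apply: int2_ge0 => z; rewrite indicE.
have a1 := area1.
have jS : j.+1%:R = j%:R + 1 :> R by rewrite -natr1.
rewrite area_lev; last lra.
have main x : x <= 2 * (1 + 4 * rho) ^+ 2 * j.+1%:R -> 0 <= x ->
    x * \int[mu2]_z \1_(lev 1) z <= 2 * (2 / r0) ^+ 2 * (1 + 4 * rho) ^+ 2 * j.+1%:R.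
  move=> hx x0; apply: (@le_trans _ _ (2 * (1 + 4 * rho) ^+ 2 * j.+1%:R * (2 / r0) ^+ 2)).
    by rewrite ler_pM.
  by rewrite le_eqVlt; apply/orP; left; apply/eqP; ring.
have [jL|jL] := ltP L j%:R.
  rewrite (area_lev (u := j%:R - L)); last lra.
  rewrite -mulrBl; apply: main.
    have -> : (j%:R + 1 + L) ^+ 2 - (j%:R - L) ^+ 2 = (1 + 4 * rho) * (2 * j%:R + 1) by rewrite /L; ring.
    rewrite jS; nra.
  have -> : (j%:R + 1 + L) ^+ 2 - (j%:R - L) ^+ 2 = (1 + 4 * rho) * (2 * j%:R + 1) by rewrite /L; ring.
  by apply: mulr_ge0; lra.
apply: (@le_trans _ _ ((j%:R + 1 + L) ^+ 2 * \int[mu2]_z \1_(lev 1) z)).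
  by rewrite gerBl; apply: int2_ge0 => z; rewrite indicE.
apply: main; last by rewrite sqr_ge0.
rewrite jS; have : (j%:R + 1 + L) ^+ 2 <= (1 + 4 * rho) ^+ 2.
  by rewrite lerXn2r ?nnegrE; rewrite /L in jL L0 *; lra.
have := sqr_ge0 (1 + 4 * rho); nra.
Qed.

End Bins.

(** Telescoping against the bounded increasing function [phi x = x / (1 + |x|)]: each of its unit
    increments is at least a quarter of the corresponding term, and [phi + 1] is at most 2. *)
Lemma sum_kappa (p J : nat) :
  \sum_(m < J) (1 + (p%:R - m%:R) ^+ 2)^-1 <= 8 :> R.
Proof.
pose phi (x : R) := x / (1 + `|x|).
have phi1 x : - 1 <= phi x <= 1.
  have n0 := normr_ge0 x; have := ler_norm x; have := ler_norm (- x); rewrite normrN => h1 h2.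
  by rewrite /phi ler_pdivlMr ?ler_pdivrMr; [apply/andP; split; lra|lra|lra].
have H : \sum_(m < J) (1 + (p%:R - m%:R) ^+ 2)^-1 <= 4 * (phi (J%:R - p%:R) + 1).
  elim: J => [|J IH].
    by rewrite big_ord0; have /andP[? ?] := phi1 (0%:R - p%:R); lra.
  rewrite big_ord_recr/=; apply: (@le_trans _ _ (4 * (phi (J%:R - p%:R) + 1) + (1 + (p%:R - J%:R) ^+ 2)^-1)).
    by rewrite lerD2r.
  have [pJ|Jp] := leqP p J.
    have -> : J.+1%:R - p%:R = (J - p)%N%:R + 1 :> R by rewrite -natr1 natrB//; ring.
    have -> : p%:R - J%:R = - (J - p)%N%:R :> R by rewrite natrB//; ring.
    have -> : J%:R - p%:R = (J - p)%N%:R :> R by rewrite natrB.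
    set x := (J - p)%N%:R; have x0 : 0 <= x :> R by [].
    rewrite /phi sqrrN !ger0_norm ?addr_ge0//.
    have h : (1 + x ^+ 2)^-1 <= 4 / ((1 + x) * (2 + x)).
      by rewrite ler_pdivlMr ?mulr_gt0//; [rewrite mulrC ler_pdivrMr; nra|lra|lra].
    have -> : (x + 1) / (1 + (x + 1)) = x / (1 + x) + 1 / ((1 + x) * (2 + x)) by field; apply/andP; split; lra.
    have -> : 1 / ((1 + x) * (2 + x)) = (4 / ((1 + x) * (2 + x))) / 4 by field; apply/andP; split; lra.
    lra.
  have -> : J.+1%:R - p%:R = - (p - J.+1)%N%:R :> R by rewrite natrB//; ring.
  have -> : p%:R - J%:R = (p - J.+1)%N%:R + 1 :> R by rewrite natrB// -natr1; ring.
  have -> : J%:R - p%:R = - ((p - J.+1)%N%:R + 1) :> R by rewrite natrB// -natr1; ring.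
  set x := (p - J.+1)%N%:R; have x0 : 0 <= x :> R by [].
  rewrite /phi !normrN !ger0_norm ?addr_ge0//.
  have h : (1 + (x + 1) ^+ 2)^-1 <= 4 / ((1 + x) * (2 + x)).
    by rewrite ler_pdivlMr ?mulr_gt0//; [rewrite mulrC ler_pdivrMr; nra|lra|lra].
  have -> : - (x + 1) / (1 + (x + 1)) = - x / (1 + x) - 1 / ((1 + x) * (2 + x)) by field; apply/andP; split; lra.
  have -> : 1 / ((1 + x) * (2 + x)) = (4 / ((1 + x) * (2 + x))) / 4 by field; apply/andP; split; lra.
  lra.
by apply: le_trans H _; have /andP[? ?] := phi1 (J%:R - p%:R); lra.
Qed.

Lemma kappa_floor (x y : R) (j m : nat) : j%:R <= x < j%:R + 1 -> m%:R <= y < m%:R + 1 ->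
  (1 + (x - y) ^+ 2)^-1 <= 4 * (1 + (j%:R - m%:R) ^+ 2)^-1.
Proof.
move=> /andP[x1 x2] /andP[y1 y2].
set d := j%:R - m%:R; have h1 : d - 1 <= x - y by rewrite /d; lra.
have h2 : x - y <= d + 1 by rewrite /d; lra.
set z := x - y in h1 h2 *.
have z2 : 0 < 1 + z ^+ 2 by rewrite ltr_pwDl ?sqr_ge0.
have d2 : 0 < 1 + d ^+ 2 by rewrite ltr_pwDl ?sqr_ge0.
rewrite -[X in X <= _]mul1r ler_pdivrMr// mulrAC ler_pdivlMr//.
have [dp|dn] := leP 1 `|d|.
  have : (`|d| - 1) ^+ 2 <= z ^+ 2.
    rewrite -(real_normK (num_real z)) lerXn2r ?nnegrE//; first lra.
    have := ler_norm z; have := ler_norm (- z); rewrite normrN => ? ?.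
    by rewrite lerBlDr ler_norml; apply/andP; split; lra.
  by rewrite -(real_normK (num_real d)); nra.
have : d ^+ 2 <= 1 by rewrite -(real_normK (num_real d)); have := normr_ge0 d; nra.
have := sqr_ge0 z; nra.
Qed.

(** The weights in Schur's test are the bin sizes: dividing by [(j l).+1] offsets the [C0 * m.+1]
    members that bin [m] may have, so each row sum reduces to [sum_kappa]. The constant 32 is the 4
    of [kappa_floor] times the 8 of [sum_kappa]. *)
Lemma schur_bins (I : eqType) (s : seq I) (x be : I -> R) (j : I -> nat) (C0 : R) : 0 <= C0 ->
  (forall i, 0 <= be i) ->
  (forall i, (j i)%:R <= x i < (j i)%:R + 1) ->
  (forall m, (size [seq i <- s | j i == m])%:R <= C0 * m.+1%:R) ->
  \sum_(i <- s) \sum_(l <- s) be i * be l * (576 / (1 + (x i - x l) ^+ 2)) <=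
  576 * 32 * C0 * \sum_(i <- s) be i ^+ 2 * (j i).+1%:R.
Proof.
move=> C00 be0 jx cnt.
pose ka (i l : I) : R := (1 + (x i - x l) ^+ 2)^-1.
have ka0 i l : 0 <= ka i l by rewrite invr_ge0 addr_ge0// sqr_ge0.
have kaC i l : ka i l = ka l i by rewrite /ka -sqrrN opprB.
have S0 i : 0 < (j i).+1%:R :> R by rewrite ltr0n.
have c288 : 0 < 288 :> R by rewrite ltr0n.
pose f i l := be i ^+ 2 * (j i).+1%:R * (ka i l / (j l).+1%:R).
have term i l : be i * be l * (576 / (1 + (x i - x l) ^+ 2)) <= 288 * (f i l + f l i).
  have -> : be i * be l * (576 / (1 + (x i - x l) ^+ 2)) = 288 * (2 * (be i * be l) * ka i l).
    by rewrite /ka; ring.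
  rewrite (ler_pM2l c288).
  have -> : f i l + f l i = (be i ^+ 2 * ((j i).+1%:R / (j l).+1%:R) + be l ^+ 2 * ((j l).+1%:R / (j i).+1%:R)) * ka i l.
    by rewrite /f (kaC l i); ring.
  apply: ler_wpM2r => //.
  have := S0 i; have := S0 l; set u := (j i).+1%:R; set v := (j l).+1%:R => v0 u0.
  have -> : be i ^+ 2 * (u / v) + be l ^+ 2 * (v / u) =
    ((be i * u) ^+ 2 + (be l * v) ^+ 2) / (u * v) by field; apply/andP; split; lra.
  rewrite ler_pdivlMr ?mulr_gt0//; have := sqr_ge0 (be i * u - be l * v); nra.
have row i : \sum_(l <- s) ka i l / (j l).+1%:R <= 32 * C0.
  pose J := \max_(l <- s) (j l).+1.
  have jJ l : l \in s -> (j l < J)%N.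
    by move=> ls; exact: (@leq_bigmax_seq _ s xpredT (fun l => (j l).+1) l ls isT).
  apply: (@le_trans _ _ (\sum_(l <- s) \sum_(m < J | j l == m) 4 * (1 + ((j i)%:R - m%:R) ^+ 2)^-1 / m.+1%:R)).
    rewrite big_seq [leRHS]big_seq; apply: ler_sum => l ls.
    rewrite (big_pred1 (Ordinal (jJ l ls))) => [|m]; last by rewrite /= eq_sym.
    by rewrite /= ler_pM2r ?invr_gt0//; exact: kappa_floor.
  rewrite (exchange_big_dep xpredT)//=.
  apply: (@le_trans _ _ (\sum_(m < J) 4 * C0 * (1 + ((j i)%:R - m%:R) ^+ 2)^-1)).
    apply: ler_sum => m _; rewrite -big_filter big_const_seq count_predT iter_addr addr0.
    rewrite -[X in X <= _]mulr_natr; have := cnt m.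
    set c := (size _)%:R; set e := (1 + _)^-1 => h.
    have e0 : 0 <= e by rewrite invr_ge0 addr_ge0// sqr_ge0.
    have m0 : 0 < m.+1%:R :> R by rewrite ltr0n.
    rewrite mulrAC ler_pdivrMr//.
    have -> : 4 * C0 * e * m.+1%:R = 4 * e * (C0 * m.+1%:R) by ring.
    by rewrite ler_wpM2l// mulr_ge0.
  rewrite -mulr_sumr; have := sum_kappa (j i) J; nra.
apply: (@le_trans _ _ (\sum_(i <- s) \sum_(l <- s) (288 * (f i l + f l i)))).
  by apply: ler_sum => i _; apply: ler_sum => l _; exact: term.
under eq_bigr do rewrite -mulr_sumr big_split/=.
rewrite -mulr_sumr big_split/= [X in _ + X]exchange_big/=.
have fE : \sum_(i <- s) \sum_(l <- s) f i l <= 32 * C0 * \sum_(i <- s) be i ^+ 2 * (j i).+1%:R.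
  rewrite mulr_sumr; apply: ler_sum => i _; rewrite -mulr_sumr mulrC.
  by apply: ler_wpM2r => //; rewrite mulr_ge0 ?sqr_ge0// ltW.
have -> : 576 * 32 * C0 * \sum_(i <- s) be i ^+ 2 * (j i).+1%:R =
  288 * (32 * C0 * \sum_(i <- s) be i ^+ 2 * (j i).+1%:R + 32 * C0 * \sum_(i <- s) be i ^+ 2 * (j i).+1%:R) by ring.
by rewrite (ler_pM2l c288) lerD.
Qed.

End Counting.

(** * The smoothed lattice point count *)

Lemma near_int_uniq (R : realType) (e u : R) (i j : int) : e <= 4^-1 ->
  `|u - i%:~R| <= e -> `|u - j%:~R| <= e -> i = j.
Proof.
rewrite !ler_norml => e4 /andP[a1 a2] /andP[b1 b2].
have : (`|i - j| < 1)%R by rewrite -(ltr_int R) intr_norm rmorphB/= ltr_norml; apply/andP; split; lra.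
clear; lia.
Qed.

Section LatticeCompare.
Context {R : realType}.
Notation mu := (@lebesgue_measure R).
Notation mu2 := (mu \x mu)%E.
Variables (D : set (R * R)) (r0 rho : R).
Hypothesis oD : open D.
Hypothesis cD : convex_set2 D.
Hypothesis r00 : 0 < r0.
Hypothesis rD : forall z, nrm z <= r0 -> D z.
Hypothesis Drho : forall z, D z -> nrm z <= rho.

Let bD : bs2 (\1_D). Proof. exact: bs2_D oD Drho. Qed.

Lemma lattice_ptsP t (p : int * int) : 0 < t ->
  lattice_pts D t p <-> D (p.1%:~R / t, p.2%:~R / t).
Proof.
move=> t0; split=> [[x Dx [-> ->]]|Dp].
  by rewrite !(mulrC t) !mulfK ?gt_eqF// -surjective_pairing.
by exists (p.1%:~R / t, p.2%:~R / t) => //=; rewrite !(mulrC t) !divfK ?gt_eqF.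
Qed.

Lemma lattice_pts_bnd t (p : int * int) : 0 < t -> lattice_pts D t p ->
  `|p.1%:~R : R| <= t * rho /\ `|p.2%:~R : R| <= t * rho.
Proof.
move=> t0 /(lattice_ptsP _ t0) /Drho h.
have [/= h1 h2] := norm_le_nrm (p.1%:~R / t, p.2%:~R / t).
rewrite !normrM !normfV (gtr0_norm t0) !ler_pdivrMr// in h1 h2.
by split; apply: le_trans (_ : _ <= rho * t) _; rewrite ?(mulrC t)//;
  [apply: le_trans h1 _|apply: le_trans h2 _]; rewrite ler_pM2r.
Qed.

Lemma finite_lattice_pts t : 0 < t -> finite_set (lattice_pts D t).
Proof.
move=> t0.
pose M := `|Num.floor (t * rho)|%N.
apply: (@sub_finite_set _ _ [set` [seq (x, y) | x <- rng M, y <- rng M]]); last exact: finite_seq.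
move=> [a b] /(lattice_pts_bnd t0) [/= h1 h2].
have key (i : int) : `|i%:~R : R| <= t * rho -> i \in rng M.
  move=> h; rewrite mem_rng /M.
  have fi : (`|i| <= Num.floor (t * rho))%R.
    by rewrite Num.Theory.floor_ge_int intr_norm.
  by have : (0 <= `|i|)%R by []; lia.
exact: allpairs_f (key _ h1) (key _ h2).
Qed.

Let pts t : seq (int * int) := fset_set (lattice_pts D t).

Let mem_pts t p : 0 < t -> (p \in pts t) = (lattice_pts D t p) :> Prop.
Proof. by move=> t0; rewrite /pts in_fset_set ?inE//; exact: finite_lattice_pts. Qed.

Let uniq_pts t : uniq (pts t). Proof. exact: fset_uniq. Qed.

Lemma Ncount_size t : Ncount D t = (size (fset_set (lattice_pts D t)))%:R.
Proof. by []. Qed.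

Lemma Ncount_le t : 0 < t -> Ncount D t <= 4 * (t * rho + 1) ^+ 2.
Proof.
move=> t0; pose M := t * rho + 1.
have M0 : 0 < M by have := rho_ge0 r00 rD Drho; rewrite /M; nra.
pose I := `[- M, M]%classic.
have b1 : bs1 (\1_I : R -> R) by exact: bs1_indic.
have bG := bs2_prod b1 b1.
have -> : 4 * (t * rho + 1) ^+ 2 = \int[mu2]_z (\1_I z.1 * \1_I z.2).
  by rewrite (int2_prod b1 b1) !int1_indic; [rewrite /M; ring|lra].
rewrite Ncount_size; apply: (count_le (uniq_pts t) bG _ _) => [z|k z].
  by rewrite mulr_ge0// indicE.
rewrite mem_pts// => /(lattice_pts_bnd t0) [h1 h2] /usq_neq0 [/andP[a1 a2] /andP[a3 a4]].
have E v (i : int) : `|i%:~R : R| <= t * rho -> i%:~R <= v -> v < i%:~R + 1 -> v \in I.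
  rewrite ler_norml => /andP[c1 c2] c3 c4; rewrite mem_set// /I/= in_itv/= /M; apply/andP; split; lra.
by rewrite !indicE (E _ k.1)// (E _ k.2)// mul1r.
Qed.

Variables (N : nat) (eta kap : R).
Hypotheses (eta0 : 0 < eta) (eta4 : eta <= 4^-1).
Hypotheses (kap0 : 0 <= kap) (kap1 : kap <= 1).
Hypothesis kerkap : forall x : R, eta <= `|x| <= 2^-1 -> ker N x <= kap.

Let K0 : R := ker N 0.
(** A displacement by at most [eta] in each coordinate has norm at most [2 * eta = r0 * tau], so it
    lies in [tau D]; by convexity it carries [t D] into [(t + tau) D]. *)
Let tau := 2 * eta / r0.

Definition smooth (z : R * R) : R := ker N z.1 * ker N z.2.
Definition smoothed (t : R) : R :=
  \int[mu2]_z (smooth z * \1_D (z.1 / t, z.2 / t)).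

Let win (m : int * int) (z : R * R) : R :=
  (\1_`[(m.1%:~R - eta : R), m.1%:~R + eta]%classic z.1 * ker N z.1) *
  (\1_`[(m.2%:~R - eta : R), m.2%:~R + eta]%classic z.2 * ker N z.2).
Let w := \int[mu]_x (\1_`[- eta, eta]%classic x * ker N x) : R.

Let w1 : w <= 1. Proof. by have := eta4 => e4; rewrite /w ker_window_le1//; lra. Qed.
Let wk : 1 - kap <= w. Proof. by have := eta4 => e4; rewrite /w ker_window_ge//; lra. Qed.

Let bs1_win (a b : R) : bs1 (fun x => \1_`[a, b]%classic x * ker N x).
Proof. by apply: bs1_itv_mul; exact: continuous_ker. Qed.

Let bs2_win m : bs2 (win m).
Proof. exact: (bs2_prod (bs1_win (m.1%:~R - eta) (m.1%:~R + eta)) (bs1_win (m.2%:~R - eta) (m.2%:~R + eta))). Qed.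

Let int_win m : \int[mu2]_z win m z = w ^+ 2.
Proof.
rewrite /win (int2_prod (bs1_win (m.1%:~R - eta) (m.1%:~R + eta)) (bs1_win (m.2%:~R - eta) (m.2%:~R + eta))).
by rewrite (int_ker_window N eta m.1) (int_ker_window N eta m.2).
Qed.

Let smooth_ge0 z : 0 <= smooth z. Proof. by rewrite mulr_ge0// ker_ge0. Qed.

Let winE m z : win m z = (`|z.1 - m.1%:~R| <= eta)%R%:R * (`|z.2 - m.2%:~R| <= eta)%R%:R * smooth z.
Proof.
have E (u : R) (i : int) : \1_`[i%:~R - eta, i%:~R + eta]%classic u = (`|u - i%:~R| <= eta)%R%:R :> R.
  rewrite indicE; have -> // : (u \in `[i%:~R - eta, i%:~R + eta]%classic) = (`|u - i%:~R| <= eta).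
  by apply/idP/idP; rewrite inE/= in_itv/= ler_norml => /andP[? ?]; apply/andP; split; lra.
by rewrite /win !E /smooth; ring.
Qed.

Let uniq_near (u : R) (i j : int) : `|u - i%:~R| <= eta -> `|u - j%:~R| <= eta -> i = j.
Proof. by apply: near_int_uniq; have := eta4; lra. Qed.

Let sum_win_le (s : seq (int * int)) z : uniq s -> \sum_(m <- s) win m z <= smooth z.
Proof.
move=> us; have e (m : int * int) : win m z <= smooth z.
  by rewrite winE; case: (`|z.1 - _| <= _); case: (`|z.2 - _| <= _); rewrite ?mul1r ?mul0r.
have [/hasP[m ms mz]|/hasPn h] := boolP (has (fun m => win m z != 0) s); last first.
  rewrite big_seq big1 ?smooth_ge0// => m ms; apply/eqP; exact: (negbNE (h _ ms)).
apply: le_trans (e m); apply: sum_le_single => // [k|k].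
  by rewrite winE mulr_ge0// mulr_ge0.
move: mz; rewrite !winE.
case: (boolP (`|z.1 - m.1%:~R| <= eta)) => a1; last by rewrite !mul0r eqxx.
case: (boolP (`|z.2 - m.2%:~R| <= eta)) => a2; last by rewrite mulr0 mul0r eqxx.
case: (boolP (`|z.1 - k.1%:~R| <= eta)) => b1; last by rewrite !mul0r eqxx.
case: (boolP (`|z.2 - k.2%:~R| <= eta)) => b2; last by rewrite mulr0 mul0r eqxx.
move=> _ _; rewrite (surjective_pairing k) (surjective_pairing m).
by rewrite (uniq_near a1 b1) (uniq_near a2 b2).
Qed.

Let taup : 0 < tau. Proof. by rewrite divr_gt0// mulr_gt0. Qed.

Let bs2_scaled t : 0 < t -> bs2 (fun z : R * R => \1_D (z.1 / t, z.2 / t)).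
Proof.
move=> t0; have d : t^-1 * t^-1 - 0 * 0 != 0 by rewrite mulr0 subr0 mulf_neq0// invr_eq0 gt_eqF.
have := bs2_lin d bD; congr bs2; apply/funext => z.
by rewrite !mul0r addr0 add0r !(mulrC t^-1).
Qed.

Lemma measurable_smooth : measurable_fun setT smooth.
Proof.
apply: measurable_funM; apply: measurableT_comp => //;
  by apply: continuous_measurable_fun; exact: continuous_ker.
Qed.

Let smooth_le z : smooth z <= K0 ^+ 2.
Proof. by rewrite expr2 ler_pM ?ker_ge0 ?ker_le. Qed.

Let bs2_smoothed t : 0 < t -> bs2 (fun z => smooth z * \1_D (z.1 / t, z.2 / t)).
Proof.
move=> t0; apply: (@bs2M _ _ _ (K0 ^+ 2)); first exact: bs2_scaled.
  exact: measurable_smooth.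
by move=> z; rewrite ger0_norm.
Qed.

Lemma int2_scaled t : 0 < t ->
  \int[mu2]_z (\1_D (z.1 / t, z.2 / t)) = t ^+ 2 * \int[mu2]_z \1_D z.
Proof.
move=> t0; have d : t^-1 * t^-1 - 0 * 0 != 0 by rewrite mulr0 subr0 mulf_neq0// invr_eq0 gt_eqF.
have := int2_lin d bD.
rewrite mulr0 subr0 -invfM normfV invrK -expr2 ger0_norm ?sqr_ge0// => <-.
by apply: eq_Rintegral => z _; rewrite !mul0r addr0 add0r !(mulrC t^-1).
Qed.

Let scaled_in t (x : R * R) (v : R * R) : 0 < t -> D (x.1 / t, x.2 / t) ->
  `|v.1| <= eta -> `|v.2| <= eta ->
  D ((x.1 + v.1) / (t + tau), (x.2 + v.2) / (t + tau)).
Proof.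
move=> t0 Dx v1 v2; have tp := taup; have r := r00.
have Dv : D (v.1 / tau, v.2 / tau).
  apply: rD; apply: le_trans (nrm_le_sum _) _ => /=.
  rewrite !normrM normfV (gtr0_norm tp) -mulrDl ler_pdivrMr//.
  have -> : r0 * tau = 2 * eta by rewrite /tau; field; lra.
  lra.
pose l := tau / (t + tau).
have l01 : 0 <= l <= 1.
  by apply/andP; split; [rewrite divr_ge0//; lra|rewrite ler_pdivrMr; lra].
have := cD Dx Dv l01 => /=; congr D; rewrite /l; congr pair; field; apply/and3P; split=> //; lra.
Qed.

(** The windows around the lattice points of [t D] are disjoint because [eta <= 1/4], lie in
    [(t + tau) D], and each has kernel mass [w ^+ 2]. *)
Lemma lattice_upper t : 0 < t -> Ncount D t * w ^+ 2 <= smoothed (t + tau).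
Proof.
move=> t0; have tp := taup.
have -> : Ncount D t * w ^+ 2 = \int[mu2]_z \sum_(m <- pts t) win m z.
  rewrite int2_sum; last exact: bs2_win.
  under eq_bigr do rewrite int_win.
  by rewrite big_const_seq count_predT iter_addr addr0 Ncount_size mulr_natl.
apply: le_int2; [by apply: bs2_sum; exact: bs2_win|by apply: bs2_smoothed; lra|move=> z].
rewrite indicE; case: (boolP (_ \in D)) => h; first by rewrite mulr1 sum_win_le.
rewrite mulr0 big_seq big1// => m; rewrite mem_pts// => /(lattice_ptsP _ t0) Dm.
rewrite winE; case: (boolP (`|z.1 - m.1%:~R| <= eta)) => a1; last by rewrite !mul0r.
case: (boolP (`|z.2 - m.2%:~R| <= eta)) => a2; last by rewrite mulr0 mul0r.
have := scaled_in (x := (m.1%:~R, m.2%:~R)) (v := (z.1 - m.1%:~R, z.2 - m.2%:~R)) t0 Dm a1 a2.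
by rewrite /= !(addrC _ (_ - _)) !subrK => Dz; rewrite mem_set in h.
Qed.

Lemma near_int (u : R) : exists i : int, `|u - i%:~R| <= 2^-1.
Proof.
exists (Num.floor (u + 2^-1)).
have /andP[h1 h2] := Num.Theory.floor_itv (u + 2^-1).
by rewrite rmorphD/= in h2; rewrite ler_norml; apply/andP; split; lra.
Qed.

(** A point of [(t - tau) D] is either within [eta] of a lattice point, which then lies in [t D], or
    one of its two kernel factors is at most [kap] while the other is at most the peak [K0]. *)
Lemma lattice_lower t : tau < t ->
  smoothed (t - tau) <= Ncount D t + kap * K0 * ((t - tau) ^+ 2 * \int[mu2]_z \1_D z).
Proof.
move=> tt; have tp := taup; have t0 : 0 < t by lra.
have u0 : 0 < t - tau by lra.
have b1 := bs2_sum (pts t) xpredT bs2_win.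
have b2 := bs2Z (kap * K0) (bs2_scaled u0).
have K00 : 0 <= K0 by exact: ker_ge0.
apply: (@le_trans _ _ (\int[mu2]_z (\sum_(m <- pts t) win m z + kap * K0 * \1_D (z.1 / (t - tau), z.2 / (t - tau))))).
  apply: le_int2 => [||z]; [exact: bs2_smoothed|exact: bs2D|].
  have s0 : 0 <= \sum_(m <- pts t) win m z.
    by apply: sumr_ge0 => m _; rewrite winE mulr_ge0// mulr_ge0.
  rewrite indicE; case: (boolP (_ \in D)) => h; last by rewrite !mulr0 addr0.
  rewrite !mulr1; move: h; rewrite inE => Dz.
  have [i hi] := near_int z.1; have [j hj] := near_int z.2.
  have ki (x : R) (l : int) : eta < `|x - l%:~R| -> `|x - l%:~R| <= 2^-1 -> ker N x <= kap.
    move=> h1 h2; have := ker_periodic N (x - l%:~R) l; rewrite subrK => ->.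
    by apply: kerkap; rewrite (ltW h1).
  have [ci|ci] := ltP eta `|z.1 - i%:~R|.
    apply: (@le_trans _ _ (kap * K0)); last by rewrite lerDr.
    by rewrite /smooth ler_pM ?ker_ge0 ?ker_le ?(ki _ i).
  have [cj|cj] := ltP eta `|z.2 - j%:~R|.
    apply: (@le_trans _ _ (kap * K0)); last by rewrite lerDr.
    by rewrite mulrC /smooth ler_pM ?ker_ge0 ?ker_le ?(ki _ j).
  apply: (@le_trans _ _ (\sum_(m <- pts t) win m z)); last by rewrite lerDl mulr_ge0.
  have ijp : (i, j) \in pts t.
    rewrite mem_pts// lattice_ptsP//=.
    have := scaled_in (x := z) (v := (i%:~R - z.1, j%:~R - z.2)) u0 Dz.
    by rewrite /= !(addrC _ (_ - _)) !subrK (distrC i%:~R) (distrC j%:~R); exact.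
  rewrite (bigD1_seq (i, j))//= winE /= ci cj !mul1r lerDl.
  by apply: sumr_ge0 => m _; rewrite winE mulr_ge0// mulr_ge0.
rewrite int2D// int2Z; last exact: bs2_scaled.
rewrite int2_scaled// lerD2r int2_sum; last exact: bs2_win.
under eq_bigr do rewrite int_win.
rewrite big_const_seq count_predT iter_addr addr0 -mulr_natl -Ncount_size.
have N0 : 0 <= Ncount D t by rewrite Ncount_size.
have w0 : 0 <= w by have := wk; have := kap1; lra.
by rewrite ler_piMr// expr_le1.
Qed.

Lemma Eerr_upper t : 0 < t -> Eerr D t <=
  smoothed (t + tau) - (t + tau) ^+ 2 * \int[mu2]_z \1_D z +
  (tau * (2 * t + tau) * \int[mu2]_z \1_D z + 2 * kap * (4 * (t * rho + 1) ^+ 2)).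
Proof.
move=> t0; rewrite /Eerr -int2_indic; last exact: measurable_D.
have h1 := lattice_upper t0; have h2 := Ncount_le t0.
have N0 : 0 <= Ncount D t by rewrite Ncount_size.
move: h1 h2 N0; set n := Ncount D t; set A := \int[mu2]_z _; move: (smoothed _) A => S A h1 h2 N0.
(* The mass missing from the windows costs [2 * kap] times the count, which is why the trivial bound
   [Ncount_le] appears in the error. *)
have w2 : 1 - 2 * kap <= w ^+ 2.
  have := wk; have := w1; have := kap0; have := kap1 => k1 k0 ww wwk.
  have : (1 - kap) ^+ 2 <= w ^+ 2 by rewrite lerXn2r ?nnegrE//; lra.
  nra.
have : n * (1 - 2 * kap) <= S by apply: le_trans h1; rewrite ler_wpM2l.
have : 2 * kap * n <= 2 * kap * (4 * (t * rho + 1) ^+ 2).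
  by rewrite ler_wpM2l// mulr_ge0.
move: (4 * _) => Z; nra.
Qed.

Lemma Eerr_lower t : tau < t ->
  smoothed (t - tau) - (t - tau) ^+ 2 * \int[mu2]_z \1_D z -
  (tau * (2 * t) * \int[mu2]_z \1_D z + kap * K0 * (t ^+ 2 * \int[mu2]_z \1_D z)) <= Eerr D t.
Proof.
move=> tt; rewrite /Eerr -int2_indic; last exact: measurable_D.
have h1 := lattice_lower tt; have tp := taup.
have A0 : 0 <= \int[mu2]_z \1_D z by apply: int2_ge0 => z; rewrite indicE.
have K00 : 0 <= K0 by exact: ker_ge0.
move: h1 A0; set A := \int[mu2]_z _; move: (smoothed _) A (Ncount D t) => S A n h1 A0.
have : kap * K0 * ((t - tau) ^+ 2 * A) <= kap * K0 * (t ^+ 2 * A).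
  apply: ler_wpM2l; first exact: mulr_ge0.
  by apply: ler_wpM2r => //; rewrite lerXn2r ?nnegrE//; lra.
move: (kap * K0 * _) (kap * K0 * (t ^+ 2 * A)) h1 => X Y h1 XY.
have : (t - tau) ^+ 2 = t ^+ 2 - tau * (2 * t) + tau ^+ 2 by ring.
have : 0 <= tau ^+ 2 * A by rewrite mulr_ge0// sqr_ge0.
move: h1; nra.
Qed.

End LatticeCompare.

(** * The mean square of the error over a unit interval *)

Section CosineSums.
Context {R : realType}.
Notation mu := (@lebesgue_measure R).
Notation mu2 := (mu \x mu)%E.

Lemma sum_cauchy_schwarz (I : Type) (s : seq I) (P : pred I) (a b : I -> R) :
  (\sum_(i <- s | P i) a i * b i) ^+ 2 <=
  (\sum_(i <- s | P i) a i ^+ 2) * (\sum_(i <- s | P i) b i ^+ 2).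
Proof.
have E (x y : I -> R) : (\sum_(i <- s | P i) x i) * (\sum_(i <- s | P i) y i) =
    \sum_(i <- s | P i) \sum_(j <- s | P j) x i * y j by rewrite big_distrlr.
rewrite expr2 !E -subr_ge0 -sumrB.
have -> : \sum_(i <- s | P i) (\sum_(j <- s | P j) a i ^+ 2 * b j ^+ 2 -
    \sum_(j <- s | P j) a i * b i * (a j * b j)) =
  \sum_(i <- s | P i) \sum_(j <- s | P j) (a i ^+ 2 * b j ^+ 2 - a i * b i * (a j * b j)).
  by apply: eq_bigr => i _; rewrite sumrB.
set S := \sum_(i <- s | P i) _.
(* Lagrange's identity, obtained by symmetrising in [i] and [j]. *)
have S2 : S + S = \sum_(i <- s | P i) \sum_(j <- s | P j) (a i * b j - a j * b i) ^+ 2.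
  rewrite {2}/S exchange_big/= /S -big_split/=; apply: eq_bigr => i _.
  by rewrite -big_split/=; apply: eq_bigr => j _; ring.
have : 0 <= S + S.
  by rewrite S2; apply: sumr_ge0 => i _; apply: sumr_ge0 => j _; exact: sqr_ge0.
lra.
Qed.

Lemma bs1_mul (f g : R -> R) : bs1 f -> bs1 g -> bs1 (fun x => f x * g x).
Proof. by move=> [mf [M fM]] bg; apply: (@bs1M _ _ _ M) => // x; exact: (fM x).1. Qed.

Lemma bs1_sum_cond (I : Type) (s : seq I) (P : pred I) (f : I -> R -> R) :
  (forall i, P i -> bs1 (f i)) -> bs1 (fun x => \sum_(i <- s | P i) f i x).
Proof.
move=> bf.
have -> : (fun x => \sum_(i <- s | P i) f i x) = (fun x => \sum_(i <- s) if P i then f i x else 0).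
  by apply/funext => x; rewrite big_mkcond.
by apply: bs1_sum => i; case: (boolP (P i)) => [/bf//|_]; exact: bs10.
Qed.

Lemma measurable_cosmul (t : R) : measurable_fun setT (fun s : R => cos (2 * pi * t * s)).
Proof.
by apply: (measurableT_comp (continuous_measurable_fun (@continuous_cos R))); apply: measurable_funM.
Qed.

Lemma bs1_cosmul (t : R) (B : R -> R) : bs1 B -> bs1 (fun s => cos (2 * pi * t * s) * B s).
Proof.
move=> bB; apply: (@bs1M _ _ _ 1) => //; first exact: measurable_cosmul.
by move=> x; exact: cos_max.
Qed.

Lemma cosintZ c (B : R -> R) t : bs1 B -> cosint (fun s => c * B s) t = c * cosint B t.
Proof.
move=> bB; rewrite /cosint -int1Z; last exact: bs1_cosmul.
by apply: eq_Rintegral => s _; ring.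
Qed.

Lemma cosintD (A B : R -> R) t : bs1 A -> bs1 B ->
  cosint (fun s => A s + B s) t = cosint A t + cosint B t.
Proof.
move=> bA bB; rewrite /cosint -int1D; [|exact: bs1_cosmul|exact: bs1_cosmul].
by apply: eq_Rintegral => s _; ring.
Qed.

Lemma norm_cosint_le (B : R -> R) t : bs1 B -> `|cosint B t| <= \int[mu]_s `|B s|.
Proof.
move=> bB; apply: le_trans (int1_norm (bs1_cosmul t bB)) _.
apply: le_int1; [by apply: bs1_norm; exact: bs1_cosmul|exact: bs1_norm|move=> s].
by rewrite normrM ler_piMl// cos_max.
Qed.

Lemma cosint_shift (A : R -> R) d t : bs1 A ->
  cosint (fun s => A (s + d)) t = \int[mu]_s (cos (2 * pi * t * (s - d)) * A s).
Proof.
move=> bA; have b : bs1 (fun s => cos (2 * pi * t * (s - d)) * A s).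
  apply: (@bs1M _ _ _ 1) => //; last by move=> x; exact: cos_max.
  apply: (measurableT_comp (continuous_measurable_fun (@continuous_cos R))).
  by apply: measurable_funM => //; exact: measurable_funB.
by rewrite -(int1_shift d b); apply: eq_Rintegral => s _; rewrite addrK.
Qed.

Lemma cosint_sdiff (A : R -> R) h t : bs1 A ->
  cosint (sdiff A h) t = (2 * cos (2 * pi * t * h) - 2) * cosint A t.
Proof.
move=> bA.
have bs d : bs1 (fun s => A (s + d)).
  have := bs1_affine d (oner_neq0 R) bA.
  by under eq_fun do rewrite mul1r.
have bc d : bs1 (fun s => cos (2 * pi * t * (s - d)) * A s).
  apply: (@bs1M _ _ _ 1) => //; last by move=> x; exact: cos_max.
  apply: (measurableT_comp (continuous_measurable_fun (@continuous_cos R))).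
  by apply: measurable_funM => //; exact: measurable_funB.
have -> : cosint (sdiff A h) t = cosint (fun s => A (s + - h)) t + (-2) * cosint A t + cosint (fun s => A (s + h)) t.
  rewrite -cosintZ// -!cosintD//; first by congr cosint; apply/funext => s; rewrite /sdiff; ring.
    by apply: bs1D => //; exact: bs1Z.
  exact: bs1Z.
rewrite !cosint_shift// -[RHS]int1Z; last exact: bs1_cosmul.
have b2 : bs1 (fun s => -2 * (cos (2 * pi * t * s) * A s)) by apply: bs1Z; exact: bs1_cosmul.
rewrite /cosint -int1Z; last exact: bs1_cosmul.
rewrite -!int1D//; last by apply: bs1D.
apply: eq_Rintegral => s _; rewrite opprK mulrDr mulrBr cosD cosB; ring.
Qed.

(** The chord function of [k] ends at [supp D k] on the right but at minus the support function of
    [- k] on the left, and [D] need not be symmetric. Each half-line is therefore treated from its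
    own end; the left half for [k] is the right half for [- k]. *)
Definition pospart (B : R -> R) (s : R) : R := (0 <= s)%R%:R * B s.

Lemma bs1_pospart B : bs1 B -> bs1 (pospart B).
Proof.
move=> bB; apply: (@bs1M _ _ _ 1) => //; last by move=> x; case: (0 <= x); rewrite ?normr1 ?normr0.
have -> : (fun x : R => (0 <= x)%R%:R) = \1_`[(0 : R), +oo[%classic :> (R -> R).
  apply/funext => x; rewrite indicE; have -> // : (x \in `[(0 : R), +oo[%classic) = (0 <= x).
  by apply/idP/idP; rewrite inE/= in_itv/= andbT.
exact: measurable_indic.
Qed.

Lemma cosint_pospart (B : R -> R) t : bs1 B ->
  cosint B t = cosint (pospart B) t + cosint (pospart (fun s => B (- s))) t.
Proof.
move=> bB; have n1 : (-1 : R) != 0 by rewrite oppr_eq0 oner_eq0.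
have bN : bs1 (fun s => B (- s)).
  have := bs1_affine 0 n1 bB.
  by under [X in bs1 X -> _]eq_fun do rewrite mulN1r addr0.
have -> : cosint B t = cosint (pospart B) t + cosint (fun s => B s - pospart B s) t.
  rewrite -cosintD; [|exact: bs1_pospart|by apply: bs1B => //; exact: bs1_pospart].
  by congr cosint; apply/funext => s; ring.
congr (_ + _).
have bD : bs1 (fun s => B s - pospart B s) by apply: bs1B => //; exact: bs1_pospart.
have := int1_affine 0 n1 (bs1_cosmul t bD); rewrite normrN1 invr1 mul1r => E.
rewrite {1}/cosint -E.
(* The point 0 belongs to both halves; [bz] accounts for it and has integral zero. *)
have bz : bs1 (fun s : R => B 0 * \1_`[0, 0]%classic s) by apply: bs1Z; exact: bs1_indic.
have -> : cosint (pospart (fun s => B (- s))) t =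
   \int[mu]_s (cos (2 * pi * t * (-1 * s + 0)) * (B (-1 * s + 0) - pospart B (-1 * s + 0))) +
   \int[mu]_s (B 0 * \1_`[0, 0]%classic s).
  rewrite -int1D; [|exact: (bs1_affine 0 n1 (bs1_cosmul t bD))|exact: bz].
  apply: eq_Rintegral => s _; rewrite mulN1r addr0 mulrN cosN /pospart indicE.
  have -> : (s \in `[(0 : R), 0]%classic) = (s == 0).
    by apply/idP/idP; rewrite inE/= in_itv/= -eq_le eq_sym.
  rewrite oppr_ge0; case: (ltgtP s 0) => [s0|s0|->] /=.
  - by rewrite !mul0r mul1r subrr !mulr0 addr0.
  - by rewrite !mul0r mul1r subr0 !mulr0 addr0.
  - by rewrite !mul1r subrr !mulr0 add0r cos0 mul1r mulr1 oppr0.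
by rewrite int1Z ?int1_indic ?subrr ?mulr0 ?addr0//; exact: bs1_indic.
Qed.

Definition box (N : nat) : seq (int * int) := [seq (x, y) | x <- rng N, y <- rng N].

Lemma mem_box N k : (k \in box N) = (`|k.1| <= N)%N && (`|k.2| <= N)%N.
Proof.
case: k => a b /=; apply/allpairsP/andP => [[[x y] /= [xN yN [-> ->]]]|[h1 h2]].
  by rewrite -!mem_rng.
by exists (a, b); rewrite !mem_rng.
Qed.

Lemma uniq_box N : uniq (box N).
Proof. by apply: allpairs_uniq; rewrite ?uniq_rng// => -[a b] [c d] _ _ /= [-> ->]. Qed.

Definition negk (k : int * int) : int * int := (- k.1, - k.2).

Lemma sum_box_neg N (F : int * int -> R) :
  \sum_(k <- box N | k != 0) F (negk k) = \sum_(k <- box N | k != 0) F k.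
Proof.
have nK : involutive negk by move=> [a b]; rewrite /negk/= !opprK.
rewrite -[RHS]big_filter -[LHS]big_filter -(big_map negk xpredT F).
apply: perm_big; apply: uniq_perm.
- by rewrite map_inj_uniq ?filter_uniq ?uniq_box//; exact: inv_inj.
- by rewrite filter_uniq ?uniq_box.
move=> k; rewrite -[k in LHS]nK (mem_map (inv_inj nK)) !mem_filter !mem_box /negk/=.
rewrite !abszN; congr (~~ _ && _).
by case: k => a b; apply/eqP/eqP => -[]; [move=> /eqP + /eqP; rewrite !oppr_eq0 => /eqP -> /eqP ->|move=> -> ->].
Qed.

Definition cc (N : nat) (k : int * int) : R := coef N k.1 * coef N k.2.

Lemma cc_ge0 N k : 0 <= cc N k. Proof. by rewrite mulr_ge0// coef_ge0. Qed.
Lemma cc_le1 N k : cc N k <= 1. Proof. by rewrite mulr_ile1 ?coef_ge0 ?coef_le1. Qed.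

Lemma ccN N k : k \in box N -> cc N (negk k) = cc N k.
Proof. by rewrite mem_box => /andP[h1 h2]; rewrite /cc /negk/= !coefN. Qed.

Lemma smooth_expand N (z : R * R) :
  smooth N z = \sum_(k <- box N) cc N k * cos (2 * pi * dot (kr k) z).
Proof.
rewrite /smooth big_allpairs/= exchange_big/=.
have := ker_expand N z.2 0; rewrite cos0 mulr1 => ->.
rewrite mulr_sumr; apply: eq_bigr => j _; rewrite mulrCA ker_expand mulr_sumr.
apply: eq_bigr => i _; rewrite /cc /kr /dot/= mulrA (mulrC (coef N j)); congr (_ * cos _); ring.
Qed.

Lemma nrm_kr_ge1 k : k != 0 -> 1 <= nrm (kr k : R * R).
Proof.
move=> k0; have h : k.1 != 0 \/ k.2 != 0.
  by apply/orP; rewrite -negb_and; apply: contra k0; case: k => a b /= /andP[/eqP -> /eqP ->].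
have one (i : int) : i != 0 -> 1 <= `|i%:~R : R|.
  move=> i0; rewrite -intr_norm -[1]/(1%:~R) ler_int.
  by move: i0; lia.
have [h1 h2] := norm_le_nrm (kr k : R * R).
by case: h => /one h; [apply: le_trans h1|apply: le_trans h2].
Qed.

Lemma kr_neq0 k : k != 0 -> (kr k : R * R) != (0, 0).
Proof. by move=> /nrm_kr_ge1; apply: contraTneq => ->; rewrite /nrm /dot/= !mul0r addr0 sqrtr0 ler10. Qed.

Lemma krN k : (kr (negk k) : R * R) = (- (kr k).1, - (kr k).2).
Proof. by rewrite /kr /negk/= !mulrNz. Qed.

(** [nrm k] is at least the larger coordinate [i], and at most [3 |i|] values of the other
    coordinate go with it; what is left is the sum of [coef N i], the peak of the kernel. So the sum
    has order [sqrt N], as if the frequencies were cut off at [sqrt N] instead of [N]. *)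
Lemma sum_cc_inv N : \sum_(k <- box N | k != 0) cc N k / nrm (kr k : R * R) <= 6 * ker N (0 : R).
Proof.
have cg := @coef_ge0 R N.
pose g (i j : int) : R := ((`|j| <= `|i|)%N && (i != 0))%:R * (coef N i * coef N j / `|i%:~R|).
have g0 i j : 0 <= g i j by rewrite mulr_ge0// divr_ge0// mulr_ge0.
have row i : \sum_(j <- rng N) g i j <= 3 * coef N i.
  rewrite /g; have [->|i0] := eqVneq i 0.
    by rewrite big1 ?mulr_ge0// => j _; rewrite andbF mul0r.
  have ip : 0 < `|i%:~R : R| by rewrite normr_gt0 intr_eq0.
  apply: (@le_trans _ _ (\sum_(j <- rng N | (`|j| <= `|i|)%N) coef N i / `|i%:~R|)).
    rewrite [leRHS]big_mkcond; apply: ler_sum => j _; case: ifP => _; last by rewrite mul0r.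
    by rewrite mul1r ler_pM2r ?invr_gt0// ler_piMr// coef_le1.
  rewrite -big_filter big_const_seq count_predT iter_addr addr0 -[X in X <= _]mulr_natr.
  have sz : (size [seq j <- rng N | (`|j| <= `|i|)%N] <= `|i|.*2.+1)%N.
    have -> : `|i|.*2.+1 = size (rng `|i|) by rewrite size_map size_iota.
    by apply: uniq_leq_size; [rewrite filter_uniq ?uniq_rng|move=> j; rewrite mem_filter !mem_rng => /andP[]].
  rewrite mulrAC ler_pdivrMr// (_ : 3 * coef N i * `|i%:~R| = coef N i * (3 * `|i%:~R|)) ?ler_wpM2l//; last by ring.
  have : (size [seq j <- rng N | (`|j| <= `|i|)%N])%:R <= `|i|.*2.+1%:R :> R by rewrite ler_nat.
  have -> : `|i|.*2.+1%:R = 2 * `|i%:~R| + 1 :> R.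
    by rewrite -natr1 -mul2n natrM -intr_norm -pmulrn.
  have : 1 <= `|i%:~R : R| by rewrite -intr_norm -[1]/(1%:~R) ler_int; move: i0; lia.
  lra.
apply: (@le_trans _ _ (\sum_(k <- box N) (g k.1 k.2 + g k.2 k.1))).
  rewrite big_mkcond; apply: ler_sum => k _; case: ifP => k0; last by rewrite addr_ge0.
  have [h1 h2] := norm_le_nrm (kr k : R * R); have n1 := nrm_kr_ge1 k0.
  have main (i j : int) (i0 : i != 0) : (`|j| <= `|i|)%N -> (`|i%:~R| : R) <= nrm (kr k) -> coef N i * coef N j = cc N k ->
      cc N k / nrm (kr k) <= g i j.
    move=> ji hi E; rewrite /g ji i0 mul1r E ler_wpM2l ?cc_ge0// lef_pV2 ?posrE ?normr_gt0 ?intr_eq0//.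
    exact: lt_le_trans ltr01 n1.
  have [ji|ij] := leqP `|k.2| `|k.1|.
    have i0 : k.1 != 0.
      apply: contra k0 => /eqP k1; move: ji; rewrite k1 => h.
      by case: k k1 h {h1 h2 n1 main} => a b /= -> h; apply/eqP; congr pair; lia.
    by apply: le_trans (main _ _ i0 ji h1 erefl) _; rewrite lerDl.
  have j0 : k.2 != 0 by apply: contraTneq ij => ->; lia.
  by apply: le_trans (main _ _ j0 (ltnW ij) h2 _) _; rewrite /cc ?lerDr//; ring.
rewrite big_split/= big_allpairs/= [X in _ + X]big_allpairs/= [X in _ + X]exchange_big/=.
rewrite ker_coef0 mulr_sumr -big_split/=; apply: ler_sum => i _; have := row i; lra.
Qed.

End CosineSums.

(** * The mean square of the smoothed error *)

Section MeanSquare.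
Context {R : realType}.
Notation mu := (@lebesgue_measure R).
Notation mu2 := (mu \x mu)%E.
Variables (D : set (R * R)) (r0 rho : R) (f : int * int -> R).
Hypothesis oD : open D.
Hypothesis cD : convex_set2 D.
Hypothesis r00 : 0 < r0.
Hypothesis r01 : r0 <= 1.
Hypothesis rho1 : 1 <= rho.
Hypothesis rD : forall z, nrm z <= r0 -> D z.
Hypothesis Drho : forall z, D z -> nrm z <= rho.
Hypothesis f0 : forall k, 0 <= f k.
Hypothesis Df : forall k, k != 0 -> forall y y', D y -> D y' ->
  dot (kr k) y = dot (kr k) y' -> dot (y.1 - y'.1, y.2 - y'.2) (y.1 - y'.1, y.2 - y'.2) <=
  f k * (supp D (kr k) - dot (kr k) y) / nrm (kr k).

Let A (k : int * int) := chord D (kr k).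
Let a (k : int * int) : R := supp D (kr k).
Let nk (k : int * int) : R := nrm (kr k).
Let V (k : int * int) : R := Num.sqrt (f k / nk k) / nk k.
Let bD : bs2 (\1_D) := bs2_D oD Drho.

Lemma smoothed_cosint N t : 0 < t ->
  smoothed D N t - t ^+ 2 * \int[mu2]_z \1_D z =
  t ^+ 2 * \sum_(k <- box N | k != 0) cc N k * cosint (A k) t.
Proof.
move=> t0; pose F z := smooth N (t * z.1, t * z.2) * \1_D z.
have bc k : bs2 (fun z => cos (2 * pi * (t * dot (kr k) z)) * \1_D z).
  apply: (@bs2M _ _ _ 1) => //.
  apply: (measurableT_comp (continuous_measurable_fun (@continuous_cos R))).
  apply: measurable_funM => //; apply: measurable_funM => //; exact: measurable_lin2.
  by move=> z; exact: cos_max.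
have EF z : F z = \sum_(k <- box N) cc N k * (cos (2 * pi * (t * dot (kr k) z)) * \1_D z).
  rewrite /F smooth_expand mulr_suml; apply: eq_bigr => k _; rewrite -mulrA; congr (_ * (cos _ * _)).
  by rewrite /dot/=; ring.
have bF : bs2 F.
  by rewrite (funext EF); apply: bs2_sum => k; exact: bs2Z.
have -> : smoothed D N t = t ^+ 2 * \int[mu2]_z F z.
  have d : t^-1 * t^-1 - 0 * 0 != 0 by rewrite mulr0 subr0 mulf_neq0// invr_eq0 gt_eqF.
  have := int2_lin d bF.
  rewrite mulr0 subr0 -invfM normfV invrK -expr2 ger0_norm ?sqr_ge0// => <-.
  apply: eq_Rintegral => z _; rewrite /F/= !mul0r addr0 add0r.
  have tn : t != 0 by rewrite gt_eqF.
  rewrite !(mulrC t^-1); congr (smooth _ _ * _); rewrite [LHS]surjective_pairing.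
  by congr pair; field.
rewrite -mulrBr; congr (_ * _).
under eq_Rintegral do rewrite EF.
rewrite int2_sum; last by move=> k; exact: bs2Z.
have in0 : (0 : int * int) \in box N by rewrite mem_box.
rewrite (bigD1_seq 0) ?uniq_box//=.
have -> : \int[mu2]_z (cc N 0 * (cos (2 * pi * (t * dot (kr 0) z)) * \1_D z)) = \int[mu2]_z \1_D z :> R.
  apply: eq_Rintegral => z _; rewrite /cc !coef0 /dot/= !mul0r addr0 !mulr0 cos0; ring.
rewrite addrAC subrr add0r; apply: eq_bigr => k k0.
rewrite int2Z//; congr (_ * _).
have := int2_chord oD Drho (kr_neq0 k0) (measurable_cosmul t) (fun x => cos_max _); rewrite /cosint -/(A k) => <-.
by apply: eq_Rintegral => z _; rewrite mulrA.
Qed.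


Lemma sum_cosint_sdiff N h t :
  \sum_(k <- box N | k != 0) cc N k * cosint (sdiff (A k) h) t =
  2 * \sum_(k <- box N | k != 0) cc N k * cosint (pospart (sdiff (A k) h)) t.
Proof.
have bA k : k != 0 -> bs1 (A k) by move=> k0; exact: (bs1_chord oD Drho (kr_neq0 k0)).
pose F k := cc N k * cosint (pospart (sdiff (A k) h)) t.
rewrite mulr2n mulrDl !mul1r -{2}(sum_box_neg N F) -big_split/= big_seq_cond [RHS]big_seq_cond.
apply: eq_bigr => k /andP[kN k0]; rewrite /F ccN// -mulrDr; congr (_ * _).
rewrite cosint_pospart; last exact: (bs1_sdiff h (bA _ k0)).
have E u : A (negk k) u = A k (- u).
  by rewrite /A krN chordN//; exact: (bs1_chord_section oD Drho (kr_neq0 k0)).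
have -> // : (fun s => sdiff (A k) h (- s)) = sdiff (A (negk k)) h.
by apply/funext => s; rewrite /sdiff !E !opprD opprK; ring.
Qed.

Variables (n : nat).
Hypothesis n4 : (4 <= n)%N.
Hypothesis rn : 4 <= r0 * n%:R.

(** With this step the factor [2 cos (2 pi t h) - 2] equals [-4] at [t = n] and is at most [-2] for
    [t] in [[n / 2, 3 n / 2]]. The condition [4 <= r0 * n] is [h <= r0 / 8]. *)
Let h : R := (2 * n%:R)^-1.
Let mid k s := \1_`[0, a k - r0 / 2[%classic s * sdiff (A k) h s.
Let top k s := \1_`[a k - r0 / 2, a k + 1[%classic s * sdiff (A k) h s.

Let n4R : 4 <= n%:R :> R. Proof. by rewrite ler_nat. Qed.
Let h0 : 0 < h. Proof. by rewrite invr_gt0; have := n4R; lra. Qed.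
Let hn : h * (2 * n%:R) = 1. Proof. by rewrite mulVf// gt_eqF//; have := n4R; lra. Qed.
Let h8 : h <= r0 / 8.
Proof.
rewrite /h -[_^-1]mul1r ler_pdivrMr; have := n4R; last lra.
by have := rn; lra.
Qed.

Let V0 k : 0 <= V k. Proof. by rewrite divr_ge0 ?sqrtr_ge0 ?nrm_ge0. Qed.

Lemma chord_le_sqrt k s : k != 0 -> - (r0 * nk k) <= s -> s < a k -> A k s <= V k * Num.sqrt (a k - s).
Proof.
move=> k0 s1 s2; have kn := kr_neq0 k0 : (kr k : R * R) != (0, 0).
have n0 := nrm_gt0 kn.
rewrite /V mulrAC -sqrtrM ?divr_ge0// ?nrm_ge0//.
apply: (chord_le oD cD r00 rD Drho kn) => //.
  by rewrite mulr_ge0 ?divr_ge0 ?nrm_ge0//; lra.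
move=> y y' Dy Dy' ys ys'; have := Df k0 Dy Dy'; rewrite ys ys' => /(_ erefl).
by rewrite mulrAC.
Qed.

Let bsS k : k != 0 -> bs1 (sdiff (A k) h).
Proof. by move=> k0; exact: (bs1_sdiff h (bs1_chord oD Drho (kr_neq0 k0))). Qed.

Lemma top_int k : k != 0 -> \int[mu]_s `|top k s| <= (1 / r0 + 8) * (V k * (h * Num.sqrt h)).
Proof.
move=> k0; have kn := kr_neq0 k0 : (kr k : R * R) != (0, 0).
apply: (@top_bound _ (A k) (a k) (nk k) r0 rho h (V k)) => //.
- exact: (bs1_chord oD Drho kn).
- move=> s; exact: chord_ge0.
- move=> s; exact: (chord_eq0 oD Drho kn).
- exact: nrm_kr_ge1.
- exact: (supp_ger r00 rD Drho).
- exact: (supp_ler r00 rD Drho).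
- exact: (chord_concave oD cD r00 rD Drho kn).
- by move=> s; exact: chord_le_sqrt.
Qed.

Lemma mid_int k : k != 0 -> \int[mu]_s `|mid k s| <= ((4 + rho) / r0) * (V k * h ^+ 2).
Proof.
move=> k0; have kn := kr_neq0 k0 : (kr k : R * R) != (0, 0).
apply: (@mid_bound _ (A k) (a k) (nk k) r0 rho h (V k)) => //.
- exact: (bs1_chord oD Drho kn).
- move=> s; exact: chord_ge0.
- exact: nrm_kr_ge1.
- exact: (supp_ger r00 rD Drho).
- exact: (supp_ler r00 rD Drho).
- exact: (chord_concave oD cD r00 rD Drho kn).
- by move=> s; exact: chord_le_sqrt.
Qed.

Lemma pospart_split k s : k != 0 -> pospart (sdiff (A k) h) s = mid k s + top k s.
Proof.
move=> k0; have kn := kr_neq0 k0 : (kr k : R * R) != (0, 0).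
have k1 := @nrm_kr_ge1 R _ k0; have ra : r0 * nk k <= a k := supp_ger r00 rD Drho _.
have c0 : 0 <= a k - r0 / 2 by move: k1 ra; rewrite -/(nk k); have := r00; nra.
rewrite /pospart /mid /top !indic_co_diff//; last by have := r00; lra.
rewrite -mulrDl; have [sa|sa] := leP (a k + 1) s; last by congr (_ * _); rewrite subr0; ring.
have h1 : h <= 1 by have := h8; have := r01; lra.
rewrite (_ : sdiff _ _ _ = 0) ?mulr0// /sdiff.
have z u : a k <= u -> A k u = 0 by exact: (chord_eq0 oD Drho kn).
have hp := h0; rewrite !z; lra.
Qed.

Let N := (n ^ 2)%N.
Let r := [seq k <- box N | k != 0].
Let X t := \sum_(k <- r) cc N k * cosint (A k) t.
(** The value 0 at [k = 0] makes [Bt k] integrable for every index, as [sqr_cosint_sum] demands; the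
    list [r] omits this index. *)
Let Bt (k : int * int) : R -> R := if k == 0 then fun=> 0 else fun s => cc N k * top k s.
Let T t := \sum_(k <- r) cosint (Bt k) t.
Let M t := \sum_(k <- r) cc N k * cosint (mid k) t.
Let F := \sum_(k <- r) f k / nk k ^+ 2.
Let K1 := (4 + rho) / r0.
Let C0 := 2 * (2 / r0) ^+ 2 * (1 + 4 * rho) ^+ 2.
Let c1 : R := 576 * 32.

Let rP k : k \in r -> k != 0. Proof. by rewrite mem_filter => /andP[]. Qed.

Let bs_mid k : k != 0 -> bs1 (mid k). Proof. by move=> k0; apply: bs1_itv; exact: bsS. Qed.
Let bs_top k : k != 0 -> bs1 (top k). Proof. by move=> k0; apply: bs1_itv; exact: bsS. Qed.

Let bs_Bt k : bs1 (Bt k).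
Proof. by rewrite /Bt; case: eqP => [_|/eqP k0]; [exact: bs10|apply: bs1Z; exact: bs_top]. Qed.

Lemma osc_identity t : (2 * cos (2 * pi * t * h) - 2) * X t = 2 * (T t + M t).
Proof.
have -> : (2 * cos (2 * pi * t * h) - 2) * X t = \sum_(k <- box N | k != 0) cc N k * cosint (sdiff (A k) h) t.
  rewrite /X big_filter mulr_sumr; apply: eq_bigr => k k0.
  by rewrite cosint_sdiff; [ring|exact: (bs1_chord oD Drho (kr_neq0 k0))].
rewrite sum_cosint_sdiff -big_filter -/r /T /M -big_split/=; congr (_ * _).
rewrite big_seq [RHS]big_seq; apply: eq_bigr => k /rP k0.
rewrite /Bt (negbTE k0) cosintZ; last exact: bs_top.
rewrite -mulrDr addrC -cosintD; [|exact: bs_mid|exact: bs_top].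
by congr (_ * cosint _ _); apply/funext => s; exact: pospart_split.
Qed.

Let Mb := K1 * h ^+ 2 * \sum_(k <- r) cc N k * V k.

Lemma mid_le t : `|M t| <= Mb.
Proof.
apply: le_trans (ler_norm_sum _ _ _) _; rewrite /Mb mulr_sumr big_seq [leRHS]big_seq.
apply: ler_sum => k /rP k0; rewrite normrM ger0_norm ?cc_ge0// mulrCA ler_wpM2l ?cc_ge0//.
apply: le_trans (norm_cosint_le _ (bs_mid k0)) _; apply: le_trans (mid_int k0) _.
by rewrite -/K1 le_eqVlt; apply/orP; left; apply/eqP; ring.
Qed.

(** Cauchy-Schwarz with [cc V] split as [(cc / |k|)^(1/2)] times [(cc f / |k|^2)^(1/2)]. The first
    sum of squares is [sum_cc_inv], at most [6 * 2n]; the second is at most [F], as [cc <= 1]. *)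
Lemma sqr_Mb : Mb ^+ 2 <= 12 * K1 ^+ 2 * h ^+ 4 * n%:R * F.
Proof.
have VE k : V k = (Num.sqrt (nk k))^-1 * (Num.sqrt (f k) / nk k).
  by rewrite /V sqrtrM// sqrtrV ?nrm_ge0//; ring.
rewrite /Mb; have -> : \sum_(k <- r) cc N k * V k = \sum_(k <- r)
    (Num.sqrt (cc N k) / Num.sqrt (nk k)) * (Num.sqrt (cc N k) * (Num.sqrt (f k) / nk k)).
  apply: eq_bigr => k _; rewrite VE -{1}(sqr_sqrtr (cc_ge0 N k)); ring.
rewrite exprMn.
have h1 := sum_cauchy_schwarz r xpredT (fun k => Num.sqrt (cc N k) / Num.sqrt (nk k))
  (fun k => Num.sqrt (cc N k) * (Num.sqrt (f k) / nk k)).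
apply: le_trans (_ : _ <= (K1 * h ^+ 2) ^+ 2 * ((12 * n%:R) * F)) _; last first.
  by rewrite le_eqVlt; apply/orP; left; apply/eqP; ring.
apply: ler_wpM2l; first exact: sqr_ge0.
apply: le_trans h1 _; apply: ler_pM; try by apply: sumr_ge0 => k _; exact: sqr_ge0.
  have -> : \sum_(k <- r) (Num.sqrt (cc N k) / Num.sqrt (nk k)) ^+ 2 = \sum_(k <- box N | k != 0) cc N k / nrm (kr k : R * R).
    rewrite /r big_filter; apply: eq_bigr => k _.
    by rewrite expr_div_n !sqr_sqrtr ?cc_ge0 ?nrm_ge0.
  apply: le_trans (sum_cc_inv N) _.
  have N0 : (0 < N)%N by rewrite /N expn_gt0; move: n4; case: (n).
  have := @ker0_le R _ N0; rewrite /N natrX => k2.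
  have : ker (n ^ 2) (0 : R) <= 2 * n%:R.
    rewrite -ler_sqr ?nnegrE ?ker_ge0//; first by rewrite (_ : (2 * n%:R) ^+ 2 = 4 * n%:R ^+ 2 :> R)//; ring.
  lra.
apply: ler_sum => k _; rewrite exprMn expr_div_n (sqr_sqrtr (cc_ge0 N k)) (sqr_sqrtr (f0 k)).
by rewrite ler_piMl ?cc_le1// divr_ge0 ?sqr_ge0.
Qed.

Let cos_le0 t : n%:R / 2 <= t <= 3 * n%:R / 2 -> cos (2 * pi * t * h) <= 0.
Proof.
move=> /andP[t1 t2]; have p0 := @pi_gt0 R.
have -> : 2 * pi * t * h = (2 * pi * t * h - pi) + pi by ring.
rewrite cosDpi oppr_le0; apply: cos_ge0_pihalf.
have th1 : 4^-1 <= t * h.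
  have := ler_wpM2r (ltW h0) t1; have := hn; lra.
have th2 : t * h <= 3 / 4.
  have := ler_wpM2r (ltW h0) t2; have := hn; lra.
have := ler_wpM2l (ltW p0) th1; have := ler_wpM2l (ltW p0) th2; lra.
Qed.

Lemma sqr_X_le t : n%:R / 2 <= t <= 3 * n%:R / 2 -> X t ^+ 2 <= 2 * T t ^+ 2 + 2 * Mb ^+ 2.
Proof.
move=> /cos_le0; have := osc_identity t; have := mid_le t.
set u := cos _; move: (X t) (T t) (M t) => x y m mb E u0.
have m2 : m ^+ 2 <= Mb ^+ 2 by rewrite -[m ^+ 2]real_normK ?num_real// lerXn2r ?nnegrE// (le_trans _ mb).
have E2 : (1 - u) ^+ 2 * x ^+ 2 = (y + m) ^+ 2 by rewrite -exprMn (_ : y + m = - ((1 - u) * x)) ?sqrrN//; lra.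
have : x ^+ 2 <= (1 - u) ^+ 2 * x ^+ 2.
  by rewrite ler_peMl ?sqr_ge0// exprn_ege1//; lra.
have : (y + m) ^+ 2 + (y - m) ^+ 2 = 2 * y ^+ 2 + 2 * m ^+ 2 by ring.
have := sqr_ge0 (y - m); lra.
Qed.

(** Schur's test loses the factor [(j k).+1], at most [2 * rho * |k|], while the squared masses
    [be k ^+ 2] carry [f k / |k|^3]; together they give the terms [f k / |k|^2] of [F]. *)
Lemma top_square_int p sg :
  \int[mu]_t (bump p t * T (t + sg) ^+ 2) <= c1 * C0 * ((1 / r0 + 8) ^+ 2 * (2 * rho)) * h ^+ 3 * F.
Proof.
have K20 : 0 <= 1 / r0 + 8 by rewrite addr_ge0// divr_ge0// ltW.
have r1 := rho1.
have a0 k : 0 <= a k by apply: le_trans (supp_ger r00 rD Drho _); rewrite mulr_ge0 ?nrm_ge0// ltW.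
pose be k := (1 / r0 + 8) * (V k * (h * Num.sqrt h)).
have be0 k : 0 <= be k by rewrite mulr_ge0// mulr_ge0// mulr_ge0 ?sqrtr_ge0// ltW.
have Bbe k : \int[mu]_s `|Bt k s| <= be k.
  rewrite /Bt; case: eqP => [_|/eqP k0].
    by under eq_Rintegral do rewrite normr0; rewrite int10.
  apply: le_trans (top_int k0); apply: le_int1.
  - by apply: bs1_norm; apply: bs1Z; exact: bs_top.
  - by apply: bs1_norm; exact: bs_top.
  by move=> s; rewrite normrM ler_piMl// ger0_norm ?cc_ge0 ?cc_le1.
have Bsupp k s : Bt k s != 0 -> `|s - a k| <= 1.
  rewrite /Bt; have [_|_] := eqVneq k 0; first by rewrite eqxx.
  rewrite /top indic_coE; case: (boolP (_ <= _ < _)); last by rewrite mul0r mulr0 eqxx.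
  by move=> /andP[s1 s2] _; rewrite ler_norml; have := r01; have := r00; lra.
have := sqr_cosint_sum r p sg bs_Bt a0 Bsupp Bbe; move=> /le_trans; apply.
have C00 : 0 <= C0 by rewrite /C0; apply: mulr_ge0; [apply: mulr_ge0|]; rewrite ?sqr_ge0.
pose j k := Num.truncn (a k).
have jx k : (j k)%:R <= a k < (j k)%:R + 1 by rewrite natr1 truncn_itv.
have cnt m : (size [seq k <- r | j k == m])%:R <= C0 * m.+1%:R.
  apply: (bin_count r00 rD Drho); first by rewrite !filter_uniq ?uniq_box.
  by move=> k; rewrite mem_filter => /andP[/eqP <- _]; exact: jx.
apply: le_trans (schur_bins C00 be0 jx cnt) _.
rewrite (_ : c1 * C0 * _ * _ * _ = c1 * C0 * ((1 / r0 + 8) ^+ 2 * (2 * rho) * h ^+ 3 * F)); last by ring.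
have c10 : 0 <= c1 * C0 := mulr_ge0 (mulr_ge0 (ler0n _ _) (ler0n _ _)) C00.
apply: (ler_wpM2l c10).
rewrite /F mulr_sumr big_seq [leRHS]big_seq; apply: ler_sum => k /rP k0.
have n1 : 1 <= nk k := nrm_kr_ge1 k0.
have j1 : (j k).+1%:R <= 2 * rho * nk k.
  have /andP[jk _] := jx k; have := supp_ler r00 rD Drho (kr k); rewrite -/(a k) -/(nk k) -natr1.
  have : 1 <= rho * nk k by rewrite mulr_ege1.
  lra.
have -> : be k ^+ 2 = (1 / r0 + 8) ^+ 2 * h ^+ 3 * (f k / nk k ^+ 3).
  rewrite /be /V !exprMn !sqr_sqrtr ?divr_ge0 ?nrm_ge0//; last exact: ltW.
  move: (f k) (nk k) n1 (h) (1 / r0 + 8) => u v v1 hh c.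
  by field; rewrite gt_eqF//; lra.
apply: le_trans (ler_wpM2l _ j1) _.
  rewrite mulr_ge0 ?divr_ge0 ?exprn_ge0 ?nrm_ge0//; first by rewrite mulr_ge0 ?sqr_ge0 ?exprn_ge0// ltW.
rewrite le_eqVlt; apply/orP; left; apply/eqP; move: (f k) (nk k) n1 (h) (1 / r0 + 8) => u v v1 hh c.
by field; rewrite gt_eqF//; lra.
Qed.

(** The prefactor is [32 n^4]: 16 from [(t + sg)^4 <= (2n)^4] and 2 from [sqr_X_le]. With
    [h = 1 / (2n)], [32 n^4 h^3 = 4 n] and [32 n^4 * 12 h^4 n = 24 n]. *)
Definition Kms : R := 4 * (c1 * C0 * ((1 / r0 + 8) ^+ 2 * (2 * rho))) + 24 * K1 ^+ 2.

Lemma Kms_ge0 : 0 <= Kms.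
Proof.
have c10 : 0 <= c1 := mulr_ge0 (ler0n _ _) (ler0n _ _).
have C00 : 0 <= C0 := mulr_ge0 (mulr_ge0 (ler0n _ _) (sqr_ge0 _)) (sqr_ge0 _).
apply: addr_ge0; last exact: mulr_ge0 (ler0n _ _) (sqr_ge0 _).
apply: mulr_ge0 (ler0n _ _) _; apply: (mulr_ge0 (mulr_ge0 c10 C00)).
by apply: mulr_ge0 (sqr_ge0 _) _; have := rho1; lra.
Qed.

Lemma mean_square_smoothed sg : `|sg| <= 1 ->
  bs1 (fun t => \1_`[n%:R, n%:R + 1]%classic t *
     (smoothed D N (t + sg) - (t + sg) ^+ 2 * \int[mu2]_z \1_D z) ^+ 2) /\
  \int[mu]_t (\1_`[n%:R, n%:R + 1]%classic t *
     (smoothed D N (t + sg) - (t + sg) ^+ 2 * \int[mu2]_z \1_D z) ^+ 2) <= Kms * n%:R * F.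
Proof.
rewrite ler_norml => /andP[s1 s2]; have nn := n4R.
(* The window starts at [n - 1/2] so that its middle part, where [bump >= 1], is exactly
   [[n, n + 1]]. *)
pose p : R := n%:R - 2^-1; pose I (t : R) : R := \1_(`[n%:R, n%:R + 1]%classic : set R) t.
pose E t : R := smoothed D N (t + sg) - (t + sg) ^+ 2 * \int[mu2]_z \1_D z.
have IE t : I t = (n%:R <= t <= n%:R + 1)%R%:R.
  by rewrite /I indicE; congr (_%:R); congr nat_of_bool; apply/idP/idP; rewrite inE/= in_itv.
have bI : bs1 I by exact: bs1_indic.
have EE t : I t * E t = (I t * (t + sg) ^+ 2) * \sum_(k <- r) cc N k * (I t * cosint (A k) (t + sg)).
  rewrite IE; case: (boolP (_ <= _ <= _)) => [/andP[t1 t2]|_]; last by rewrite !mul0r.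
  rewrite /E smoothed_cosint; last by lra.
  by rewrite !mul1r -big_filter; congr (_ * _); apply: eq_bigr => k _; rewrite mul1r.
have bE : bs1 (fun t => I t * E t).
  rewrite (funext EE); apply: bs1_mul.
    apply: (@bs1_itv_mul _ _ _ (fun x => (x + sg) ^+ 2)).
    have cs : continuous (fun x : R => x + sg) by move=> x; apply: cvgD; [exact: cvg_id|exact: cvg_cst].
    rewrite (_ : (fun x => _) = fun x => (x + sg) * (x + sg)); last by apply/funext => x; rewrite expr2.
    by move=> x; apply: cvgM; exact: cs.
  under eq_fun do rewrite big_seq; apply: bs1_sum_cond => k /rP k0; apply: bs1Z.
  by apply: bs1_mul_cosint => //; exact: (bs1_chord oD Drho (kr_neq0 k0)).
have IEE t : I t * E t ^+ 2 = I t * E t * (I t * E t).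
  by rewrite IE; case: (_ <= _ <= _); rewrite ?mul0r// !mul1r expr2.
have bT (v : R -> R) : bs1 v -> bs1 (fun t => v t * T (t + sg)).
  move=> bv; under eq_fun do rewrite /T mulr_sumr.
  by apply: bs1_sum => k; apply: bs1_mul_cosint.
have bbT : bs1 (fun t => bump p t * T (t + sg) ^+ 2).
  have := bs1_mul (bT _ (bs1_bump p)) (bT _ (bs1_indic p (p + 2) true false)).
  congr bs1; apply/funext => t; rewrite /bump expr2.
  rewrite !indicE; case: (_ \in _) => /=; ring.
have bEE : bs1 (fun t => I t * E t ^+ 2) by rewrite (funext IEE); exact: bs1_mul.
split; first exact: bEE.
pose G t := 32 * n%:R ^+ 4 * (bump p t * T (t + sg) ^+ 2) + 32 * n%:R ^+ 4 * Mb ^+ 2 * I t.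
have bG : bs1 G by apply: bs1D; apply: bs1Z.
apply: (@le_trans _ _ (\int[mu]_t G t)).
  apply: le_int1 => // t.
  rewrite -/(I t) -/(E t) /G; have b0 := bump_ge0 p t.
  have pos : 0 <= 32 * n%:R ^+ 4 :> R by rewrite mulr_ge0 ?exprn_ge0.
  rewrite IE; case: (boolP (_ <= _ <= _)) => [/andP[t1 t2]|_]; last first.
    by rewrite mul0r mulr0 addr0 mulr_ge0// mulr_ge0// sqr_ge0.
  rewrite mul1r mulr1 /E smoothed_cosint; last by lra.
  rewrite -big_filter -/r -/(X (t + sg)) exprMn.
  have X2 : X (t + sg) ^+ 2 <= 2 * T (t + sg) ^+ 2 + 2 * Mb ^+ 2 by apply: sqr_X_le; lra.
  have b1 : 1 <= bump p t by apply: bump_ge; rewrite /p; lra.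
  have t4 : ((t + sg) ^+ 2) ^+ 2 <= 16 * n%:R ^+ 4.
    rewrite (_ : 16 * n%:R ^+ 4 = ((2 * n%:R) ^+ 2) ^+ 2 :> R); last by ring.
    by rewrite lerXn2r ?nnegrE ?sqr_ge0// lerXn2r ?nnegrE//; lra.
  apply: le_trans (ler_pM _ _ t4 X2) _; rewrite ?sqr_ge0//.
  have : T (t + sg) ^+ 2 <= bump p t * T (t + sg) ^+ 2 by rewrite ler_peMl ?sqr_ge0.
  move=> /(ler_wpM2l pos); set y := T _ ^+ 2; set m := Mb ^+ 2; lra.
rewrite int1D; [|exact: bs1Z|exact: bs1Z].
rewrite int1Z// int1Z// int1_indic; last by lra.
have := ler_wpM2l (_ : 0 <= 32 * n%:R ^+ 4) (top_square_int p sg).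
rewrite mulr_ge0 ?exprn_ge0// => /(_ isT).
have := ler_wpM2l (_ : 0 <= 32 * n%:R ^+ 4) sqr_Mb.
rewrite mulr_ge0 ?exprn_ge0// => /(_ isT).
set c2 := c1 * _ * _; set J := \int[mu]_t _; set m2 := Mb ^+ 2.
have n0 : (n%:R : R) != 0 by rewrite gt_eqF//; lra.
have -> : 32 * n%:R ^+ 4 * (12 * K1 ^+ 2 * h ^+ 4 * n%:R * F) = 24 * K1 ^+ 2 * n%:R * F.
  by rewrite /h; field.
have -> : 32 * n%:R ^+ 4 * (c2 * h ^+ 3 * F) = 4 * c2 * n%:R * F.
  by rewrite /h; field.
rewrite /Kms -/c2; lra.
Qed.

End MeanSquare.

(** * From the smoothed count back to the lattice point error *)

Section UnitInterval.
Context {R : realType}.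
Notation mu := (@lebesgue_measure R).
Notation mu2 := (mu \x mu)%E.

(** The left side is at most [exp (- n / 16) = exp (- x)^4] with [x = n / 64], and [exp x >= x]. The
    fourth power is chosen so that [n^(-3)] remains after multiplication by the peak [2n]. *)
Lemma exp_decay (n : nat) : (0 < n)%N ->
  (1 - (4 * Num.sqrt (n%:R : R))^-1 ^+ 2) ^+ (n ^ 2) <= (64 / n%:R) ^+ 4.
Proof.
move=> n0; have np : 0 < n%:R :> R by rewrite ltr0n.
pose x : R := n%:R / 64.
have x0 : 0 < x by rewrite divr_gt0.
have -> : (4 * Num.sqrt (n%:R : R))^-1 ^+ 2 = (16 * n%:R)^-1.
  by rewrite exprVn exprMn sqr_sqrtr ?ler0n//; congr (_^-1); ring.
have n1 : 1 <= n%:R :> R by rewrite ler1n.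
have i1 : (16 * n%:R)^-1 <= 1 :> R by rewrite invf_le1; lra.
apply: (@le_trans _ _ (expR (- (16 * n%:R)^-1) ^+ (n ^ 2))).
  by rewrite lerXn2r ?nnegrE ?expR_ge0 ?expR_ge1Dx//; lra.
rewrite -expRM_natl.
have -> : (n ^ 2)%:R * - (16 * n%:R)^-1 = 4%:R * (- x) :> R.
  by rewrite natrX /x; field; rewrite gt_eqF.
rewrite expRM_natl lerXn2r ?nnegrE ?expR_ge0 ?divr_ge0 ?ler0n//.
rewrite expRN -[64 / _]invrK lef_pV2 ?posrE ?expR_gt0 ?invr_gt0 ?divr_gt0//.
rewrite invf_div -/x; have := @expR_ge1Dx R x; lra.
Qed.

(** The upper and lower comparison values are taken at different points, [t + tau] and [t - tau];
    according to the sign of [E], one of them controls its square. *)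
Lemma sqr_two_sided (E a b q : R) : E <= a + q -> b - q <= E ->
  E ^+ 2 <= 2 * a ^+ 2 + 2 * b ^+ 2 + 4 * q ^+ 2.
Proof.
move=> h1 h2; have [E0|E0] := leP 0 E.
  have : E ^+ 2 <= (a + q) ^+ 2 by rewrite lerXn2r ?nnegrE//; lra.
  have := sqr_ge0 (a - q); have := sqr_ge0 b; have := sqr_ge0 q; nra.
have : (- E) ^+ 2 <= (q - b) ^+ 2 by rewrite lerXn2r ?nnegrE//; lra.
rewrite sqrrN; have := sqr_ge0 (b + q); have := sqr_ge0 a; have := sqr_ge0 q; nra.
Qed.

(** Here [s] stands for [sqrt n], [y] for [64 / n], [K] for the peak of the kernel and [A] for the
    area. The layer [tau * t] is of order [sqrt n]. The tail [128 y^3] meets [t^2] in the first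
    estimate and [K t^2], of order [n^3], in the second, so it leaves [O(1)]. *)
Lemma error_terms (r0 rho s tau y K A t : R) : 0 < r0 -> 1 <= rho -> 2 <= s -> 0 < tau ->
  tau <= 1 -> tau * (2 * (r0 * s)) = 1 -> 0 < y <= 8^-1 -> y * s ^+ 2 = 64 ->
  0 <= K <= 2 * s ^+ 2 -> 0 <= A <= 4 * rho ^+ 2 -> s ^+ 2 <= t <= s ^+ 2 + 1 ->
  tau * (2 * t + tau) * A + 2 * (128 * y ^+ 3) * (4 * (t * rho + 1) ^+ 2) <=
    (6 / r0 * rho ^+ 2 + 4 * 128 ^+ 4 * rho ^+ 2) * s /\
  tau * (2 * t) * A + 128 * y ^+ 3 * K * (t ^+ 2 * A) <=
    (6 / r0 * rho ^+ 2 + 4 * 128 ^+ 4 * rho ^+ 2) * s.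
Proof.
move=> r00 rho1 s1 tau0 tau1 taus /andP[y0 y8] ys /andP[k0 K2] /andP[A0 A4] /andP[t1 t2].
have rn0 : 2 * r0 != 0 by rewrite gt_eqF// mulr_gt0.
have st : s * tau = (2 * r0)^-1 by apply: (mulIf rn0); rewrite mulVf//; lra.
have T1 : tau * (3 * s ^+ 2) * (4 * rho ^+ 2) = 6 / r0 * rho ^+ 2 * s.
  rewrite (_ : _ * _ = 12 * rho ^+ 2 * s * (s * tau)); last by ring.
  by rewrite st; field; rewrite gt_eqF.
have B1 x : 0 <= x -> x <= 3 * s ^+ 2 -> tau * x * A <= 6 / r0 * rho ^+ 2 * s.
  move=> x0 x3; rewrite -T1; apply: ler_pM => //; first by rewrite mulr_ge0// ltW.
  by rewrite ler_pM2l.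
have s21 : 4 <= s ^+ 2 by nra.
set c8 := 4 * 128 ^+ 4.
have c80 : 0 <= c8 * rho ^+ 2.
  exact: mulr_ge0 (mulr_ge0 (ler0n _ _) (exprn_ge0 _ (ler0n _ _))) (sqr_ge0 _).
have c8s : c8 * rho ^+ 2 <= c8 * rho ^+ 2 * s by rewrite ler_peMr//; lra.
have Q : (t * rho + 1) ^+ 2 <= (3 * s ^+ 2 * rho) ^+ 2.
  have q1 : t * rho <= 2 * s ^+ 2 * rho by rewrite ler_pM2r; lra.
  have q2 : 1 <= s ^+ 2 * rho by rewrite mulr_ege1//; lra.
  have q3 : 0 <= t * rho by rewrite mulr_ge0; lra.
  by rewrite lerXn2r ?nnegrE//; lra.
rewrite (mulrDl _ _ s); split.
  apply: lerD; first by apply: B1; lra.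
  apply: le_trans c8s.
  apply: (@le_trans _ _ (2 * (128 * y ^+ 3) * (4 * (3 * s ^+ 2 * rho) ^+ 2))).
    apply: ler_wpM2l; last by rewrite ler_pM2l.
    exact: mulr_ge0 (ler0n _ _) (mulr_ge0 (ler0n _ _) (exprn_ge0 _ (ltW y0))).
  rewrite (_ : _ * _ = 9216 * y * (y * s ^+ 2) ^+ 2 * rho ^+ 2); last by ring.
  by apply: ler_wpM2r; [exact: sqr_ge0|rewrite ys /c8; lra].
apply: lerD; first by apply: B1; lra.
apply: le_trans c8s.
apply: (@le_trans _ _ (128 * y ^+ 3 * (2 * s ^+ 2) * ((2 * s ^+ 2) ^+ 2 * (4 * rho ^+ 2)))).
  have y3 : 0 <= 128 * y ^+ 3 by exact: mulr_ge0 (ler0n _ _) (exprn_ge0 _ (ltW y0)).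
  apply: ler_pM.
  - exact: mulr_ge0.
  - by rewrite mulr_ge0 ?sqr_ge0.
  - exact: ler_wpM2l.
  - by apply: ler_pM => //; [exact: sqr_ge0|rewrite lerXn2r ?nnegrE//; lra].
rewrite (_ : _ * _ = 4096 * (y * s ^+ 2) ^+ 3 * rho ^+ 2); last by ring.
by apply: ler_wpM2r; [exact: sqr_ge0|rewrite ys /c8; lra].
Qed.

Lemma scale_parameters (r0 x : R) (s := Num.sqrt x) (eta := (4 * s)^-1) (tau := 2 * eta / r0)
    (y := 64 / x) : 0 < r0 <= 1 -> 512 + 4 / r0 ^+ 2 <= x ->
  [/\ 2 <= r0 * s, 2 <= s, 0 < eta <= 4^-1, 0 < tau <= 4^-1 & tau * (2 * (r0 * s)) = 1] /\
  [/\ 0 < y <= 8^-1, y * x = 64, 128 * y ^+ 3 <= 1 & 4 <= r0 * x].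
Proof.
move=> /andP[r00 r01] large; have q0 : 0 <= 4 / r0 ^+ 2 by rewrite divr_ge0 ?sqr_ge0.
have x0 : 0 < x by lra.
have s2 : s ^+ 2 = x by rewrite sqr_sqrtr// ltW.
have s0 : 0 <= s by exact: sqrtr_ge0.
have rs : 2 <= r0 * s.
  rewrite -ler_sqr ?nnegrE ?mulr_ge0//; last exact: ltW.
  rewrite exprMn s2 mulrC (_ : 2 ^+ 2 = 4 :> R); last by ring.
  by rewrite -ler_pdivrMr ?exprn_gt0//; lra.
have s1 : 2 <= s by apply: le_trans rs _; rewrite ler_piMl.
have eta0 : 0 < eta by rewrite invr_gt0; lra.
have eta4 : eta <= 4^-1 by rewrite lef_pV2 ?posrE//; lra.
have taus : tau * (2 * (r0 * s)) = 1.
  by rewrite /tau /eta; field; rewrite !gt_eqF//; lra.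
have tau0 : 0 < tau by rewrite divr_gt0 ?mulr_gt0.
have yx : y * x = 64 by rewrite /y divfK// gt_eqF.
have y0 : 0 < y by rewrite divr_gt0.
have y8 : y <= 8^-1 by rewrite /y ler_pdivrMr//; lra.
split; split => //; [by rewrite eta0| |by rewrite y0| |].
- rewrite tau0/=; clear - rs taus tau0; nra.
- have : y ^+ 3 <= 8^-1 ^+ 3 by rewrite lerXn2r ?nnegrE//; lra.
  by rewrite exprVn; lra.
- by rewrite -s2; clear - rs s1; nra.
Qed.

Lemma ker0_sqr_le (n : nat) : (0 < n)%N -> ker (n ^ 2) (0 : R) <= 2 * n%:R.
Proof.
move=> np; have N0 : (0 < n ^ 2)%N by rewrite expn_gt0 np.
have := @ker0_le R _ N0; rewrite natrX => k2.
by rewrite -ler_sqr ?nnegrE ?ker_ge0 ?mulr_ge0// (_ : (2 * n%:R) ^+ 2 = 4 * n%:R ^+ 2 :> R)//; ring.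
Qed.

Lemma ker_outside_window (n : nat) (x : R) : (16 <= n)%N ->
  (4 * Num.sqrt n%:R)^-1 <= `|x| <= 2^-1 -> ker (n ^ 2) x <= 128 * (64 / n%:R) ^+ 3.
Proof.
move=> n16; have np : (0 < n)%N by exact: leq_trans n16.
have n0 : 0 < n%:R :> R by rewrite ltr0n.
have s1 : 1 <= Num.sqrt n%:R :> R by rewrite -[leLHS]sqrtr1 ler_wsqrtr// ler1n.
have e0 : 0 < (4 * Num.sqrt n%:R)^-1 :> R by rewrite invr_gt0; lra.
have e4 : (4 * Num.sqrt n%:R)^-1 <= 4^-1 :> R by rewrite lef_pV2 ?posrE//; lra.
have e04 : 0 < (4 * Num.sqrt (n%:R : R))^-1 <= 4^-1 by rewrite e0.
have kerN := ker0_sqr_le np.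
move=> h; apply: le_trans (ker_far _ e04 h) _.
have -> : 128 * (64 / n%:R) ^+ 3 = 2 * n%:R * (64 / n%:R) ^+ 4 :> R.
  by field; rewrite gt_eqF.
have e1 : (4 * Num.sqrt n%:R)^-1 ^+ 2 <= 1 :> R.
  by rewrite exprn_ile1 ?(ltW e0)// (le_trans e4)// invf_le1 ?ltr0n ?ler1n.
apply: (ler_pM (ker_ge0 _ _) _ kerN); first by rewrite exprn_ge0// subr_ge0.
exact: exp_decay.
Qed.

Lemma trivial_error_le (m rho t : R) : 1 <= m -> 1 <= rho -> 1 <= t <= 2 * m ->
  4 * (t * rho + 1) ^+ 2 + t ^+ 2 * (4 * rho ^+ 2) <= 52 * m ^+ 2 * rho ^+ 2.
Proof.
move=> m1 r1 /andP[t1 t2].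
have h1 : (t * rho + 1) ^+ 2 <= (3 * m * rho) ^+ 2.
  have : t * rho <= 2 * m * rho by rewrite ler_pM2r//; lra.
  have : 1 <= m * rho by rewrite mulr_ege1.
  have : 0 <= t * rho by rewrite mulr_ge0//; lra.
  by move=> ? ? ?; rewrite lerXn2r ?nnegrE//; lra.
have h2 : t ^+ 2 * (4 * rho ^+ 2) <= (2 * m) ^+ 2 * (4 * rho ^+ 2).
  apply: ler_wpM2r; first by rewrite mulr_ge0 ?sqr_ge0.
  by rewrite lerXn2r ?nnegrE//; lra.
rewrite (_ : 52 * m ^+ 2 * rho ^+ 2 = 4 * (3 * m * rho) ^+ 2 + (2 * m) ^+ 2 * (4 * rho ^+ 2)); last by ring.
by apply: lerD => //; rewrite ler_pM2l.
Qed.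

Variables (r0 rho : R).
Hypothesis r00 : 0 < r0.
Hypothesis r01 : r0 <= 1.
Hypothesis rho1 : 1 <= rho.

(** Beyond this threshold, [4 / r0^2] gives [r0 * sqrt n >= 2], hence [tau <= 1/4], and 512 gives
    [64 / n <= 1/8], hence [kap <= 1/4]. Below it the trivial bound of the error is a constant. *)
Let n0 : R := 512 + 4 / r0 ^+ 2.
Let c8 : R := 4 * 128 ^+ 4.
Let c3 : R := 6 / r0 * rho ^+ 2 + c8 * rho ^+ 2.

Definition Kerr : R := 4 * Kms r0 rho + 4 * c3 ^+ 2 + (52 * n0 ^+ 2 * rho ^+ 2) ^+ 2.

Lemma Kerr_ge0 : 0 <= Kerr.
Proof.
exact: addr_ge0 (addr_ge0 (mulr_ge0 (ler0n _ _) (Kms_ge0 r0 rho1))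
  (mulr_ge0 (ler0n _ _) (sqr_ge0 _))) (sqr_ge0 _).
Qed.

Variables (D : set (R * R)) (f : int * int -> R).
Hypothesis oD : open D.
Hypothesis cD : convex_set2 D.
Hypothesis rD : forall z, nrm z <= r0 -> D z.
Hypothesis Drho : forall z, D z -> nrm z <= rho.
Hypothesis f1 : forall k, 1 <= f k.
Hypothesis Df : forall k, k != 0 -> forall y y', D y -> D y' ->
  dot (kr k) y = dot (kr k) y' -> dot (y.1 - y'.1, y.2 - y'.2) (y.1 - y'.1, y.2 - y'.2) <=
  f k * (supp D (kr k) - dot (kr k) y) / nrm (kr k).

Let area_ge0 : 0 <= \int[mu2]_z \1_D z :> R.
Proof. by apply: int2_ge0 => z; rewrite indicE. Qed.

Lemma area_le : \int[mu2]_z \1_D z <= 4 * rho ^+ 2.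
Proof.
have r1 := rho1; pose I := `[- rho, rho]%classic.
have b1 : bs1 (\1_I : R -> R) by exact: bs1_indic.
have bG := bs2_prod b1 b1.
have -> : 4 * rho ^+ 2 = \int[mu2]_z (\1_I z.1 * \1_I z.2).
  by rewrite (int2_prod b1 b1) !int1_indic; [ring|lra].
apply: le_int2 => // [|z]; first exact: bs2_D oD Drho.
have [Dz|nDz] := pselect (D z); last by rewrite indicE memNset// mulr_ge0// indicE.
have [h1 h2] := norm_le_nrm z; have h3 := Drho Dz.
have E v : `|v| <= rho -> v \in I by rewrite ler_norml => h; rewrite mem_set// /I/= in_itv.
by rewrite !indicE mem_set// !E ?mulr1// (le_trans _ h3).
Qed.

(** Put to 0 for [t <= 0], the count becomes monotone on the whole line, and this is the source of
    its measurability in [t]. *)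
Let Np (t : R) : R := if 0 < t then Ncount D t else 0.

Lemma Ncount_mono : nondecreasing_fun Np.
Proof.
move=> s t st; rewrite /Np; case: ifP => s0; last first.
  by case: ifP => // _; rewrite Ncount_size.
have t0 : 0 < t by exact: lt_le_trans st.
rewrite t0 !Ncount_size ler_nat; apply: uniq_leq_size; first exact: fset_uniq.
move=> p; rewrite !in_fset_set ?inE; [|exact: (finite_lattice_pts r00 Drho t0)|exact: (finite_lattice_pts r00 Drho s0)].
move=> /(lattice_ptsP _ _ s0) h; apply/(lattice_ptsP _ _ t0).
have [sn tn] : s != 0 /\ t != 0 by rewrite !gt_eqF.
have l01 : 0 <= s / t <= 1 by rewrite divr_ge0 ?(ltW s0) ?(ltW t0)//= ler_pdivrMr ?mul1r.
have := cD (D00 r00 rD) h l01; rewrite /= !mulr0 !add0r.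
have E x : s / t * (x / s) = x / t by field; rewrite sn tn.
by rewrite !E.
Qed.

Lemma bs1_Eerr (n : nat) : (0 < n)%N ->
  bs1 (fun t => \1_`[n%:R, n%:R + 1]%classic t * Eerr D t).
Proof.
move=> np; have n1 : 1 <= n%:R :> R by rewrite ler1n.
pose I : R -> R := \1_(`[n%:R, n%:R + 1]%classic : set R).
have bI : bs1 I by exact: bs1_indic.
have -> : (fun t => \1_`[n%:R, n%:R + 1]%classic t * Eerr D t) =
  (fun t => Num.min (Np t) (Np (n%:R + 1)) * I t - fine (area D) * (I t * t ^+ 2)).
  apply/funext => t; rewrite -/(I t) /I indicE.
  case: (boolP (t \in _)) => [|_]; last by rewrite !mul0r !mulr0 subrr.
  rewrite inE/= in_itv/= => /andP[t1 t2].
  rewrite min_l; last exact: Ncount_mono.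
  by rewrite /Np /Eerr ifT; [rewrite !mul1r mulr1; ring|lra].
apply: bs1B; last by apply: bs1Z; apply: bs1_itv_mul; exact: exprn_continuous.
apply: (@bs1M _ _ _ (Np (n%:R + 1))) => // [|x].
  apply: measurable_minr; last exact: measurable_cst.
  by apply: nondecreasing_measurable => //; exact: Ncount_mono.
have Np0 y : 0 <= Np y by rewrite /Np; case: ifP => // _; rewrite Ncount_size.
by rewrite ger0_norm ?ge_min ?lexx ?orbT// le_min !Np0.
Qed.

Lemma measurable_Eerr (a b : R) : 0 < a -> measurable_fun `[a, b]%classic (Eerr D).
Proof.
move=> a0; apply: (@eq_measurable_fun _ _ _ _ _ (fun t => Np t - t ^+ 2 * fine (area D))).
  by move=> t; rewrite inE/= in_itv/= => /andP[ta _]; rewrite /Np (lt_le_trans a0 ta).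
apply: measurable_funTS; apply: measurable_funB.
  by apply: nondecreasing_measurable => //; exact: Ncount_mono.
by apply: measurable_funM => //; exact: exprn_measurable.
Qed.

Let F n := \sum_(k <- box (n ^ 2) | k != 0) f k / nrm (kr k : R * R) ^+ 2.

(** The single vector [(1, 0)] suffices, since [f k >= 1]. This lets the comparison error, of mean
    square [O(n)], be absorbed into [n * F n]. *)
Lemma weights_ge1 n : (0 < n)%N -> 1 <= F n.
Proof.
move=> np; have kin : (1, 0) \in box (n ^ 2) by rewrite mem_box/= andbT expn_gt0 np.
have t0 k : 0 <= f k / nrm (kr k : R * R) ^+ 2.
  by rewrite divr_ge0 ?sqr_ge0// (le_trans _ (f1 k)).
rewrite /F -big_filter (bigD1_seq ((1, 0) : int * int)) ?filter_uniq ?uniq_box ?mem_filter ?kin//=.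
apply: ler_wpDr; first by apply: sumr_ge0.
by rewrite sqr_nrm /dot/= !mulr1 !mulr0 addr0 divr1.
Qed.

Let Eerr_triv t : 1 <= t -> `|Eerr D t| <= 4 * (t * rho + 1) ^+ 2 + t ^+ 2 * (4 * rho ^+ 2).
Proof.
move=> t1; have t0 : 0 < t by lra.
rewrite /Eerr -int2_indic; last exact: (measurable_D oD).
have := Ncount_le r00 rD Drho t0; have N0 : 0 <= Ncount D t by rewrite Ncount_size.
have : t ^+ 2 * \int[mu2]_z \1_D z <= t ^+ 2 * (4 * rho ^+ 2) by rewrite ler_wpM2l ?sqr_ge0 ?area_le.
have : 0 <= t ^+ 2 * \int[mu2]_z \1_D z by rewrite mulr_ge0 ?sqr_ge0.
rewrite ler_norml; move: (t ^+ 2 * \int[mu2]_z _) (t ^+ 2 * (4 * _)) (4 * (_ * _ + 1) ^+ 2) => a b c; lra.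
Qed.

Lemma mean_square_Eerr (n : nat) : (0 < n)%N ->
  \int[mu]_t (\1_`[n%:R, n%:R + 1]%classic t * Eerr D t ^+ 2) <= Kerr * n%:R * F n.
Proof.
move=> np; have n1 : 1 <= n%:R :> R by rewrite ler1n.
have Fn := weights_ge1 np; have r1 := rho1; have r := r00; have r' := r01.
have nF : 1 <= n%:R * F n by rewrite mulr_ege1.
pose I : R -> R := \1_(`[n%:R, n%:R + 1]%classic : set R).
have IE t : I t = (n%:R <= t <= n%:R + 1)%R%:R.
  by rewrite /I indicE; congr (_%:R); congr nat_of_bool; apply/idP/idP; rewrite inE/= in_itv.
have bI : bs1 I by exact: bs1_indic.
have bE : bs1 (fun t => I t * Eerr D t ^+ 2).
  have := bs1_mul (bs1_Eerr np) (bs1_Eerr np).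
  congr bs1; apply/funext => t; rewrite -/(I t) IE.
  by case: (_ <= _ <= _); rewrite ?mul0r// !mul1r expr2.
have iI : \int[mu]_t I t = 1 by rewrite int1_indic; lra.
have [small|large] := ltP n%:R n0.
  pose c := (52 * n0 ^+ 2 * rho ^+ 2) ^+ 2.
  apply: (@le_trans _ _ c); last first.
    have K0 := Kms_ge0 r0 rho1; have c0 : 0 <= c by exact: sqr_ge0.
    rewrite -mulrA; apply: le_trans (_ : _ <= Kerr * 1) _; last by rewrite ler_wpM2l ?Kerr_ge0.
    by rewrite mulr1 /Kerr -/c; have := sqr_ge0 c3; lra.
  have bc : bs1 (fun t => c * I t) by exact: bs1Z.
  have -> : c = \int[mu]_t (c * I t) by rewrite int1Z// iI mulr1.
  apply: le_int1 => // t.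
  rewrite -/(I t) IE; case: (boolP (_ <= _ <= _)) => [/andP[t1 t2]|_]; last by rewrite mul0r mulr0.
  rewrite mul1r mulr1 -real_normK ?num_real// /c lerXn2r ?nnegrE//.
    by rewrite mulr_ge0 ?sqr_ge0// mulr_ge0 ?sqr_ge0.
  apply: le_trans (Eerr_triv _) _; first exact: le_trans t1.
  have q0 : 0 <= 4 / r0 ^+ 2 by rewrite divr_ge0 ?sqr_ge0.
  have n01 : 1 <= n0 by rewrite /n0 ler_wpDr// ler1n.
  apply: trivial_error_le => //; rewrite (le_trans n1 t1)/=; apply: le_trans t2 _.
  by rewrite mulr_natl mulr2n lerD// ltW.
pose s := Num.sqrt (n%:R : R); have s2 : s ^+ 2 = n%:R by rewrite sqr_sqrtr.
pose eta := (4 * s)^-1; pose tau := 2 * eta / r0.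
pose y : R := 64 / n%:R; pose kap := 128 * y ^+ 3.
have r0_01 : 0 < r0 <= 1 by rewrite r.
have [[rs s1 eta04 tau04 taus] [y08 yn kap1 rn]] := scale_parameters r0_01 large.
have [eta0 eta4] := andP eta04; have [tau0 tau4] := andP tau04; have [y0 y8] := andP y08.
have kap0 : 0 <= kap by rewrite mulr_ge0// exprn_ge0// ltW.
have n512 : (512 <= n)%N.
  by rewrite -(ler_nat R); apply: le_trans large; rewrite /n0 lerDl divr_ge0 ?sqr_ge0.
have kerkap x : eta <= `|x| <= 2^-1 -> ker (n ^ 2) x <= kap.
  by apply: ker_outside_window; exact: leq_trans n512.
have kerN := ker0_sqr_le np.
have tau1 : `|tau| <= 1 by rewrite gtr0_norm// (le_trans tau4)// invf_le1 ?ltr0n ?ler1n.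
have tauN1 : `|- tau| <= 1 by rewrite normrN.
pose S t := smoothed D (n ^ 2) t - t ^+ 2 * \int[mu2]_z \1_D z.
have n4 : (4 <= n)%N by exact: leq_trans n512.
have ms sg : `|sg| <= 1 -> bs1 (fun t => I t * S (t + sg) ^+ 2) /\
    \int[mu]_t (I t * S (t + sg) ^+ 2) <= Kms r0 rho * n%:R * F n.
  move=> h; have f0 k : 0 <= f k by exact: le_trans ler01 (f1 k).
  have := mean_square_smoothed oD cD r00 r01 rho1 rD Drho f0 Df n4 rn h.
  by rewrite big_filter.
have [bS1 ms1] := ms _ tau1; have [bS2 ms2] := ms _ tauN1.
pose A := \int[mu2]_z \1_D z : R.
have A0 : 0 <= A by exact: area_ge0.
have A4 : A <= 4 * rho ^+ 2 by exact: area_le.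
have er t : n%:R <= t <= n%:R + 1 ->
   tau * (2 * t + tau) * A + 2 * kap * (4 * (t * rho + 1) ^+ 2) <= c3 * s /\
   tau * (2 * t) * A + kap * ker (n ^ 2) 0 * (t ^+ 2 * A) <= c3 * s.
  move=> /andP[t1 t2]; apply: error_terms => //.
  - exact: le_trans (ler_norm _) tau1.
  - by rewrite s2.
  - by rewrite s2 ker_ge0.
  - by rewrite A0.
  - by rewrite s2 t1.
pose G t := 2 * (I t * S (t + tau) ^+ 2) + 2 * (I t * S (t - tau) ^+ 2) + 4 * c3 ^+ 2 * n%:R * I t.
have bG : bs1 G by apply: bs1D; [apply: bs1D; exact: bs1Z|exact: bs1Z].
apply: (@le_trans _ _ (\int[mu]_t G t)).
  apply: le_int1 => // t; rewrite -/(I t) /G IE.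
  case: (boolP (_ <= _ <= _)) => [tn|_]; last by rewrite !mul0r !mulr0 !addr0.
  have [e1 e2] := er _ tn; have /andP[t1 t2] := tn.
  have up := @Eerr_upper _ _ _ _ oD cD r00 rD Drho _ _ _ eta0 eta4 kap0 kap1 kerkap t.
  have lo := @Eerr_lower _ _ _ _ oD cD r00 rD Drho _ _ _ eta0 eta4 kap0 kap1 kerkap t.
  have tp : 0 < t := lt_le_trans (lt_le_trans ltr01 n1) t1.
  have tt : tau < t.
    by apply: le_lt_trans tau4 (lt_le_trans _ (le_trans n1 t1)); rewrite invf_lt1 ?ltr1n.
  move: (up tp) (lo tt); rewrite -/tau -/(S (t + tau)) -/(S (t - tau)) -/A !mul1r mulr1 => h1 h2.
  have -> : 4 * c3 ^+ 2 * n%:R = 4 * (c3 * s) ^+ 2 by rewrite exprMn s2 [RHS]mulrA.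
  apply: sqr_two_sided.
    by apply: le_trans h1 _; rewrite lerD2l.
  by apply: le_trans _ h2; rewrite lerD2l lerN2.
rewrite int1D; [|by apply: bs1D; apply: bs1Z|exact: bs1Z].
rewrite int1D; [|exact: bs1Z|exact: bs1Z].
rewrite !int1Z ?iI//.
move: ms1 ms2.
have : c3 ^+ 2 * n%:R <= c3 ^+ 2 * n%:R * F n by rewrite ler_peMr// mulr_ge0 ?sqr_ge0.
have : 0 <= (52 * n0 ^+ 2 * rho ^+ 2) ^+ 2 * (n%:R * F n).
  by apply: mulr_ge0; [exact: sqr_ge0|exact: le_trans ler01 nF].
rewrite /Kerr; move: ((52 * _ * _) ^+ 2) (c3 ^+ 2) (Kms _ _) (\int[mu]_t _) (\int[mu]_t _) (n%:R) (F n).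
by move=> c c' k a b u v; lra.
Qed.

End UnitInterval.

(** * Flatness of the boundary *)

Section Directions.
Context {R : realType}.
Notation mu := (@lebesgue_measure R).
Variables (D : set (R * R)) (r0 rho : R).
Hypothesis r00 : 0 < r0.
Hypothesis rho1 : 1 <= rho.
Hypothesis rD : forall z, nrm z <= r0 -> D z.
Hypothesis Drho : forall z, D z -> nrm z <= rho.

Lemma nrmB (y z : R * R) : nrm (y.1 - z.1, y.2 - z.2) <= nrm y + nrm z.
Proof.
rewrite -ler_sqr ?nnegrE ?nrm_ge0 ?addr_ge0 ?nrm_ge0// sqrrD !sqr_nrm.
have := cauchy_schwarz (- y.1, - y.2) z.
have -> : nrm (- y.1, - y.2) = nrm y by rewrite /nrm /dot/= !mulrNN.
by rewrite /dot/= -[_ *+ 2]mulr_natr; lra.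
Qed.

Definition udir (x : R) : R * R := (cos x, sin x).
Definition hgt (x : R) : R := supp D (udir x).

Lemma nrm_udir x : nrm (udir x) = 1.
Proof. by rewrite /nrm /dot/= -!expr2 cos2Dsin2 sqrtr1. Qed.

Lemma dot_le_hgt x z : D z -> dot (udir x) z <= hgt x.
Proof. exact: (dot_le_supp Drho). Qed.

Lemma hgt_le x : hgt x <= rho.
Proof. by have := supp_ler r00 rD Drho (udir x); rewrite nrm_udir mulr1. Qed.

Lemma hgt_ge0 x : 0 <= hgt x.
Proof. by have := supp_ger r00 rD Drho (udir x); rewrite nrm_udir mulr1; apply: le_trans; exact: ltW. Qed.

Lemma sin_itv01 (r : R) : 0 < r <= 1 -> r / 2 <= sin r <= r.
Proof.
move=> /andP[r0' r1]; have h : 0 <= r <= 1 by rewrite ltW.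
rewrite sin_ge_half//=; apply: le_trans (ler_norm _) _.
by apply: le_trans (norm_sin_le _) _; rewrite gtr0_norm.
Qed.

Lemma cos_itv01 (r : R) : 0 < r <= 1 -> 2^-1 <= cos r <= 1.
Proof.
move=> /andP[r0' r1]; rewrite cos_le1 andbT; have := cos_ge_sqr r; nra.
Qed.

(** The circular form of convexity: [sin (r + s)] times [udir x] is the combination of
    [udir (x + r)] and [udir (x - s)] with the positive coefficients [sin s] and [sin r], and the
    support function is sublinear. *)
Lemma hgt_three_terms x r s : 0 < r <= 1 -> 0 < s <= 1 ->
  sin (r + s) * hgt x <= sin s * hgt (x + r) + sin r * hgt (x - s).
Proof.
move=> rr ss; have /andP[sr1 sr2] := sin_itv01 rr; have /andP[ss1 ss2] := sin_itv01 ss.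
have /andP[cr1 _] := cos_itv01 rr; have /andP[cs1 _] := cos_itv01 ss.
move: rr ss => /andP[rp r1] /andP[sp s1].
have sp0 : 0 < sin (r + s) by rewrite sinD; nra.
rewrite mulrC -ler_pdivlMr//; apply: (supp_le r00 rD) => z Dz; rewrite ler_pdivlMr//.
have -> : dot (udir x) z * sin (r + s) = sin s * dot (udir (x + r)) z + sin r * dot (udir (x - s)) z.
  rewrite /dot/= !sinD !cosD !sinN !cosN.
  have E := cos2Dsin2 x; ring.
by apply: lerD; rewrite ler_pM2l ?dot_le_hgt//; lra.
Qed.

Let slopes x := [set (hgt (x + r) - cos r * hgt x) / sin r | r in [set r : R | 0 < r <= 1]].

(* The right derivative of [hgt], as an infimum of slopes. *)
Definition dhgt x : R := inf (slopes x).

Let slope_lb x s : 0 < s <= 1 -> lbound (slopes x) ((cos s * hgt x - hgt (x - s)) / sin s).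
Proof.
move=> ss _ [r rr <-]; have := hgt_three_terms x rr ss; rewrite sinD.
have /andP[sr1 sr2] := sin_itv01 rr; have /andP[ss1 ss2] := sin_itv01 ss.
move: rr ss => /andP[rp r1] /andP[sp s1].
rewrite ler_pdivrMr; last by lra.
rewrite mulrAC ler_pdivlMr; last by lra.
lra.
Qed.

Let one01 : 0 < (1 : R) <= 1. Proof. by rewrite ltr01 lexx. Qed.

(** Together with [dhgt_left]: near [x], [hgt] lies above the sinusoid that has the same value and
    the slope [dhgt x] there, the analogue of a supporting line. *)
Lemma dhgt_right x r : 0 < r <= 1 -> cos r * hgt x + sin r * dhgt x <= hgt (x + r).
Proof.
move=> rr; have /andP[sr1 sr2] := sin_itv01 rr; have /andP[rp r1] := rr.
have : dhgt x <= (hgt (x + r) - cos r * hgt x) / sin r.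
  by apply: ge_inf; [exists ((cos 1 * hgt x - hgt (x - 1)) / sin 1); exact: slope_lb|exists r].
rewrite ler_pdivlMr; lra.
Qed.

Lemma dhgt_left x s : 0 < s <= 1 -> cos s * hgt x - sin s * dhgt x <= hgt (x - s).
Proof.
move=> ss; have /andP[ss1 ss2] := sin_itv01 ss; have /andP[sp s1] := ss.
have : (cos s * hgt x - hgt (x - s)) / sin s <= dhgt x.
  apply: lb_le_inf; last exact: slope_lb.
  by exists ((hgt (x + 1) - cos 1 * hgt x) / sin 1); exists 1.
rewrite ler_pdivrMr; lra.
Qed.

Lemma dhgt_bound x : `|dhgt x| <= 4 * rho.
Proof.
have h1 := dhgt_right x one01; have h2 := dhgt_left x one01.
have /andP[s1 s2] := sin_itv01 one01; have /andP[c1 c2] := cos_itv01 one01.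
have H0 := hgt_ge0 x; have := hgt_le (x + 1); have := hgt_le (x - 1).
have : 0 <= cos 1 * hgt x by rewrite mulr_ge0//; lra.
have r1 := rho1.
rewrite ler_norml; move: (cos 1 * hgt x) h1 h2 => u h1 h2 u0 h3 h4.
by apply/andP; split; nra.
Qed.

(* [hgt] is not convex, but [hgt'' + hgt >= 0] and [hgt] is bounded, so that
   adding a linear term to [dhgt] makes it monotone. *)
Definition ghgt x := dhgt x + 4 * rho * x.

Let ghgt_local x r : 0 < r <= 1 -> ghgt x <= ghgt (x + r).
Proof.
move=> rr; have h1 := dhgt_right x rr; have := dhgt_left (x + r) rr; rewrite addrK => h2.
have /andP[s1 s2] := sin_itv01 rr; have /andP[c1 c2] := cos_itv01 rr; have c3 := cos_ge_sqr r.
have H0 := hgt_le x; have H1 := hgt_le (x + r); have h0 := hgt_ge0 x; have h0' := hgt_ge0 (x + r).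
rewrite /ghgt; move: rr (hgt x) (hgt (x + r)) (dhgt x) (dhgt (x + r)) h1 h2 H0 H1 h0 h0'.
move=> /andP[rp r1] a b p q h1 h2 H0 H1 h0 h0'; have r' := rho1.
(* Adding the two supporting inequalities between [x] and [x + r] bounds a decrease of [dhgt] by
   [2 * rho * r], less than the [4 * rho * r] that [ghgt] adds. *)
have k1 : sin r * (p - q) <= (1 - cos r) * (a + b) by lra.
have k2 : (1 - cos r) * (a + b) <= (r ^+ 2 / 2) * (2 * rho) by apply: ler_pM; lra.
have [pq|pq] := leP p q; first by nra.
have : r / 2 * (p - q) <= r ^+ 2 * rho by nra.
have -> : r / 2 * (p - q) = r * ((p - q) / 2) by ring.
have -> : r ^+ 2 * rho = r * (r * rho) by ring.
by rewrite ler_pM2l//; nra.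
Qed.

Lemma ghgt_mono x y : x <= y -> ghgt x <= ghgt y.
Proof.
have local u v : u <= v -> v <= u + 1 -> ghgt u <= ghgt v.
  rewrite le_eqVlt => /predU1P[->//|uv v1]; rewrite -[v](subrK u) addrC.
  by apply: ghgt_local; apply/andP; split; lra.
have key n : forall u v, u <= v -> v - u <= n%:R -> ghgt u <= ghgt v.
  elim: n => [|n IH] u v uv; first by move=> h; apply: local => //; lra.
  rewrite -natr1 => h; have [v1|v1] := leP v (u + 1); first exact: local.
  apply: (@le_trans _ _ (ghgt (u + 1))); first by apply: local; lra.
  by apply: IH; lra.
move=> xy; apply: (key (Num.truncn (y - x)).+1) => //.
exact: ltW (truncnS_gt _).
Qed.

Lemma ghgt_incr x y : x <= y -> 0 <= ghgt y - ghgt x. Proof. by rewrite subr_ge0; exact: ghgt_mono. Qed.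

(** The factor [cos r] makes this vanish on sinusoids, the support functions of points, so
    translating [D] does not affect it; it is the difference form of [hgt'' + hgt]. *)
Definition second_diff x r := hgt (x + r) + hgt (x - r) - 2 * cos r * hgt x.

(* Bounds the second difference by an average of the measure [d ghgt], hence
   [flatness] by a maximal function of that measure. *)
Lemma second_diff_le x r : 0 < r <= 1 ->
  second_diff x r <= 4 * rho * r ^+ 2 + 2 * r * (ghgt (x + r) - ghgt (x - r)).
Proof.
move=> rr; have := dhgt_left (x + r) rr; rewrite addrK => h1.
have := dhgt_right (x - r) rr; rewrite subrK => h2; have /andP[rp r1] := rr.
have gm : 0 <= ghgt (x + r) - ghgt (x - r) by apply: ghgt_incr; lra.
have /andP[s1 s2] := sin_itv01 rr; have /andP[c1 c2] := cos_itv01 rr.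
have H0 := hgt_le x; have H1 := hgt_ge0 x; have r' := rho1.
have G : dhgt (x + r) - dhgt (x - r) <= ghgt (x + r) - ghgt (x - r) by rewrite /ghgt; nra.
rewrite /second_diff; move: (ghgt (x + r) - _) gm G => g gm G.
move: (hgt x) (hgt (x + r)) (hgt (x - r)) (dhgt _) (dhgt _) h1 h2 H0 H1 G => a b c p q h1 h2 H0 H1 G.
have k1 : cos r * (b + c - 2 * cos r * a) <= 2 * (1 - cos r ^+ 2) * a + sin r * (q - p) by nra.
have k2 : (1 - cos r ^+ 2) * a <= r ^+ 2 * rho.
  have -> : 1 - cos r ^+ 2 = sin r ^+ 2 by rewrite -(cos2Dsin2 r); ring.
  by apply: ler_pM => //; rewrite ?sqr_ge0// lerXn2r ?nnegrE//; lra.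
have k3 : sin r * (q - p) <= r * g.
  apply: (@le_trans _ _ (sin r * g)); first by rewrite ler_wpM2l//; lra.
  by rewrite ler_wpM2r.
have [neg|pos] := leP (b + c - 2 * cos r * a) 0; last by nra.
by apply: le_trans neg _; rewrite addr_ge0 ?mulr_ge0 ?sqr_ge0//; lra.
Qed.

(** The maximum with 1 supplies the bound [1 <= f k] required by the mean square estimate. The value
    is infinite at the normal to a flat side. *)
Definition flatness (x : R) : \bar R :=
  ereal_sup [set (Num.max 1 (second_diff x r / r ^+ 2))%:E | r in [set r : R | 0 < r <= 1]].

Lemma flatness_ge1 x : (1 <= flatness x)%E.
Proof.
apply: (@le_trans _ _ (Num.max 1 (second_diff x 1 / 1 ^+ 2))%:E); first by rewrite lee_fin le_max lexx.
by apply: ereal_sup_ubound; exists 1.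
Qed.

Lemma second_diff_flatness x r : 0 < r <= 1 -> ((second_diff x r / r ^+ 2)%:E <= flatness x)%E.
Proof.
move=> rr; apply: (@le_trans _ _ (Num.max 1 (second_diff x r / r ^+ 2))%:E).
  by rewrite lee_fin le_max lexx orbT.
by apply: ereal_sup_ubound; exists r.
Qed.

Lemma flatness_gt x (a : R) : 1 <= a -> (a%:E < flatness x)%E ->
  exists2 r, 0 < r <= 1 & a * r ^+ 2 < second_diff x r.
Proof.
move=> a1 /ereal_sup_gt [_ [r rr <-]]; rewrite lte_fin lt_max ltNge a1/= => h.
by exists r => //; rewrite -ltr_pdivlMr// exprn_gt0//; case/andP: rr.
Qed.

Lemma continuous_hgt : continuous hgt.
Proof.
have lip x y : hgt x <= hgt y + 2 * rho * `|x - y|.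
  apply: le_trans (supp_sub_le r00 rD Drho (udir x) (udir y)) _.
  rewrite lerD2l/= mulrAC mulrC; have r' := rho1.
  rewrite ler_pM2r//; last by lra.
  by have := cos_lipschitz x y; have := sin_lipschitz x y; lra.
have r' := rho1.
move=> x; apply/cvgrPdist_lt => e e0; near=> y.
have yx : `|x - y| < e / (2 * rho).
  near: y; apply/nbhs_ballP; exists (e / (2 * rho)) => //=.
  by rewrite divr_gt0//; lra.
rewrite ltr_pdivlMr in yx; last by lra.
have := lip x y; have := lip y x; rewrite (distrC y x) => h1 h2.
by rewrite ltr_norml; lra.
Unshelve. all: by end_near. Qed.

(** A supremum of uncountably many continuous functions is lower semicontinuous, hence
    measurable. *)
Lemma measurable_flatness : measurable_fun setT flatness.
Proof.
apply: lower_semicontinuous_measurable => x a /ereal_sup_gt [_ [r rr <-]].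
rewrite lte_fin lt_max => /orP[a1|ar].
  by exists setT => [|y _]; [exact: filterT|apply: lt_le_trans (flatness_ge1 y); rewrite lte_fin].
exists [set y | a < second_diff y r / r ^+ 2] => [|y /= ay].
  suff : (fun y => second_diff y r / r ^+ 2) @ x --> second_diff x r / r ^+ 2.
    by move=> /cvgr_gt /(_ _ ar).
  have ch := continuous_hgt.
  have sh d : (fun y => hgt (y + d)) @ x --> hgt (x + d).
    by apply: continuous_comp; [apply: cvgD; [exact: cvg_id|exact: cvg_cst]|exact: ch].
  apply: cvgM; last exact: cvg_cst.
  apply: cvgB; first by apply: cvgD; [exact: sh|exact: (sh (- r))].
  by apply: cvgM; [exact: cvg_cst|exact: ch].
by apply: lt_le_trans (second_diff_flatness _ rr); rewrite lte_fin.
Qed.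

(** Testing [hgt (x + r)] with one end of the chord and [hgt (x - r)] with the other bounds
    [second_diff x r] below by [sin r * L - 2 d], with [L] the length and [d] the depth. Hence
    [L <= 2 f r + 4 d / r], and [r] is free to be chosen. *)
Lemma chord_flatness x (f : R) y y' : (flatness x <= f%:E)%E -> D y -> D y' ->
  dot (udir x) y = dot (udir x) y' ->
  dot (y.1 - y'.1, y.2 - y'.2) (y.1 - y'.1, y.2 - y'.2) <= 36 * rho * f * (hgt x - dot (udir x) y).
Proof.
(* The orientation decides which end is tested in the direction [x + r]. *)
wlog pos : y y' / 0 <= cos x * (y.2 - y'.2) - sin x * (y.1 - y'.1).
  move=> H Ff Dy Dy' E.
  have [pos|neg] := leP 0 (cos x * (y.2 - y'.2) - sin x * (y.1 - y'.1)); first exact: H.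
  have -> : dot (y.1 - y'.1, y.2 - y'.2) (y.1 - y'.1, y.2 - y'.2) =
    dot (y'.1 - y.1, y'.2 - y.2) (y'.1 - y.1, y'.2 - y.2) by rewrite /dot/=; ring.
  by rewrite E; apply: H => //; lra.
move=> Ff Dy Dy' E; set L := cos x * (y.2 - y'.2) - sin x * (y.1 - y'.1).
have f1 : 1 <= f by rewrite -lee_fin; exact: le_trans (flatness_ge1 x) Ff.
have r' := rho1; set d := hgt x - dot (udir x) y.
have d0 : 0 <= d by rewrite subr_ge0 dot_le_hgt.
have LL : dot (y.1 - y'.1, y.2 - y'.2) (y.1 - y'.1, y.2 - y'.2) = L ^+ 2.
  have E0 : cos x * (y.1 - y'.1) + sin x * (y.2 - y'.2) = 0 by move: E; rewrite /dot/=; lra.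
  have cs := cos2Dsin2 x.
  transitivity ((cos x ^+ 2 + sin x ^+ 2) * dot (y.1 - y'.1, y.2 - y'.2) (y.1 - y'.1, y.2 - y'.2)).
    by rewrite cs mul1r.
  transitivity (L ^+ 2 + (cos x * (y.1 - y'.1) + sin x * (y.2 - y'.2)) ^+ 2).
    by rewrite /L /dot/=; ring.
  by rewrite E0 expr0n addr0.
rewrite LL; have L0 : 0 <= L by exact: pos.
have L2 : L <= 2 * rho.
  have : L <= nrm (y.1 - y'.1, y.2 - y'.2) by rewrite /nrm LL sqrtr_sqr ler_norm.
  have := nrmB y y'; have := Drho Dy; have := Drho Dy'; lra.
have key r : 0 < r <= 1 -> L <= 2 * f * r + 4 * d / r.
  move=> rr; have := second_diff_flatness x rr; move=> /le_trans /(_ Ff); rewrite lee_fin.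
  have /andP[rp r1] := rr; rewrite ler_pdivrMr ?exprn_gt0// => h.
  have h1 := dot_le_hgt (x + r) Dy; have h2 := dot_le_hgt (x - r) Dy'.
  have h3 : dot (udir (x + r)) y + dot (udir (x - r)) y' = 2 * cos r * dot (udir x) y + sin r * L.
    have -> : 2 * cos r * dot (udir x) y = cos r * dot (udir x) y + cos r * dot (udir x) y' by rewrite E; ring.
    by rewrite /L /dot/= !sinD !cosD !sinN !cosN; ring.
  have /andP[s1 s2] := sin_itv01 rr; have /andP[c1 c2] := cos_itv01 rr.
  have h4 : sin r * L <= f * r ^+ 2 + 2 * d.
    have cd : cos r * d <= d by rewrite ler_piMl.
    move: h cd; rewrite /second_diff /d; lra.
  have h5 : r / 2 * L <= f * r ^+ 2 + 2 * d by nra.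
  rewrite -(ler_pM2l (_ : 0 < r / 2)); last by lra.
  move: h5; move: (d) (L) => dd LL' h5.
  by rewrite (_ : r / 2 * (_ + _) = f * r ^+ 2 + 2 * dd)//; field; rewrite gt_eqF.
(* For [0 < d <= f] the choice [r = sqrt (d / f)] gives [L <= 6 f r], whence the 36; for [d = 0],
   [r] tends to 0. For [d > f], [r = 1] gives [L <= 6 d], which is combined with [L <= 2 * rho]. *)
have [df|df] := leP d f.
  have [d00|dn0] := eqVneq d 0.
    rewrite d00 mulr0; suff -> : L = 0 by rewrite expr0n.
    apply/eqP; rewrite eq_le L0 andbT; apply/ler_addgt0Pr => e e0; rewrite add0r.
    have [e1|e1] := leP e (2 * f); last first.
      by have := key 1; rewrite ltr01 lexx d00 => /(_ isT); lra.
    have := key (e / (2 * f)); rewrite divr_gt0//=; last by lra.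
    rewrite ler_pdivrMr ?mul1r ?e1 => [/(_ isT)|]; last by lra.
    by rewrite d00 mulr0 mul0r addr0 mulrC divfK// gt_eqF//; lra.
  have dp : 0 < d by rewrite lt_neqAle eq_sym dn0.
  pose s := Num.sqrt (d / f); have fp : 0 < f by lra.
  have sp : 0 < s by rewrite sqrtr_gt0 divr_gt0.
  have s2 : s ^+ 2 * f = d by rewrite sqr_sqrtr ?divr_ge0 ?divfK ?gt_eqF//; lra.
  have s1 : s <= 1 by rewrite -(sqrtr1 R) ler_sqrt// ler_pdivrMr ?mul1r.
  have := key s; rewrite sp s1 => /(_ isT).
  have -> : 2 * f * s + 4 * d / s = 6 * f * s by rewrite -s2; field; rewrite gt_eqF.
  move=> Ls; have : L ^+ 2 <= (6 * f * s) ^+ 2 by rewrite lerXn2r ?nnegrE//; nra.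
  have -> : (6 * f * s) ^+ 2 = 36 * f * d by rewrite -s2; ring.
  move=> /le_trans; apply; have : 0 <= f * d by rewrite mulr_ge0; lra.
  nra.
have := key 1; rewrite ltr01 lexx divr1 mulr1 => /(_ isT) L6.
have L7 : L <= 6 * d by lra.
have : L ^+ 2 <= 2 * rho * (6 * d) by rewrite expr2 ler_pM.
have : rho * d <= rho * f * d by have : 0 <= rho * d; [rewrite mulr_ge0|]; nra.
have : 0 <= rho * d by rewrite mulr_ge0//; lra.
lra.
Qed.

End Directions.

(** * The weak-type bound for the flatness *)

Section WeakType.
Context {R : realType}.
Notation mu := (@lebesgue_measure R).

(** The intervals are disjoint but not sorted: the head of the list separates the others into those
    on its left and those on its right, and the induction on the length treats each group. *)
Lemma sum_disjoint_increments (g : R -> R) (s : seq (R * R)) (A B : R) :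
  {homo g : x y / x <= y} -> A <= B ->
  (forall x, x \in s -> A <= x.1 /\ x.2 <= B) ->
  (forall x, x \in s -> x.1 <= x.2) ->
  pairwise [rel x y : R * R | (x.2 <= y.1) || (y.2 <= x.1)] s ->
  \sum_(x <- s) (g x.2 - g x.1) <= g B - g A.
Proof.
move=> gm; have [n] := ubnP (size s); elim: n s A B => // n IH [|x t] A B.
  by move=> _ AB _ _ _; rewrite big_nil subr_ge0 gm.
rewrite /= ltnS => tn AB sAB sle /andP[/allP xt pt].
have [Ax xB] := sAB x (mem_head _ _); have x12 := sle x (mem_head _ _).
rewrite big_cons (bigID (fun y : R * R => y.2 <= x.1))/=.
rewrite -[X in _ + (X + _)]big_filter -[X in _ + (_ + X)]big_filter.
set t1 := [seq y <- t | y.2 <= x.1]; set t2 := [seq y <- t | _].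
have h1 : \sum_(y <- t1) (g y.2 - g y.1) <= g x.1 - g A.
  apply: IH => //.
  - by rewrite size_filter (leq_ltn_trans (count_size _ _)).
  - move=> y; rewrite mem_filter => /andP[yx yt]; split=> //.
    by have [] := sAB y; rewrite ?inE ?yt ?orbT.
  - by move=> y; rewrite mem_filter => /andP[yx yt]; apply: sle; rewrite inE yt orbT.
  - exact: pairwise_filter.
have h2 : \sum_(y <- t2) (g y.2 - g y.1) <= g B - g x.2.
  apply: IH => //.
  - by rewrite size_filter (leq_ltn_trans (count_size _ _)).
  - move=> y; rewrite mem_filter => /andP[yx yt]; split=> //; last first.
      by have [] := sAB y; rewrite ?inE ?yt ?orbT.
    by have /= /orP[|] := xt y yt => // h; rewrite h in yx.
  - by move=> y; rewrite mem_filter => /andP[yx yt]; apply: sle; rewrite inE yt orbT.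
  - exact: pairwise_filter.
lra.
Qed.

Lemma disjoint_balls (x y r s : R) : 0 < r -> 0 < s ->
  ball x r `&` ball y s = set0 -> x + r <= y - s \/ y + s <= x - r.
Proof.
move=> r0 s0 E; have [h|h] := leP (x + r) (y - s); first by left.
right; rewrite leNgt; apply/negP => h'.
have : (ball x r `&` ball y s) ((x * s + y * r) / (r + s)).
  have rs : 0 < r + s by lra.
  split; rewrite /ball/=.
    rewrite (_ : x - _ = (x - y) * r / (r + s)); last by field; rewrite gt_eqF.
    rewrite 2!normrM normfV (gtr0_norm r0) (gtr0_norm rs) ltr_pdivrMr// mulrC ltr_pM2l//.
    by rewrite ltr_norml; lra.
  rewrite (_ : y - _ = (y - x) * s / (r + s)); last by field; rewrite gt_eqF.
  rewrite 2!normrM normfV (gtr0_norm s0) (gtr0_norm rs) ltr_pdivrMr// mulrC ltr_pM2l//.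
  by rewrite ltr_norml; lra.
by rewrite E.
Qed.

Variables (D : set (R * R)) (r0 rho : R).
Hypothesis r00 : 0 < r0.
Hypothesis rho1 : 1 <= rho.
Hypothesis rD : forall z, nrm z <= r0 -> D z.
Hypothesis Drho : forall z, D z -> nrm z <= rho.

Let g := ghgt D rho.

(** [1920 = 80 * 24]. The balls lie in [[-9, 9]], where [dhgt] varies by at most [8 * rho] and the
    linear part of [ghgt] by [72 * rho]. The 24 is 3 from Vitali, 2 from the length [2r] of a ball
    and 4 from the increment [kap / 4 * r]. The interval [[-8, 8]] holds every difference of two
    angles in [[- pi, pi]]. *)
Lemma flatness_weak (kap : R) : 0 < kap ->
  (mu [set x | (-8 <= x <= 8)%R /\ kap%:E < flatness D x] <= (1920 * rho / kap)%:E)%E.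
Proof.
move=> kap0; have r' := rho1.
set S := [set x | _].
have mS : measurable S.
  have -> : S = `[-8, 8]%classic `&` [set x | (kap%:E < flatness D x)%E].
    by apply/seteqP; split=> x /=; rewrite in_itv.
  apply: measurableI => //; rewrite -[X in measurable X]setTI.
  by apply: emeasurable_fun_o_infty => //; exact: (measurable_flatness r00 rho1 rD Drho).
(* For small [kap] the trivial measure 16 is enough; otherwise the term [4 * rho * r^2] of
   [second_diff_le] is at most half of [kap * r^2]. *)
have [k8|k8] := ltP kap (8 * rho).
  apply: (@le_trans _ _ (mu `[-8, 8]%classic)).
    by apply: le_measure; rewrite ?inE//; move=> x [/= h _]; rewrite in_itv.
  rewrite lebesgue_measure_itv/= lte_fin ifT; last by lra.
  rewrite -EFinB lee_fin ler_pdivlMr//; lra.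
(* Inner regularity leaves compact subsets, for which the cover by balls can be taken finite. *)
rewrite lebesgue_regularity_inner_sup//.
apply: ge_ereal_sup => /= x /= [K [cK KS <-{x}]].
have r_proof x : (kap%:E < flatness D x)%E ->
    {r : R | 0 < r <= 1 & kap / 4 * r <= g (x + r) - g (x - r)}.
  move=> h; have k1 : 1 <= kap by lra.
  have /cid2[r rr hr] := flatness_gt k1 h; exists r => //.
  have := second_diff_le r00 rho1 rD Drho x rr; have /andP[rp r1] := rr.
  rewrite -/g => h2; have h3 := lt_le_trans hr h2.
  rewrite -(ler_pM2l (_ : 0 < 2 * r)); last by lra.
  have : 8 * rho * r ^+ 2 <= kap * r ^+ 2 by rewrite ler_pM2r ?exprn_gt0.
  lra.
pose r_ x := if pselect (kap%:E < flatness D x)%E is left H then s2val (r_proof _ H) else 1.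
have r_pos x : 0 < r_ x <= 1.
  by rewrite /r_; case: pselect => [h|_]; [case: (r_proof _ h)|rewrite ltr01 lexx].
have r_incr x : S x -> kap / 4 * r_ x <= g (x + r_ x) - g (x - r_ x).
  by move=> [_ h]; rewrite /r_; case: pselect => // {}h; case: (r_proof _ h).
pose B x := ball x (r_ x).
have rp x : 0 < r_ x by case/andP: (r_pos x).
have BS : K `<=` cover S B.
  by move=> x /KS Sx; exists x => //; exact: ballxx.
have [F Fsub Kcover] : finite_subset_cover S B K.
  by move: cK; rewrite compact_cover => /(_ _ _ _ _ BS); apply=> x _; exact: ball_open.
have KFB : K `<=` cover [set` F] B.
  by apply: (subset_trans Kcover) => /= x [r Fr] rx; exists r.
have is_ballB i : is_ball (B i) by exact: is_ball_ball.
have Bset0 i : B i !=set0 by exists i; exact: ballxx.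
have [E [uE EF tEB FE]] := @vitali_lemma_finite_cover _ _ B is_ballB Bset0 F.
have ES x : x \in E -> S x by move=> /EF /Fsub /[!inE].
have step : \sum_(i <- E) (g (i + r_ i) - g (i - r_ i)) <= 80 * rho.
  have := @sum_disjoint_increments g [seq (i - r_ i, i + r_ i) | i <- E] (-9) 9.
  rewrite big_map/= => H; apply: le_trans (H _ _ _ _ _) _.
  - by move=> u v; exact: (ghgt_mono r00 rho1 rD Drho).
  - lra.
  - move=> _ /mapP[i iE ->] /=; have [/andP[i1 i2] _] := ES _ iE.
    by have /andP[ri1 ri2] := r_pos i; lra.
  - by move=> _ /mapP[i iE ->] /=; have := rp i; lra.
  - rewrite pairwise_map/=; have : all (mem E) E by apply/allP.
    move: uE; rewrite uniq_pairwise => pE aE; move: pE; apply: (sub_in_pairwise _ aE).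
    move=> i j iE jE /= ij; apply/orP.
    have := @disjoint_balls i j (r_ i) (r_ j) (rp i) (rp j).
    case; [|by left|by right].
    by apply/eqP/negPn/negP => /set0P ne; move/eqP: ij; apply; apply: tEB.
  - rewrite /g /ghgt; have := dhgt_bound r00 rho1 rD Drho 9; have := dhgt_bound r00 rho1 rD Drho (-9).
    rewrite !ler_norml => /andP[a1 a2] /andP[b1 b2]; lra.
apply: (@le_trans _ _ (3%:E * \sum_(i <- E) mu (B i)))%E.
  have {}FE := subset_trans KFB FE.
  apply: (le_trans (@content_subadditive _ _ _ mu K
      (fun i => 3 *` B (nth 0 E i)) (size E) _ _ _)) => //.
  - by move=> k ?; rewrite scale_ballE//; exact: measurable_ball.
  - by apply: closed_measurable; apply: compact_closed => //; exact: Rhausdorff.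
  - by apply: (subset_trans FE); rewrite /cover bigcup_seq (big_nth 0)//= big_mkord.
  - rewrite ge0_sume_distrr//= (big_nth 0) big_mkord; apply: lee_sum => i _.
    rewrite scale_ballE// !lebesgue_measure_ball ?mulr_ge0 ?(ltW (rp _))//.
    by rewrite -mulrnAr EFinM.
have -> : (\sum_(i <- E) mu (B i))%E = (\sum_(i <- E) (r_ i *+ 2))%:E.
  rewrite -sumEFin; apply: eq_bigr => i _; rewrite lebesgue_measure_ball//.
  exact: ltW.
rewrite -EFinM lee_fin; have k0 : 0 < kap / 24 by lra.
rewrite -(ler_pM2l k0) (_ : kap / 24 * (1920 * rho / kap) = 80 * rho); last by field; rewrite gt_eqF.
apply: le_trans step; rewrite mulrA mulr_sumr big_seq [leRHS]big_seq; apply: ler_sum => i iE.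
by apply: le_trans (r_incr _ (ES _ iE)); rewrite -mulr_natr; lra.
Qed.

End WeakType.

(** * Weighted sums of weak-type functions *)

Section WeakSums.
Context {R : realType}.
Notation mu := (@lebesgue_measure R).

(* Splitting off the first term and pairing the terms 2m and 2m+1 gives
   [S_(2N+1) <= 1 + 2 ^ (- e) S_N]. *)
Lemma zeta_bound (e : R) (N : nat) : 0 < e ->
  \sum_(m < N) m.+1%:R `^ (- (1 + e)) <= (1 - 2 `^ (- e))^-1.
Proof.
move=> e0; pose u (m : nat) : R := m.+1%:R `^ (- (1 + e)); pose q : R := 2 `^ (- e).
have u0 m : 0 <= u m by exact: powR_ge0.
have q1 : q < 1.
  rewrite /q powRN invf_lt1 ?powR_gt0//.
  rewrite [X in X < _](_ : 1 = 1 `^ e); last by rewrite powR1.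
  by rewrite gt0_ltr_powR ?nnegrE// ltr1n.
have un m n : (m <= n)%N -> u n <= u m.
  move=> mn; rewrite /u !powRN lef_pV2 ?posrE ?powR_gt0//.
  by rewrite ge0_ler_powR ?nnegrE// ?ler_nat//; lra.
have u2 m : u m.*2.+1 = q / 2 * u m.
  rewrite /u (_ : m.*2.+2%:R = 2 * m.+1%:R :> R); last by rewrite -doubleS -mul2n natrM.
  by rewrite powRM// opprD powRD ?pnatr_eq0 ?implybT// powR_inv1//; rewrite /q; ring.
have S n : \sum_(m < n.*2.+1) u m <= 1 + q * \sum_(m < n) u m.
  elim: n => [|n IH]; first by rewrite big_ord1 big_ord0 mulr0 addr0 /u powR1.
  rewrite doubleS [X in _ <= 1 + q * X]big_ord_recr/= [X in X <= _]big_ord_recr/=.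
  rewrite [X in X + _ <= _]big_ord_recr/=.
  by have := un _ _ (leqnSn n.*2.+1); rewrite u2; lra.
have SN : \sum_(m < N) u m <= \sum_(m < N.*2.+1) u m.
  by rewrite -addnn -addnS big_split_ord/= lerDl sumr_ge0.
rewrite -[leRHS]mul1r ler_pdivlMr ?subr_gt0// -/q.
have := S N; move: SN; rewrite -/u; lra.
Qed.

Definition lv (k : int * int) : nat := trunc_log 2 (maxn `|k.1| `|k.2|).

(** The vectors of level [m] lie in the box of radius [2^(m+1)], which has
    [(2^(m+2) + 1)^2 <= (5 * 2^m)^2] points. *)
Lemma level_sum (N : nat) (phi : nat -> R) : (forall m, 0 <= phi m) ->
  \sum_(k <- box N | k != 0) phi (lv k) <= \sum_(m < N.+1) 25 * 4 ^+ m * phi m.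
Proof.
move=> phi0; have lvN k : k \in box N -> (lv k < N.+1)%N.
  rewrite mem_box ltnS => /andP[h1 h2].
  have [M0|M0] := posnP (maxn `|k.1| `|k.2|); first by rewrite /lv M0 trunc_log0.
  by rewrite (leq_trans (ltnW (ltn_expl _ (ltnSn 1))))// (leq_trans (trunc_logP _ _))// geq_max h1.
have -> : \sum_(k <- box N | k != 0) phi (lv k) =
    \sum_(k <- box N | k != 0) \sum_(m < N.+1) (lv k == m)%:R * phi m.
  rewrite big_seq_cond [RHS]big_seq_cond; apply: eq_bigr => k /andP[kN _].
  rewrite (bigD1 (Ordinal (lvN k kN)))//= eqxx mul1r big1 ?addr0// => i.
  by rewrite -val_eqE/= eq_sym => /negbTE ->; rewrite mul0r.
rewrite exchange_big/=; apply: ler_sum => m _; rewrite -mulr_suml.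
apply: ler_wpM2r => //.
have -> : \sum_(k <- box N | k != 0) (lv k == m)%:R = (size [seq k <- box N | (k != 0) && (lv k == m)])%:R :> R.
  rewrite -sum1_size big_filter natr_sum big_mkcondr/=; apply: eq_bigr => k _.
  by case: (lv k == m).
apply: (@le_trans _ _ (size (box (2 ^ m.+1)))%:R).
  rewrite ler_nat; apply: uniq_leq_size => [|k]; first by rewrite filter_uniq ?uniq_box.
  rewrite mem_filter mem_box => /andP[/andP[_ /eqP lk] _].
  have := @trunc_log_ltn 2 (maxn `|k.1| `|k.2|) isT; rewrite -/(lv k) lk gtn_max => /andP[h1 h2].
  by rewrite mem_box; apply/andP; split; exact: ltnW.
have sr n : size (rng n) = n.*2.+1 by rewrite size_map size_iota.
rewrite size_allpairs sr natrM -natr1 -mul2n natrM natrX exprS.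
have p1 : 1 <= 2 ^+ m :> R by rewrite exprn_ege1// ler1n.
rewrite (_ : 25 * 4 ^+ m = (5 * 2 ^+ m) * (5 * 2 ^+ m)); first by apply: ler_pM; lra.
by have -> : (4 : R) = 2 * 2; [ring|rewrite exprMn; ring].
Qed.

Lemma bs1_indic_set (T : set R) (M : R) : measurable T -> (forall x, T x -> `|x| <= M) ->
  bs1 (\1_T).
Proof.
move=> mT TM; split; first exact: measurable_indic.
exists (1 + `|M|) => x; rewrite indicE; split.
  by case: (_ \in _); rewrite ?normr1 ?normr0; have := normr_ge0 M; lra.
by move=> h; rewrite memNset// => /TM; have := ler_norm M; lra.
Qed.

(** A dyadic layer-cake formula: if [x > a], the term of the last [j] with [a 2^j < x] alone is
    [a 2^(j+1) >= x]. *)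
Lemma dyadic_truncation (a x : R) (n : nat) : 0 <= a -> x <= a * 2 ^+ n ->
  x <= a + \sum_(j < n) a * 2 ^+ j.+1 * (a * 2 ^+ j < x)%R%:R.
Proof.
move=> a0; elim: n => [|n IH]; first by rewrite big_ord0 addr0 mulr1.
move=> h; rewrite big_ord_recr/=; have [xn|xn] := leP x (a * 2 ^+ n).
  by rewrite mulr0 addr0; exact: IH.
rewrite mulr1; apply: le_trans h _; rewrite addrA lerDr addr_ge0// sumr_ge0// => j _.
by rewrite !mulr_ge0 ?exprn_ge0.
Qed.

(* Stein and Weiss: weak-type functions can be summed against weights at the
   price of a logarithm, here replaced by the integers [l i]. *)
Lemma weak_sum (I : eqType) (s : seq I) (X : set R) (F : I -> R -> \bar R) (w : I -> R)
    (l : I -> nat) (A W U V M : R) :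
  measurable X -> (forall x, X x -> `|x| <= M) ->
  (forall i, measurable_fun setT (F i)) -> (forall i x, 0 <= F i x)%E ->
  (forall i, 0 <= w i) -> 0 <= A -> 0 < W ->
  (forall i kap, 0 < kap -> \int[mu]_x \1_(X `&` [set x | kap%:E < F i x]%E) x <= A / kap) ->
  \sum_(i <- s) w i <= W ->
  \sum_(i <- s) (8 ^+ l i)^-1 <= U ->
  \sum_(i <- s) w i * (l i)%:R <= V ->
  forall lam, 0 < lam ->
  \int[mu]_x \1_(X `&` [set x | lam%:E < \sum_(i <- s) (w i)%:E * F i x]%E) x <=
    A * (2 * W * U + 12 * V) / lam.
Proof.
move=> mX XM mF F0 w0 A0 W0 weak sW sU sV lam lam0.
(* The parts of the [F i] below [a] contribute at most [W * a = lam / 2]; the other half of [lam]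
   must come from above. *)
pose a := lam / (2 * W); have a0 : 0 < a by rewrite divr_gt0// mulr_gt0.
pose T i kap := X `&` [set x | kap%:E < F i x]%E.
have mT i kap : measurable (T i kap).
  apply: measurableI => //; rewrite -[X in measurable X]setTI.
  exact: emeasurable_fun_o_infty.
have bT i kap : bs1 (\1_(T i kap)) by apply: (@bs1_indic_set _ M (mT i kap)) => x [/XM].
set P := X `&` _.
have mP : measurable P.
  apply: measurableI => //; rewrite -[X in measurable X]setTI.
  apply: emeasurable_fun_o_infty => //; apply: emeasurable_sum => i.
  by apply: measurable_funeM.
have bP : bs1 (\1_P) by apply: (@bs1_indic_set _ M mP) => x [/XM].
(* [G] majorises the indicator of [P]. Either some [F i] exceeds [a * 8 ^ l i], counted by the first
   sum at a cost summable through [U]; or every [F i] spans only [3 * l i] dyadic levels, each of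
   integral at most [2 * A], and the factor [2 / lam] is Markov's inequality. *)
pose G x := \sum_(i <- s) \1_(T i (a * 8 ^+ l i)) x + 2 / lam * \sum_(i <- s) w i *
   \sum_(j < 3 * l i) a * 2 ^+ j.+1 * \1_(T i (a * 2 ^+ j)) x.
have bj i : bs1 (fun x => \sum_(j < 3 * l i) a * 2 ^+ j.+1 * \1_(T i (a * 2 ^+ j)) x).
  by apply: bs1_sum => j; exact: bs1Z.
have bw : bs1 (fun x => \sum_(i <- s) w i * \sum_(j < 3 * l i) a * 2 ^+ j.+1 * \1_(T i (a * 2 ^+ j)) x).
  by apply: bs1_sum => i; exact: bs1Z.
have bb : bs1 (fun x => \sum_(i <- s) \1_(T i (a * 8 ^+ l i)) x) by exact: bs1_sum.
have bG : bs1 G by apply: bs1D => //; exact: bs1Z.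
have G0 i x : 0 <= \sum_(j < 3 * l i) a * 2 ^+ j.+1 * \1_(T i (a * 2 ^+ j)) x.
  apply: sumr_ge0 => j _; rewrite indicE; apply: mulr_ge0 => //.
  by apply: mulr_ge0; [exact: ltW|exact: exprn_ge0].
apply: (@le_trans _ _ (\int[mu]_x G x)).
  apply: le_int1 => // x; rewrite /G [leLHS]indicE.
  have g1 : 0 <= \sum_(i <- s) \1_(T i (a * 8 ^+ l i)) x :> R by apply: sumr_ge0 => i _; rewrite indicE.
  have g2 : 0 <= \sum_(i <- s) w i * \sum_(j < 3 * l i) a * 2 ^+ j.+1 * \1_(T i (a * 2 ^+ j)) x.
    by apply: sumr_ge0 => i _; exact: mulr_ge0.
  case: (boolP (x \in P)) => [|_]; last by rewrite addr_ge0// mulr_ge0// divr_ge0// ltW.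
  rewrite inE => -[Xx /= Fx].
  have [bad|good] := pselect (exists2 i, i \in s & T i (a * 8 ^+ l i) x).
    have [i si Ti] := bad; apply: ler_wpDr; first by rewrite mulr_ge0// divr_ge0// ltW.
    rewrite (big_rem i)//= indicE mem_set// lerDl; apply: sumr_ge0 => i' _; by rewrite indicE.
  apply: ler_wpDl => //.
  pose h i := a + \sum_(j < 3 * l i) a * 2 ^+ j.+1 * \1_(T i (a * 2 ^+ j)) x.
  have Fh i : i \in s -> (F i x <= (h i)%:E)%E.
    move=> si; have nb : (F i x <= (a * 8 ^+ l i)%:E)%E.
      by rewrite leNgt; apply/negP => b; apply: good; exists i.
    move: nb (F0 i x) (erefl (F i x)); case: {1 2 3}(F i x) => // y; rewrite !lee_fin => yb y0 Ey.
    rewrite -Ey lee_fin; have := @dyadic_truncation a y (3 * l i) (ltW a0).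
    rewrite exprM (_ : 2 ^+ 3 = 8 :> R); last by ring.
    move=> /(_ yb) /le_trans; apply; rewrite /h lerD2l; apply: ler_sum => j _.
    apply: ler_wpM2l; first by apply: mulr_ge0; [exact: ltW|exact: exprn_ge0].
    rewrite indicE.
    case: (boolP (_ < y)) => // h'; rewrite mem_set//; split => //=.
    by rewrite -Ey lte_fin.
  have : (lam%:E < (\sum_(i <- s) w i * h i)%:E)%E.
    apply: (lt_le_trans Fx); rewrite -sumEFin big_seq [in leRHS]big_seq; apply: lee_sum => i si.
    by rewrite EFinM lee_wpmul2l ?lee_fin// Fh.
  rewrite lte_fin; have -> : \sum_(i <- s) w i * h i = (\sum_(i <- s) w i) * a +
      \sum_(i <- s) w i * \sum_(j < 3 * l i) a * 2 ^+ j.+1 * \1_(T i (a * 2 ^+ j)) x.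
    by rewrite mulr_suml -big_split/=; apply: eq_bigr => i _; rewrite mulrDr.
  have : (\sum_(i <- s) w i) * a <= lam / 2.
    apply: le_trans (_ : _ <= W * a) _; first by rewrite ler_wpM2r// ltW.
    by rewrite /a (_ : W * _ = lam / 2)//; field; rewrite gt_eqF.
  move=> h1 h2; rewrite mulrAC ler_pdivlMr// mul1r; lra.
rewrite int1D//; last exact: bs1Z.
rewrite int1Z// !int1_sum//; last by move=> i; exact: bs1Z.
have e1 : \sum_(i <- s) \int[mu]_x \1_(T i (a * 8 ^+ l i)) x <= A / a * U.
  apply: (@le_trans _ _ (\sum_(i <- s) A / a * (8 ^+ l i)^-1)).
    apply: ler_sum => i _; apply: le_trans (weak i _ _) _; first by rewrite mulr_gt0 ?exprn_gt0.
    by rewrite invfM mulrA.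
  by rewrite -mulr_sumr ler_wpM2l// divr_ge0// ltW.
have e2 : \sum_(i <- s) \int[mu]_x (w i * \sum_(j < 3 * l i) a * 2 ^+ j.+1 * \1_(T i (a * 2 ^+ j)) x)
    <= 6 * A * V.
  apply: (@le_trans _ _ (\sum_(i <- s) 6 * A * (w i * (l i)%:R))); last first.
    by rewrite -mulr_sumr ler_wpM2l// mulr_ge0.
  apply: ler_sum => i _; rewrite int1Z// int1_sum; last by move=> j; exact: bs1Z.
  rewrite mulrCA; apply: ler_wpM2l => //.
  apply: (@le_trans _ _ (\sum_(j < 3 * l i) 2 * A)).
    apply: ler_sum => j _; rewrite int1Z//.
    have pj : 0 < a * 2 ^+ j by rewrite mulr_gt0 ?exprn_gt0.
    rewrite exprS mulrCA -mulrA ler_pM2l//.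
    by have := weak i _ pj; rewrite ler_pdivlMr// mulrC.
  by rewrite sumr_const card_ord -[X in X <= _]mulr_natr natrM; lra.
apply: (@le_trans _ _ (A / a * U + 2 / lam * (6 * A * V))).
  by apply: lerD => //; rewrite ler_wpM2l// divr_ge0// ltW.
rewrite le_eqVlt; apply/orP; left; apply/eqP; rewrite /a; field.
by rewrite !gt_eqF.
Qed.

End WeakSums.

(** * Rotations *)

Section Rotations.
Context {R : realType}.
Implicit Types (D : set (R * R)) (th : R).
Local Notation rot := Defs.rot.

Lemma rotNK th z : rot (- th) (rot th z) = z.
Proof.
have E := cos2Dsin2 th; rewrite [RHS]surjective_pairing /rot/= cosN sinN; congr pair.
  by transitivity ((cos th ^+ 2 + sin th ^+ 2) * z.1); [ring|rewrite E mul1r].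
by transitivity ((cos th ^+ 2 + sin th ^+ 2) * z.2); [ring|rewrite E mul1r].
Qed.

Lemma rotKN th z : rot th (rot (- th) z) = z.
Proof. by rewrite -{1}(opprK th) rotNK. Qed.

Lemma rot_setE th D : rot_set th D = rot (- th) @^-1` D.
Proof.
apply/seteqP; split=> [_ [z Dz <-]|z Dz] /=; first by rewrite rotNK.
by exists (rot (- th) z) => //; rewrite rotKN.
Qed.

Let lin_lt (a b x y e : R) : `|a| <= 1 -> `|b| <= 1 -> `|x| < e / 2 -> `|y| < e / 2 ->
  `|a * x + b * y| < e.
Proof.
move=> a1 b1 x1 y1; apply: le_lt_trans (ler_normD _ _) _; rewrite !normrM.
have : `|a| * `|x| <= `|x| by rewrite ler_piMl.
have : `|b| * `|y| <= `|y| by rewrite ler_piMl.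
lra.
Qed.

Lemma open_rot th D : open D -> open (rot_set th D).
Proof.
move=> oD; rewrite rot_setE openE => z /= Dz.
have /nbhs_ballP [e /= e0 eD] := open_nbhs_nbhs (conj oD Dz).
apply/nbhs_ballP; exists (e / 2); first by rewrite /= divr_gt0.
move=> w [/= w1 w2]; apply: eD; rewrite /ball/= in w1 w2; split; rewrite /ball/=.
  rewrite (_ : _ - _ = cos (- th) * (z.1 - w.1) + (- sin (- th)) * (z.2 - w.2)); last by ring.
  by apply: lin_lt => //; rewrite ?normrN ?cos_max ?sin_max.
rewrite (_ : _ - _ = sin (- th) * (z.1 - w.1) + cos (- th) * (z.2 - w.2)); last by ring.
by apply: lin_lt => //; rewrite ?cos_max ?sin_max.
Qed.

Lemma convex_rot th D : convex_set2 D -> convex_set2 (rot_set th D).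
Proof.
move=> cD _ _ [x Dx <-] [y Dy <-] l l01.
exists ((1 - l) * x.1 + l * y.1, (1 - l) * x.2 + l * y.2); first exact: cD.
by rewrite /rot/=; congr pair; ring.
Qed.

Lemma nrm_rot th (z : R * R) : nrm (rot th z) = nrm z.
Proof.
rewrite /nrm; congr Num.sqrt; rewrite /rot /dot/=.
transitivity ((cos th ^+ 2 + sin th ^+ 2) * (z.1 * z.1 + z.2 * z.2)); first by ring.
by rewrite cos2Dsin2 mul1r.
Qed.

Lemma dot_rot th (n al : R) z :
  dot (n * cos al, n * sin al) (rot th z) = n * dot (udir (al - th)) z.
Proof. by rewrite /dot /rot /udir/= cosB sinB; ring. Qed.

Lemma supp_rot th D (n al r0 rho : R) : 0 < r0 -> (forall z, nrm z <= r0 -> D z) ->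
  (forall z, D z -> nrm z <= rho) -> 0 < n ->
  supp (rot_set th D) (n * cos al, n * sin al) = n * hgt D (al - th).
Proof.
move=> r00 rD Drho n0.
rewrite /hgt -(supp_scale r00 rD Drho (udir (al - th)) n0) /supp; congr sup.
have E z : dot (n * cos al, n * sin al) (rot th z) =
    dot (n * (udir (al - th)).1, n * (udir (al - th)).2) z.
  by rewrite dot_rot /dot/=; ring.
apply/seteqP; split=> [_ [_ [z Dz <-] <-]|_ [z Dz <-]]; first by exists z.
by exists (rot th z) => //; exists z.
Qed.

Lemma polar (k : R * R) : k != (0, 0) ->
  exists al, - pi <= al <= pi /\ k = (nrm k * cos al, nrm k * sin al).
Proof.
move=> k0; have n0 := nrm_gt0 k0; have nn : nrm k != 0 by rewrite gt_eqF.
pose c := k.1 / nrm k; pose s := k.2 / nrm k.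
have cs : c ^+ 2 + s ^+ 2 = 1.
  have := sqr_nrm k; rewrite /dot -!expr2 => E.
  by rewrite /c /s !expr_div_n -mulrDl -E divff// expf_neq0.
have c2 : c ^+ 2 <= 1 by rewrite -cs lerDl sqr_ge0.
have c1 : -1 <= c <= 1 by apply/andP; split; nra.
have [/andP[a0 api] ca] := acos_def c1; have sa := sin_acos c1.
have s2 : 1 - c ^+ 2 = s ^+ 2 by rewrite -cs; ring.
rewrite s2 sqrtr_sqr in sa.
have p0 := @pi_gt0 R.
have [s0|s0] := leP 0 s.
  exists (acos c); split; first by lra.
  by rewrite ca sa ger0_norm// [LHS]surjective_pairing /c /s; congr pair; field.
exists (- acos c); split; first by lra.
by rewrite cosN sinN ca sa ltr0_norm// opprK [LHS]surjective_pairing /c /s; congr pair; field.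
Qed.

Lemma polar_angles : exists al : int * int -> R, forall k, - pi <= al k <= pi /\
  (k != 0 -> (kr k : R * R) = (nrm (kr k : R * R) * cos (al k), nrm (kr k : R * R) * sin (al k))).
Proof.
have H (k : int * int) : exists a : R, - pi <= a <= pi /\
    (k != 0 -> (kr k : R * R) = (nrm (kr k : R * R) * cos a, nrm (kr k : R * R) * sin a)).
  have [->|k0] := eqVneq k 0; first by exists 0; split=> //; have := @pi_gt0 R; lra.
  by have [a [a1 a2]] := polar (kr_neq0 k0 : (kr k : R * R) != _); exists a.
by have [al] := choice H; exists al.
Qed.

End Rotations.

(** * The weighted sum of flatnesses over all frequencies *)

Section MaximalFunction.
Context {R : realType}.
Notation mu := (@lebesgue_measure R).
Variables (D : set (R * R)) (r0 rho eps : R) (al : int * int -> R).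
Hypothesis r00 : 0 < r0.
Hypothesis r01 : r0 <= 1.
Hypothesis rho1 : 1 <= rho.
Hypothesis oD : open D.
Hypothesis cD : convex_set2 D.
Hypothesis rD : forall z, nrm z <= r0 -> D z.
Hypothesis Drho : forall z, D z -> nrm z <= rho.
Hypothesis eps0 : 0 < eps.
Hypothesis al_pi : forall k, - pi <= al k <= pi.
Hypothesis al_polar : forall k, k != 0 ->
  (kr k : R * R) = (nrm (kr k : R * R) * cos (al k), nrm (kr k : R * R) * sin (al k)).

Let b (m : nat) : R := m.+1%:R `^ (- (1 + 2 * eps)).
Let Q : R := (1 - 2 `^ (- (2 * eps)))^-1.

(* The logarithmic factor makes [weight k * lv k] summable. *)
Definition weight (k : int * int) : R := b (lv k) / (lv k).+1%:R / 4 ^+ lv k.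

Let b_gt0 m : 0 < b m. Proof. by rewrite powR_gt0. Qed.

Lemma weight_gt0 k : 0 < weight k.
Proof. by rewrite !divr_gt0 ?exprn_gt0. Qed.

Let sum_b N : \sum_(m < N) b m <= Q.
Proof. by apply: zeta_bound; rewrite mulr_gt0. Qed.

Let Q0 : 0 < Q.
Proof. by apply: lt_le_trans (sum_b 1); rewrite big_ord1. Qed.

Let ks N := [seq k <- box N | k != 0].

Let sum_weight N : \sum_(k <- ks N) weight k <= 25 * Q.
Proof.
rewrite big_filter; apply: le_trans (level_sum N (phi := fun m => b m / m.+1%:R / 4 ^+ m) _) _.
  by move=> m; rewrite !divr_ge0 ?exprn_ge0// ltW.
apply: le_trans (_ : _ <= 25 * \sum_(m < N.+1) b m) _; last by rewrite ler_pM2l.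
rewrite mulr_sumr; apply: ler_sum => m _; rewrite -mulrA ler_pM2l//.
rewrite mulrCA mulfV ?expf_neq0// mulr1 ler_pdivrMr// ler_peMr ?ler1n//.
exact: ltW.
Qed.

Let sum_weight_lv N : \sum_(k <- ks N) weight k * (lv k)%:R <= 25 * Q.
Proof.
rewrite big_filter; apply: le_trans (level_sum N (phi := fun m => b m / m.+1%:R / 4 ^+ m * m%:R) _) _.
  by move=> m; rewrite mulr_ge0// !divr_ge0 ?exprn_ge0// ltW.
apply: le_trans (_ : _ <= 25 * \sum_(m < N.+1) b m) _; last by rewrite ler_pM2l.
rewrite mulr_sumr; apply: ler_sum => m _; rewrite -mulrA ler_pM2l//.
rewrite (_ : _ * _ = b m * m%:R / m.+1%:R); last first.
  by field; rewrite expf_neq0// nat1r pnatr_eq0.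
by rewrite ler_pdivrMr// ler_wpM2l ?ler_nat// ltW.
Qed.

Let sum_eighth N : \sum_(k <- ks N) (8 ^+ lv k)^-1 <= 50 :> R.
Proof.
rewrite big_filter; apply: le_trans (level_sum N (phi := fun m => (8 ^+ m)^-1) _) _.
  by move=> m; rewrite invr_ge0 exprn_ge0.
have -> : \sum_(m < N.+1) 25 * 4 ^+ m * (8 ^+ m)^-1 = 25 * \sum_(m < N.+1) 2^-1 ^+ m :> R.
  rewrite mulr_sumr; apply: eq_bigr => m _; rewrite -mulrA; congr (_ * _).
  by rewrite -expr_div_n; congr (_ ^+ _); field.
have G n : \sum_(m < n) 2^-1 ^+ m = 2 - 2 * 2^-1 ^+ n :> R.
  elim: n => [|n IH]; first by rewrite big_ord0 expr0; ring.
  by rewrite big_ord_recr/= IH exprS; field.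
have h : 0 <= 2^-1 ^+ N.+1 :> R by rewrite exprn_ge0.
by rewrite G; lra.
Qed.

Definition flat (k : int * int) (th : R) : \bar R := flatness D (al k - th).

Lemma flat_ge0 k th : (0 <= flat k th)%E.
Proof. by apply: le_trans (flatness_ge1 D _); rewrite lee_fin. Qed.

Lemma measurable_flat k : measurable_fun setT (flat k).
Proof.
apply: (measurableT_comp (measurable_flatness r00 rho1 rD Drho)).
exact: measurable_funB.
Qed.

Let X := `[(- pi : R), pi]%classic.

Let Xle x : X x -> `|x| <= 4.
Proof. by rewrite /X/= in_itv/= ler_norml => /andP[h1 h2]; have := @pi_le4 R; lra. Qed.

Let mX : measurable X. Proof. exact: measurable_itv. Qed.

Let A := 1920 * rho.
Let A0 : 0 <= A. Proof. exact: mulr_ge0 (ler0n _ _) (le_trans ler01 rho1). Qed.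

(** The reflection [th -> al k - th] preserves measure and sends [[- pi, pi]] into [[-8, 8]], so the
    bound does not depend on [k]. *)
Lemma flat_weak k (kap : R) : 0 < kap ->
  \int[mu]_x \1_(X `&` [set x | (kap%:E < flat k x)%E]) x <= A / kap.
Proof.
move=> kap0; pose S := [set x | (-8 <= x <= 8)%R /\ (kap%:E < flatness D x)%E].
have mS : measurable S.
  have -> : S = `[-8, 8]%classic `&` [set x | (kap%:E < flatness D x)%E].
    by apply/seteqP; split=> x /=; rewrite in_itv.
  apply: measurableI => //; rewrite -[X in measurable X]setTI.
  by apply: emeasurable_fun_o_infty => //; exact: (measurable_flatness r00 rho1 rD Drho).
have bS : bs1 (\1_S) by apply: (@bs1_indic_set _ _ 8 mS) => x [h _]; rewrite ler_norml.
have iS : \int[mu]_x \1_S x <= A / kap.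
  rewrite -lee_fin EFin_int1// (_ : (\int[mu]_x (\1_S x)%:E = mu S)%E).
    exact: (flatness_weak r00 rho1 rD Drho kap0).
  by rewrite integral_indic// setIT.
have n1 : (-1 : R) != 0 by rewrite oppr_eq0 oner_eq0.
apply: le_trans iS; have := int1_affine (al k) n1 bS; rewrite normrN1 invr1 mul1r => <-.
apply: le_int1; [|exact: bs1_affine|].
  apply: (@bs1_indic_set _ _ 4) => [|x [/Xle//]].
  apply: measurableI => //; rewrite -[X in measurable X]setTI.
  by apply: emeasurable_fun_o_infty => //; exact: measurable_flat.
move=> x; rewrite !indicE; case: (boolP (x \in _)) => // /set_mem [Xx /= h].
rewrite mem_set// /S/= mulN1r addrC; split; last exact: h.
by have := Xle Xx; have := al_pi k; have := @pi_le4 R; rewrite ler_norml; lra.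
Qed.

Definition Gsum (N : nat) (th : R) : \bar R := (\sum_(k <- ks N) (weight k)%:E * flat k th)%E.

Let B := A * (2 * (25 * Q) * 50 + 12 * (25 * Q)).

Lemma measurable_Gsum N : measurable_fun setT (Gsum N).
Proof. by apply: emeasurable_sum => k; apply: measurable_funeM; exact: measurable_flat. Qed.

Lemma Gsum_weak N lam : 0 < lam ->
  (mu (X `&` [set x | lam%:E < Gsum N x]) <= (B / lam)%:E)%E.
Proof.
move=> lam0; have mP : measurable (X `&` [set x | (lam%:E < Gsum N x)%E]).
  apply: measurableI => //; rewrite -[X in measurable X]setTI.
  by apply: emeasurable_fun_o_infty => //; exact: measurable_Gsum.
have bP : bs1 (\1_(X `&` [set x | (lam%:E < Gsum N x)%E])) by apply: (@bs1_indic_set _ _ 4 mP) => x [/Xle].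
rewrite (_ : mu _ = (\int[mu]_x (\1_(X `&` [set x | (lam%:E < Gsum N x)%E]) x)%:E)%E); last first.
  by rewrite integral_indic// setIT.
rewrite -EFin_int1// lee_fin; apply: (weak_sum mX Xle) => //.
- exact: measurable_flat.
- exact: flat_ge0.
- by move=> k; exact/ltW/weight_gt0.
- by rewrite mulr_gt0.
- exact: flat_weak.
Qed.

Lemma Gsum_mono x : {homo (fun N => Gsum N x) : m n / (m <= n)%N >-> (m <= n)%E}.
Proof.
move=> m n mn; rewrite /Gsum.
have -> : (\sum_(k <- ks m) (weight k)%:E * flat k x)%E =
  (\sum_(k <- ks n | k \in box m) (weight k)%:E * flat k x)%E.
  rewrite -[RHS]big_filter /ks; apply: perm_big; apply: uniq_perm; rewrite ?filter_uniq ?uniq_box//.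
  move=> k; rewrite !mem_filter !mem_box; case: (k != 0); rewrite ?andbF//=.
  by apply/idP/idP => [/andP[h1 h2]|/andP[]//]; rewrite h1 h2 (leq_trans h1)// (leq_trans h2).
rewrite [leRHS](bigID (mem (box m)))/= leeDl// sume_ge0// => k _.
by rewrite mule_ge0 ?flat_ge0// lee_fin ltW// weight_gt0.
Qed.

(** The supremum over every [N]; being independent of the radius, it can serve for all [R] at
    once. *)
Definition Gmax (x : R) : \bar R := esups (Gsum ^~ x) 0.

Lemma Gsum_le N x : (Gsum N x <= Gmax x)%E.
Proof. by apply: ereal_sup_ubound; exists N. Qed.

Lemma Gmax_ge0 x : (0 <= Gmax x)%E.
Proof.
apply: le_trans (Gsum_le 0 x); apply: sume_ge0 => k _.
by rewrite mule_ge0 ?flat_ge0// lee_fin ltW// weight_gt0.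
Qed.

Lemma measurable_Gmax : measurable_fun setT Gmax.
Proof. by apply: measurable_fun_esups => N; exact: measurable_Gsum. Qed.

(** The bound for [Gsum N] is uniform in [N] and the superlevel sets increase with [N], so it passes
    to their union. *)
Lemma Gmax_weak : exists B : R, forall lam, 0 < lam ->
  (mu (X `&` [set x | lam%:E < Gmax x]) <= (B / lam)%:E)%E.
Proof.
exists B => lam lam0; pose P N := X `&` [set x | (lam%:E < Gsum N x)%E].
have mP N : measurable (P N).
  apply: measurableI => //; rewrite -[X in measurable X]setTI.
  by apply: emeasurable_fun_o_infty => //; exact: measurable_Gsum.
have -> : X `&` [set x | (lam%:E < Gmax x)%E] = \bigcup_N P N.
  apply/seteqP; split=> [x [Xx /= /ereal_sup_gt [_ [N _ <-] h]]|x [N _ [Xx /= h]]].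
    by exists N.
  by split=> //=; exact: lt_le_trans h (Gsum_le _ _).
have nd : nondecreasing_seq P.
  move=> m n mn; apply/subsetPset => x [Xx /= h]; split=> //=.
  exact: lt_le_trans h (Gsum_mono _ mn).
have := @nondecreasing_cvg_mu _ _ _ mu P mP (bigcupT_measurable _ mP) nd.
by apply: cvge_le; apply: nearW => N /=; exact: Gsum_weak.
Qed.

End MaximalFunction.

(** * The bound for a single rotated set *)

Section RotatedBound.
Context {R : realType}.
Notation mu := (@lebesgue_measure R).
Local Notation rot := Defs.rot.
Variables (D : set (R * R)) (r0 rho eps : R) (al : int * int -> R).
Hypothesis r00 : 0 < r0.
Hypothesis r01 : r0 <= 1.
Hypothesis rho1 : 1 <= rho.
Hypothesis oD : open D.
Hypothesis cD : convex_set2 D.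
Hypothesis rD : forall z, nrm z <= r0 -> D z.
Hypothesis Drho : forall z, D z -> nrm z <= rho.
Hypothesis eps0 : 0 < eps.
Hypothesis al_polar : forall k, k != 0 ->
  (kr k : R * R) = (nrm (kr k : R * R) * cos (al k), nrm (kr k : R * R) * sin (al k)).

Variables (th gam : R).
Hypothesis Ggam : (Gmax D eps al th <= gam%:E)%E.

Let fl k : R := fine (flat D al k th).

(** Every weight is positive, so finiteness of [Gmax] at [th] makes each of its terms finite; the
    box of radius [max |k.1| |k.2|] already contains [k]. *)
Let flE k : k != 0 -> flat D al k th = (fl k)%:E.
Proof.
move=> k0; rewrite /fl fineK// ge0_fin_numE ?flat_ge0//.
have wfin : ((weight eps k)%:E * flat D al k th <= gam%:E)%E.
  apply: le_trans Ggam; apply: le_trans (Gsum_le D eps al (maxn `|k.1| `|k.2|) th).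
  have kin : k \in [seq i <- box (maxn `|k.1| `|k.2|) | i != 0].
    by rewrite mem_filter k0 mem_box leq_maxl leq_maxr.
  rewrite /Gsum (bigD1_seq k kin (filter_uniq _ (uniq_box _))).
  rewrite leeDl// sume_ge0// => i _.
  by rewrite mule_ge0 ?flat_ge0// lee_fin ltW// weight_gt0.
rewrite ltey; apply/eqP => E; move: wfin; rewrite E gt0_muley ?lte_fin ?weight_gt0//.
Qed.

Let fl1 k : k != 0 -> 1 <= fl k.
Proof. by move=> k0; rewrite -lee_fin -flE//; exact: flatness_ge1. Qed.

Let Gsum_fl N : \sum_(k <- box N | k != 0) weight eps k * fl k <= gam.
Proof.
rewrite -lee_fin; apply: le_trans Ggam; apply: le_trans (Gsum_le D eps al N th).
rewrite le_eqVlt; apply/orP; left; apply/eqP; rewrite -sumEFin -big_filter /Gsum.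
rewrite big_seq [RHS]big_seq; apply: eq_bigr => k; rewrite mem_filter => /andP[k0 _].
by rewrite flE.
Qed.

Let pw2_le_nrm k : k != 0 -> 4 ^+ lv k <= nrm (kr k : R * R) ^+ 2.
Proof.
move=> k0; rewrite (_ : 4 = 2 ^+ 2); last by ring.
rewrite exprAC lerXn2r ?nnegrE ?exprn_ge0 ?nrm_ge0//.
have M0 : (0 < maxn `|k.1| `|k.2|)%N.
  rewrite lt0n; apply: contra k0 => /eqP M0; move: (leq_maxl `|k.1| `|k.2|) (leq_maxr `|k.1| `|k.2|).
  by rewrite M0 !leqn0 !absz_eq0; case: k {M0} => i j /= /eqP -> /eqP ->.
have [h1 h2] := norm_le_nrm (kr k : R * R).
apply: (@le_trans _ _ (maxn `|k.1| `|k.2|)%:R).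
  by rewrite -natrX ler_nat; exact: (@trunc_logP 2).
have E (i : int) : `|i|%N%:R = `|i%:~R| :> R by rewrite -intr_norm -pmulrn.
by rewrite /maxn; case: ifP => _; rewrite E.
Qed.

(** [1 / |k|^2 <= 4 ^ (- lv k)], and this is [weight eps k] times [(lv k).+1] to the power
    [2 + 2 eps]: [1 + 2 eps] from [b] and 1 from the logarithmic factor. *)
Lemma sum_flat_le N (L : R) : (forall k, k \in box N -> (lv k).+1%:R <= L) ->
  \sum_(k <- box N | k != 0) fl k / nrm (kr k : R * R) ^+ 2 <= L `^ (2 + 2 * eps) * gam.
Proof.
move=> hL; apply: le_trans (_ : _ <= L `^ (2 + 2 * eps) * \sum_(k <- box N | k != 0) weight eps k * fl k) _.
  rewrite mulr_sumr big_seq_cond [leRHS]big_seq_cond; apply: ler_sum => k /andP[kN k0].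
  have f0 : 0 <= fl k by exact: le_trans ler01 (fl1 k0).
  rewrite mulrA mulrC; apply: ler_wpM2r => //.
  apply: (@le_trans _ _ (4 ^+ lv k)^-1).
    by rewrite lef_pV2 ?posrE ?exprn_gt0 ?nrm_gt0 ?kr_neq0// pw2_le_nrm.
  rewrite /weight powRN; set m := (lv k).+1%:R.
  have m0 : 0 < m :> R by rewrite /m ltr0n.
  rewrite mulrA ler_peMl ?invr_ge0 ?exprn_ge0// mulrA.
  rewrite -[X in _ <= X]mulrA -invfM ler_pdivlMr ?mul1r ?mulr_gt0 ?powR_gt0//.
  have -> : m `^ (1 + 2 * eps) * m = m `^ (2 + 2 * eps).
    by rewrite mulrC -(@mulr_powRB1 _ m (2 + 2 * eps)) ?ltW//; [congr (_ * _ `^ _); ring|have := eps0; lra].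
  by rewrite ge0_ler_powR ?nnegrE ?(ltW m0)//; [have := eps0; lra|exact: le_trans (ltW m0) (hL _ kN)|exact: hL].
by rewrite ler_wpM2l ?powR_ge0.
Qed.

Let Dt := rot_set th D.
Let c36 : R := 36 * rho.
Let f k := if k == 0 then 1 else c36 * fl k.

Let c361 : 1 <= c36. Proof. by rewrite /c36; have := rho1; lra. Qed.

Let f1 k : 1 <= f k.
Proof. by rewrite /f; case: eqP => // /eqP k0; rewrite mulr_ege1// fl1. Qed.

Let rDt z : nrm z <= r0 -> Dt z.
Proof. by move=> h; rewrite /Dt rot_setE /=; apply: rD; rewrite nrm_rot. Qed.

Let Dtrho z : Dt z -> nrm z <= rho.
Proof. by move=> [y Dy <-]; rewrite nrm_rot; exact: Drho. Qed.

Let Df k : k != 0 -> forall y y', Dt y -> Dt y' ->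
  dot (kr k) y = dot (kr k) y' -> dot (y.1 - y'.1, y.2 - y'.2) (y.1 - y'.1, y.2 - y'.2) <=
  f k * (supp Dt (kr k) - dot (kr k) y) / nrm (kr k : R * R).
Proof.
move=> k0 _ _ [y Dy <-] [y' Dy' <-]; have n0 := nrm_gt0 (kr_neq0 k0 : (kr k : R * R) != _).
rewrite [X in dot X _ = dot X _ -> _](al_polar k0) !dot_rot => /(mulfI (lt0r_neq0 n0)) E.
have -> : dot ((rot th y).1 - (rot th y').1, (rot th y).2 - (rot th y').2)
    ((rot th y).1 - (rot th y').1, (rot th y).2 - (rot th y').2) =
    dot (y.1 - y'.1, y.2 - y'.2) (y.1 - y'.1, y.2 - y'.2).
  rewrite -!sqr_nrm -(nrm_rot th (y.1 - y'.1, y.2 - y'.2)); congr (nrm (_, _) ^+ 2); rewrite /Defs.rot/=; ring.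
have := chord_flatness rho1 Drho _ Dy Dy' E; move=> /(_ (fl k)); rewrite -flE// => /(_ (lexx _)).
move=> /le_trans; apply.
have -> : supp Dt (kr k) = nrm (kr k : R * R) * hgt D (al k - th).
  by rewrite {1}(al_polar k0) (supp_rot th (al k) r00 rD Drho n0).
have -> : dot (kr k) (rot th y) = nrm (kr k : R * R) * dot (udir (al k - th)) y.
  by rewrite {1}(al_polar k0) dot_rot.
rewrite /f (negbTE k0) -mulrBr.
by rewrite mulrCA [leRHS]mulrAC mulfV ?mul1r// lt0r_neq0.
Qed.

Lemma unit_interval_bound (n : nat) (L : R) : (0 < n)%N ->
  (forall k, k \in box (n ^ 2) -> (lv k).+1%:R <= L) ->
  \int[mu]_t (\1_`[n%:R, n%:R + 1]%classic t * Eerr Dt t ^+ 2) <=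
  Kerr r0 rho * n%:R * (c36 * (L `^ (2 + 2 * eps) * gam)).
Proof.
move=> n0 hL.
apply: le_trans (mean_square_Eerr r00 r01 rho1 (@open_rot _ th _ oD) (@convex_rot _ th _ cD) rDt Dtrho f1 Df n0) _.
rewrite ler_wpM2l ?mulr_ge0 ?Kerr_ge0//.
apply: le_trans (_ : _ <= c36 * \sum_(k <- box (n ^ 2) | k != 0) fl k / nrm (kr k : R * R) ^+ 2) _.
  rewrite mulr_sumr; apply: ler_sum => k k0; by rewrite /f (negbTE k0) mulrA.
by rewrite ler_wpM2l ?sum_flat_le// (le_trans ler01 c361).
Qed.

Lemma ln2_ge : 2^-1 <= ln 2 :> R.
Proof.
have := @le_ln1Dx R (- 2^-1); rewrite (_ : 1 + - 2^-1 = 2^-1 :> R); last by field.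
by rewrite lnV ?posrE//; lra.
Qed.

(** Coordinates are at most [n^2 <= (3 r)^2 <= r^6], as [9 <= r^4]; with [ln 2 >= 1/2] this gives
    [lv k <= 12 ln r], and [1 <= 2 ln r] accounts for the successor. *)
Lemma level_le_ln (r : R) (n : nat) k : 2 <= r -> n%:R <= 3 * r -> k \in box (n ^ 2) ->
  (lv k).+1%:R <= 14 * ln r.
Proof.
move=> r2 nr kn; have l2 := ln2_ge; have rp : 0 < r by lra.
have lr : ln 2 <= ln r by rewrite ler_ln ?posrE//; lra.
suff : (lv k)%:R * ln 2 <= 6 * ln r.
  have : (lv k)%:R * 2^-1 <= (lv k)%:R * ln 2 :> R by rewrite ler_wpM2l.
  by rewrite -[(lv k).+1%:R]natr1; lra.
have [M0|M0] := posnP (maxn `|k.1| `|k.2|).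
  by rewrite /lv M0 trunc_log0 mul0r mulr_ge0//; lra.
have h : 2 ^+ lv k <= r ^+ 6.
  apply: (@le_trans _ _ ((3 * r) ^+ 2)).
    apply: (@le_trans _ _ (n%:R ^+ 2)); last by rewrite lerXn2r ?nnegrE//; lra.
    rewrite -!natrX ler_nat (leq_trans (@trunc_logP 2 _ isT M0))//.
    by move: kn; rewrite mem_box geq_max.
  have r4 : 9 <= r ^+ 4.
    by have : 2 ^+ 4 <= r ^+ 4 by [rewrite lerXn2r ?nnegrE//; lra]; rewrite (_ : 2 ^+ 4 = 16); [lra|ring].
  rewrite exprMn (_ : r ^+ 6 = r ^+ 4 * r ^+ 2); last by ring.
  by apply: ler_wpM2r; [exact: sqr_ge0|rewrite (_ : 3 ^+ 2 = 9)//; ring].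
have : ln (2 ^+ lv k) <= ln (r ^+ 6) by rewrite ler_ln ?posrE ?exprn_gt0.
have E (x : R) m : x *+ m = m%:R * x by rewrite mulr_natl.
by rewrite lnXn// lnXn// (E (ln 2)) (E (ln r)).
Qed.

(** The interval is covered by at most [3 h] unit intervals, all starting at integers below [3 r].
    With the 36 of [chord_flatness] this gives [324 = 36 * 3 * 3]. *)
Lemma interval_bound (r h : R) : 2 <= r -> 1 <= h <= r ->
  (\int[mu]_(t in [set` `[r, r + h]%R]) ((`|Eerr Dt t| ^+ 2)%:E) <=
   (324 * rho * Kerr r0 rho * 14 `^ (2 + 2 * eps) * gam * (h * r * ln r `^ (2 + 2 * eps)))%:E)%E.
Proof.
move=> r2 /andP[h1 hr]; pose a := Num.truncn r; pose J := (Num.truncn h).+2.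
have rp : 0 <= r by lra.
have /andP[ar ra] := truncn_itv rp.
have /andP[jh hj] := truncn_itv (le_trans ler01 h1).
rewrite -natr1 -/a in ra ar; rewrite -natr1 in hj.
have a2 : (2 <= a)%N by rewrite -ltnS -(ltr_nat R) -natr1; lra.
pose S t := \sum_(j < J) \1_(`[(a + j)%:R, (a + j)%:R + 1]%classic : set R) t * Eerr Dt t ^+ 2.
have bj (j : 'I_J) : bs1 (fun t => \1_(`[(a + j)%:R, (a + j)%:R + 1]%classic : set R) t * Eerr Dt t ^+ 2).
  have n0 : (0 < a + j)%N by rewrite addn_gt0; case: (a) a2.
  have b := bs1_Eerr r00 (@convex_rot _ th _ cD) rDt Dtrho n0.
  have := bs1_mul b b; congr bs1; apply/funext => t; rewrite expr2 indicE.
  by case: (_ \in _) => /=; rewrite ?mul0r// !mul1r.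
have bS : bs1 S by exact: bs1_sum.
have S0 t : 0 <= S t by apply: sumr_ge0 => j _; rewrite mulr_ge0 ?sqr_ge0// indicE.
have mE : measurable_fun `[r, r + h]%classic (Eerr Dt).
  by apply: (measurable_Eerr r00 (@convex_rot _ th _ cD) rDt Dtrho); lra.
apply: (@le_trans _ _ (\int[mu]_t (S t)%:E)%E).
  rewrite integral_mkcond; apply: ge0_le_integral => //.
  - by move=> t _; rewrite patchE; case: ifP => // _; rewrite lee_fin exprn_ge0.
  - have mEE : measurable_fun `[r, r + h]%classic (EFin \o (fun t => `|Eerr Dt t| ^+ 2)).
      by apply/measurable_EFinP; apply: measurable_funX; exact: measurableT_comp mE.
    exact: ((measurable_restrictT _ (measurable_itv _)).1 mEE).
  - by apply/measurable_EFinP; case: bS.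
  move=> t _; rewrite patchE; case: ifPn => [|_]; last by rewrite lee_fin.
  rewrite inE/= in_itv/= => /andP[t1 t2]; rewrite lee_fin real_normK ?num_real//.
  have tp : 0 <= t by lra.
  have /andP[mt tm] := truncn_itv tp; rewrite -natr1 in tm.
  have am : (a <= Num.truncn t)%N by rewrite -ltnS -(ltr_nat R) -natr1; lra.
  have mJ : (Num.truncn t - a < J)%N.
    by rewrite ltn_subLR// -(ltr_nat R) natrD /J -!natr1; lra.
  rewrite /S (bigD1 (Ordinal mJ))//= subnKC// ler_wpDr//.
    by apply: sumr_ge0 => j _; rewrite mulr_ge0 ?sqr_ge0// indicE.
  by rewrite indicE mem_set ?mul1r//= in_itv/=; lra.
rewrite -EFin_int1// lee_fin int1_sum//.
have lr0 : 0 <= ln r by apply: ln_ge0; lra.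
have gam0 : 0 <= gam by rewrite -lee_fin; exact: le_trans (Gmax_ge0 _ _ _ _) Ggam.
have K0 := Kerr_ge0 r0 rho1.
pose c := c36 * ((14 * ln r) `^ (2 + 2 * eps) * gam).
have c0 : 0 <= c.
  by rewrite /c mulr_ge0 ?(le_trans ler01 c361)// mulr_ge0 ?powR_ge0.
apply: (@le_trans _ _ (\sum_(j < J) Kerr r0 rho * (3 * r) * c)).
  apply: ler_sum => j _.
  have jr : (a + j)%:R <= 3 * r.
    by have := ltn_ord j; rewrite /J ltnS -(ler_nat R) -natr1 natrD; lra.
  apply: le_trans (@unit_interval_bound (a + j) (14 * ln r) _ _) _.
  - by rewrite addn_gt0; case: (a) a2.
  - by move=> k; exact: level_le_ln.
  by rewrite -/c; apply: ler_wpM2r => //; apply: ler_wpM2l.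
rewrite sumr_const card_ord -[leLHS]mulr_natr.
have Jh : J%:R <= 3 * h by rewrite /J -!natr1; lra.
apply: (@le_trans _ _ (Kerr r0 rho * (3 * r) * c * (3 * h))).
  apply: ler_wpM2l => //.
  exact: mulr_ge0 (mulr_ge0 K0 (mulr_ge0 (ler0n _ _) rp)) c0.
rewrite le_eqVlt; apply/orP; left; apply/eqP; rewrite /c /c36 powRM//; ring.
Qed.

End RotatedBound.

(** * The function of the angle and the final estimate *)

Lemma inscribed_circumscribed (R : realType) (D : set (R * R)) : open D -> bounded_set2 D ->
  D (0, 0) -> exists r0 rho : R, [/\ 0 < r0, r0 <= 1, 1 <= rho,
    (forall z, nrm z <= r0 -> D z) & (forall z, D z -> nrm z <= rho)].
Proof.
move=> oD [M DM] D0.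
have /nbhs_ballP [e /= e0 eD] := open_nbhs_nbhs (conj oD D0).
exists (Num.min 1 (e / 2)), (1 + 2 * `|M|); split.
- by rewrite lt_min ltr01 divr_gt0.
- by rewrite ge_min lexx.
- by rewrite lerDl mulr_ge0.
- move=> z; rewrite le_min => /andP[_ ze]; have [h1 h2] := norm_le_nrm z.
  by apply: eD; split; rewrite /ball/= sub0r normrN; lra.
- move=> z /DM[h1 h2]; apply: le_trans (nrm_le_sum z) _; have := ler_norm M; lra.
Qed.

Lemma measurable_sqrte (R : realType) (f : R -> \bar R) :
  (forall x, 0 <= f x)%E -> measurable_fun setT f -> measurable_fun setT (fun x => sqrte (f x)).
Proof.
move=> f0 mf; rewrite (_ : (fun x => _) = (fun y => poweR y 2^-1) \o f).
  exact: measurableT_comp (measurable_poweR _) mf.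
by apply/funext => x /=; rewrite poweR12_sqrt.
Qed.

Theorem theorem1p4 (R : realType) (Omega : set (R * R)) (eps : R) :
  open Omega -> convex_set2 Omega -> bounded_set2 Omega -> Omega (0, 0) ->
  0 < eps ->
  exists C : R -> \bar R,
    (forall th, - pi <= th <= pi -> (0 <= C th)%E) /\
    weak_L2 C /\
    forall th r h : R, - pi <= th <= pi -> 2 <= r -> 1 <= h <= r ->
      (Gmean (rot_set th Omega) r h <=
         C th * (r `^ (2^-1) * ln r `^ (1 + eps))%:E)%E.
Proof.
move=> oO cO bO O0 eps0.
have [r0 [rho [r00 r01 rho1 rO Orho]]] := inscribed_circumscribed oO bO O0.
have [al hal] := @polar_angles R.
have al_pi k : - pi <= al k <= pi := (hal k).1.
have al_polar k := (hal k).2.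
(* The added 1 makes [K] positive, so [K * G] is infinite wherever [G] is. *)
pose K : R := 324 * rho * Kerr r0 rho * 14 `^ (2 + 2 * eps) + 1.
have K0 : 0 <= 324 * rho * Kerr r0 rho * 14 `^ (2 + 2 * eps).
  have rho0 : 0 <= rho := le_trans ler01 rho1.
  exact: mulr_ge0 (mulr_ge0 (mulr_ge0 (ler0n _ _) rho0) (Kerr_ge0 _ rho1)) (powR_ge0 _ _).
have Kp : 0 < K by rewrite /K ltr_wpDl.
pose G th := Gmax Omega eps al th; pose C2 th := (K%:E * G th)%E.
have G0 th : (0 <= G th)%E by exact: Gmax_ge0.
have C20 th : (0 <= C2 th)%E by rewrite mule_ge0// lee_fin ltW.
have mG : measurable_fun setT G := measurable_Gmax eps al r00 rho1 rO Orho.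
(* Taking the square root turns the weak [L^1] bound of [G] into the weak [L^2] bound required. *)
exists (fun th => sqrte (C2 th)); split; first by move=> th _; exact: sqrte_ge0.
split.
  split; first by apply: measurable_funTS; apply: measurable_sqrte => //; exact: measurable_funeM.
  have [B GB] := Gmax_weak r00 rho1 rO Orho eps0 al_pi.
  exists (B * K) => s s0; under eq_set do rewrite sqr_sqrte//.
  have sK : 0 < s / K by rewrite divr_gt0.
  have := GB _ sK; set P := (X in lebesgue_measure X); set P' := [set th | _].
  have <- : P = P'.
    apply/seteqP; split=> [x [Xx /= h]|x [Xx h]].
      split=> //; rewrite /C2 -lte_pdivrMl// -EFinM mulrC.
      exact: h.
    split=> //=; move: h; rewrite /C2 -lte_pdivrMl// -EFinM mulrC.
    exact.
  move=> h; have s0' : (0 <= s%:E)%E by rewrite lee_fin ltW.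
  apply: le_trans (lee_wpmul2l s0' h) _.
  by rewrite -EFinM invf_div mulrCA (mulrCA s) divff ?mulr1// gt_eqF.
move=> th r h thpi r2 h1; rewrite /Gmean.
have lr : 0 < ln r by apply: ln_gt0; lra.
have rp : 0 < r by lra.
set q := r `^ 2^-1 * ln r `^ (1 + eps).
have q0 : 0 < q by rewrite mulr_gt0// powR_gt0.
have hp : 0 < h by lra.
(* Where [G] is infinite, the right-hand side is infinite because [q > 0]; elsewhere [G th] itself
   can serve as the real bound [gam]. *)
have [Gfin|] := boolP (G th \is a fin_num); last first.
  rewrite ge0_fin_numE// -leNgt leye_eq => /eqP Ginf.
  by rewrite /C2 Ginf gt0_muley ?lte_fin//= gt0_mulye ?lte_fin// leey.
have Ggam : (Gmax Omega eps al th <= (fine (G th))%:E)%E by rewrite fineK.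
have := interval_bound r00 r01 rho1 oO cO rO Orho eps0 al_polar Ggam r2 h1.
set I := (\int[_]_(_ in _) _)%E; set gam := fine (G th) => IB.
have gam0 : 0 <= gam by exact: fine_ge0.
have qE : q ^+ 2 = r * ln r `^ (2 + 2 * eps).
  rewrite /q exprMn -!powR_mulrn ?powR_ge0// -!powRrM mulVf// powRr1 ?(ltW rp)//.
  by congr (_ * _ `^ _); ring.
have -> : (sqrte (C2 th) * q%:E = sqrte (K * gam * q ^+ 2)%:E)%E.
  rewrite /C2 -(fineK Gfin) -/gam -EFinM [in RHS]EFinM sqrteM ?lee_fin ?mulr_ge0// ?(ltW Kp)//.
  by rewrite EFin_expe sqrte_sqr gee0_abs// lee_fin ltW.
have R0 : 0 <= K * gam * q ^+ 2 := mulr_ge0 (mulr_ge0 (ltW Kp) gam0) (sqr_ge0 _).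
rewrite lee_sqrt ?lee_fin//.
rewrite -lee_pdivlMl ?invr_gt0// invrK -EFinM; apply: le_trans IB _; rewrite lee_fin qE.
rewrite /K; have x0 : 0 <= h * (gam * (r * ln r `^ (2 + 2 * eps))).
  by rewrite !mulr_ge0 ?powR_ge0// ltW.
move: (324 * _ * _ * _) x0 => c; move: (ln r `^ _) => l; lra.
Qed.
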